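(* Let $(X,\omega)$ be a compact Hermitian manifold of complex dimension $n$, with geodesic distance $d$ associated to $\omega$. Let $\kappa:[0,l]\to\mathbb{R}^+$ be a modulus of continuity such that $$\exists A>0,\qquad \limsup_{t\to0^+}\frac{4n\,\kappa(At)}{A\,\kappa(t)}<1 ,$$ and let $\varphi:X\to\mathbb{R}$ be a bounded $\omega$-plurisubharmonic function on $X$. Assume that for any point $x_0\in X$ there exist a local chart $(U,F)$ centered at $x_0$ and constants $C_1>0$ and $0<\delta_1\ll1$ such that for any $0<\delta<\delta_1$ and any $x\in U$ at which $\mathcal{R}_\delta\varphi$ is defined (i.e. $x\in U_\delta$), $$\mathcal{R}_\delta\varphi(x)-\varphi(x)\le C_1\,\kappa(\delta),$$ where $\mathcal{R}_\delta\varphi$ is the local regularization of $\varphi$ in the chart $U$. Then there exists a constant $C_2>0$ such that for any $x,y\in X$ (with $d(x,y)\le l$, so that the right-hand side is defined), $$|\varphi(x)-\varphi(y)|\le C_2\,\kappa(d(x,y)).$$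
   Context: A modulus of continuity is a continuous increasing subadditive function $\kappa:[0,l]\to\mathbb{R}^+$ ($l>0$) with $\kappa(0)=0$. A function $\varphi$ is $\omega$-plurisubharmonic if it is locally the sum of a smooth function and a plurisubharmonic function and $\omega+dd^c\varphi\ge0$ in the sense of currents. Local regularization: a local chart $(U,F)$ centered at $x_0$ is a biholomorphism $F:U\to\Omega$ from a neighbourhood $U$ of $x_0$ onto a bounded domain $\Omega\Subset\mathbb{C}^n$ with $F(x_0)=0$. Put $\Omega_\delta:=\{z\in\Omega:\operatorname{dist}(z,\partial\Omega)>\delta\}$ and $U_\delta:=F^{-1}(\Omega_\delta)$. For $x\in U_\delta$, $\mathcal{R}_\delta\varphi(x):=(\varphi\circ F^{-1})_\delta(F(x))$, where for a function $v$ on $\Omega$ and $z\in\Omega_\delta$ the standard regularization is $$v_\delta(z):=\int_{\mathbb{B}}v(z+\delta\xi)\rho(\xi)\,d\lambda(\xi),$$ with $\mathbb{B}$ the unit ball of $\mathbb{C}^n=\mathbb{R}^{2n}$, $\lambda$ Lebesgue measure, and $\rho\ge0$ a fixed radial bounded Borel function with compact support in the unit ball and $\int_{\mathbb{B}}\rho\,d\lambda=1$. *)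

(* Defs.v *)
From HB Require Import structures.
From mathcomp Require Import all_boot all_order all_algebra.
From mathcomp Require Import complex.
From mathcomp Require Import all_classical all_reals all_analysis.

Set Implicit Arguments.
Unset Strict Implicit.
Unset Printing Implicit Defensive.
Import Order.TTheory GRing.Theory Num.Theory numFieldNormedType.Exports.

Local Open Scope classical_set_scope.
Local Open Scope ring_scope.
Local Open Scope sesquilinear_scope.

(* Needed to infer the topology of 'rV[R[i]]_n. *)
HB.instance Definition _ (R : rcfType) := NormedModule.copy R[i] R[i]^o.

Notation Cn R n := 'rV[R[i]]_n (only parsing).

(* The norm of the normed module 'rV[R[i]]_n is the sup norm, and is
   R[i]-valued. It has the right topology, but balls and distances below are
   Euclidean. *)
Definition enorm (R : realType) (n : nat) (z : Cn R n) : R :=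
  Num.sqrt (\sum_j (complex.Re (z ord0 j) ^+ 2 + complex.Im (z ord0 j) ^+ 2)).

Definition uball (R : realType) (n : nat) : set (Cn R n) :=
  [set z | enorm z < 1].

Lemma measurable_cons_pair (R : realType) (m : nat) :
  measurable_fun [set: m.-tuple R * R]
    (fun p => [the m.+1.-tuple R of p.2 :: p.1]).
Proof. exact: measurable_cons. Qed.

Fixpoint lebesgue_tuple (R : realType) (m : nat) :
    {measure set (m.-tuple R) -> \bar R} :=
  match m with
  | 0%N => dirac [tuple]
  | m'.+1 => measure_function_pushforward__canonical__measure_function_Measure
      (lebesgue_tuple R m' \x @lebesgue_measure R)%E
      (@measurable_cons_pair R m')
  end.

Definition of_real_coords (R : realType) (n : nat) (t : (n + n).-tuple R) :
    Cn R n :=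
  \row_j (tnth t (lshift n j) +i* tnth t (rshift n j))%C.

Definition Cintegral (R : realType) (n : nat) (D : set (Cn R n))
    (f : Cn R n -> R) : R :=
  (\int[lebesgue_tuple R (n + n)]_(t in @of_real_coords R n @^-1` D)
     f (of_real_coords t))%R.

(* The sigma-algebra of (n + n).-tuple R is the Borel sigma-algebra of R^(2n). *)
Definition borel_fun (R : realType) (n : nat) (f : Cn R n -> R) : Prop :=
  measurable_fun [set: (n + n).-tuple R] (f \o @of_real_coords R n).

(* C^n is a normed module over R[i] only, so derivatives of real-valued
   functions along real directions are taken through t |-> f (z + t v). *)
Definition rderivable (R : realType) (n : nat) (f : Cn R n -> R)
    (v z : Cn R n) : Prop :=
  derivable (fun t : R => f (z + t%:C%C *: v)) 0 1.

Definition rderive (R : realType) (n : nat) (f : Cn R n -> R)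
    (v z : Cn R n) : R :=
  'D_1 (fun t : R => f (z + t%:C%C *: v)) 0.

Fixpoint Ck_on (R : realType) (n k : nat) (V : set (Cn R n))
    (f : Cn R n -> R) : Prop :=
  (forall z, V z -> {for z, continuous f}) /\
  match k with
  | 0%N => True
  | k'.+1 => forall v, (forall z, V z -> rderivable f v z) /\
                       Ck_on k' V (rderive f v)
  end.

Definition smooth_on (R : realType) (n : nat) (V : set (Cn R n))
    (f : Cn R n -> R) : Prop := forall k, Ck_on k V f.

(* D_xi^2 f + D_(i xi)^2 f, which is
   4 \sum_(j, k) (d^2 f / dz_j dzbar_k) xi_j (xi_k)^*. *)
Definition levi (R : realType) (n : nat) (f : Cn R n -> R)
    (xi z : Cn R n) : R :=
  rderive (rderive f xi) xi z +
  rderive (rderive f ('i%C *: xi)) ('i%C *: xi) z.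

(* [differentiable] is over the scalar field R[i]. *)
Definition holomorphic_on (R : realType) (n : nat) (V : set (Cn R n))
    (f : Cn R n -> Cn R n) : Prop :=
  forall z, V z -> differentiable f z.

Definition expi (R : realType) (t : R) : R[i] := (cos t +i* sin t)%C.

(* V is meant to be open; the constant function -oo is allowed. *)
Definition psh_on (R : realType) (n : nat) (V : set (Cn R n))
    (u : Cn R n -> \bar R) : Prop :=
  [/\ forall z, V z -> (u z < +oo)%E,
      forall z, V z -> forall a : R, (u z < a%:E)%E ->
        \forall w \near z, (u w < a%:E)%E &
      forall a xi : Cn R n,
        (forall zeta : R[i], `|zeta| <= 1 -> V (a + zeta *: xi)) ->
        ((2 * pi)%R%:E * u a <=
          \int[@lebesgue_measure R]_(t in `[0%R, (2 * pi)%R])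
             u (a + expi t *: xi)%R)%E].

(* [fwd] and [bwd] are total; only their values on [dom] and [cod] matter. *)
Record chart (R : realType) (n : nat) (X : Type) := Chart {
  dom : set X;
  cod : set (Cn R n);
  fwd : X -> Cn R n;
  bwd : Cn R n -> X }.

Definition is_chart (R : realType) (n : nat) (X : topologicalType)
    (c : chart R n X) : Prop :=
  [/\ open (dom c) /\ open (cod c),
      forall x, dom c x -> cod c (fwd c x) /\ bwd c (fwd c x) = x,
      forall z, cod c z -> dom c (bwd c z) /\ fwd c (bwd c z) = z,
      forall x, dom c x -> {for x, continuous (fwd c)} &
      forall z, cod c z -> {for z, continuous (bwd c)}].

Definition chart_overlap (R : realType) (n : nat) (X : Type)
    (c c' : chart R n X) : set (Cn R n) :=
  [set z | cod c z /\ dom c' (bwd c z)].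

Definition transition (R : realType) (n : nat) (X : Type)
    (c c' : chart R n X) : Cn R n -> Cn R n := fwd c' \o bwd c.

Definition compatible (R : realType) (n : nat) (X : Type)
    (c c' : chart R n X) : Prop :=
  holomorphic_on (chart_overlap c c') (transition c c') /\
  holomorphic_on (chart_overlap c' c) (transition c' c).

(* The atlas is maximal: its elements are exactly the biholomorphisms from an
   open set of X onto an open set of C^n. *)
Record complex_structure (R : realType) (n : nat) (X : topologicalType) :=
  ComplexStructure {
    atlas : set (chart R n X);
    atlas_chart : forall c, atlas c -> is_chart c;
    atlas_cover : forall x, exists2 c, atlas c & dom c x;
    atlas_compatible : forall c c', atlas c -> atlas c' -> compatible c c';
    atlas_maximal : forall c, is_chart c ->
      (forall c', atlas c' -> compatible c c') -> atlas c }.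

Definition mfd_smooth_on (R : realType) (n : nat) (X : topologicalType)
    (S : complex_structure R n X) (V : set X) (f : X -> R) : Prop :=
  forall c, atlas S c ->
    smooth_on [set z | cod c z /\ V (bwd c z)] (f \o bwd c).

Definition mfd_psh_on (R : realType) (n : nat) (X : topologicalType)
    (S : complex_structure R n X) (V : set X) (u : X -> \bar R) : Prop :=
  forall c, atlas S c ->
    psh_on [set z | cod c z /\ V (bwd c z)] (u \o bwd c).

Definition hform (R : realType) (n : nat) (H : 'M[R[i]]_n) (v : Cn R n) :
  R[i] := (v *m H *m v ^t*) ord0 ord0.

(* [metric g c z] is the matrix h of the metric in the chart c at the point of
   coordinates z: the fundamental form is
     omega = (i/2) \sum_(j, k) h_jk dz_j /\ dzbar_k
   and the squared length of a tangent vector v is \sum_(j, k) h_jk v_j (v_k)^*.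
   Vectors are rows, so the differential of f at z is v |-> v *m jacobian f z. *)
Record hermitian_metric (R : realType) (n : nat) (X : topologicalType)
    (S : complex_structure R n X) := HermitianMetric {
  metric : chart R n X -> Cn R n -> 'M[R[i]]_n;
  metric_hermitian : forall c z, atlas S c -> cod c z ->
    (metric c z) ^t* = metric c z;
  metric_posdef : forall c z, atlas S c -> cod c z ->
    forall v : Cn R n, v != 0 -> 0 < hform (metric c z) v;
  metric_smooth : forall c, atlas S c -> forall j k,
    smooth_on (cod c) (fun z => complex.Re (metric c z j k)) /\
    smooth_on (cod c) (fun z => complex.Im (metric c z j k));
  metric_transition : forall c c', atlas S c -> atlas S c' ->
    forall z, chart_overlap c c' z ->
    let J := jacobian (transition c c') z in
    metric c z = J *m metric c' (transition c c' z) *m J ^t* }.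

Definition hnorm (R : realType) (n : nat) (H : 'M[R[i]]_n) (v : Cn R n) : R :=
  Num.sqrt (complex.Re (hform H v)).

(* C^1 curves on [0, 1] are given by a C^1 extension to the real line. *)
Definition C1_curve (R : realType) (n : nat) (gamma : R -> Cn R n) : Prop :=
  forall j,
    let x (t : R) : R := complex.Re (gamma t ord0 j) in
    let y (t : R) : R := complex.Im (gamma t ord0 j) in
    [/\ forall t, derivable x t 1, forall t, derivable y t 1,
        continuous (derive1 x) & continuous (derive1 y)].

Definition velocity (R : realType) (n : nat) (gamma : R -> Cn R n) (t : R) :
    Cn R n :=
  \row_j (derive1 (fun s : R => complex.Re (gamma s ord0 j)) t +i*
          derive1 (fun s : R => complex.Im (gamma s ord0 j)) t)%C.

(* [curve_length g x y L]: some piecewise C^1 curve from x to y has length L.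
   The curve is cut into finitely many C^1 pieces, each one contained in the
   domain of a chart. *)
Inductive curve_length (R : realType) (n : nat) (X : topologicalType)
    (S : complex_structure R n X) (g : hermitian_metric S) :
    X -> X -> R -> Prop :=
| curve_length_nil x : curve_length g x x 0
| curve_length_cons (c : chart R n X) (gamma : R -> Cn R n) (y : X) (L : R) :
    atlas S c -> C1_curve gamma ->
    (forall t, 0 <= t <= 1 -> cod c (gamma t)) ->
    curve_length g (bwd c (gamma 1)) y L ->
    curve_length g (bwd c (gamma 0)) y
      ((\int[@lebesgue_measure R]_(t in `[0%R, 1%R])
          hnorm (metric g c (gamma t)) (velocity gamma t))%R + L).

(* +oo between points of distinct connected components *)
Definition geodesic_dist (R : realType) (n : nat) (X : topologicalType)
    (S : complex_structure R n X) (g : hermitian_metric S) (x y : X) : \bar R :=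
  ereal_inf [set L%:E | L in curve_length g x y].

Definition test_function (R : realType) (n : nat) (V : set (Cn R n))
    (chi : Cn R n -> R) : Prop :=
  [/\ smooth_on setT chi, compact (closure [set z | chi z != 0]) &
      closure [set z | chi z != 0] `<=` V].

(* omega + dd^c phi >= 0 as a current, where dd^c = 2 i d dbar. A (1,1)-current
   (i/2) \sum_(j, k) T_jk dz_j /\ dzbar_k is positive when, for every xi,
   the distribution \sum_(j, k) T_jk xi_j (xi_k)^* is nonnegative; here
   T_jk = h_jk + 4 d^2 phi / dz_j dzbar_k. *)
Definition ddc_current_ge0 (R : realType) (n : nat) (X : topologicalType)
    (S : complex_structure R n X) (g : hermitian_metric S) (phi : X -> R) :
    Prop :=
  forall c, atlas S c -> forall (xi : Cn R n) (chi : Cn R n -> R),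
    test_function (cod c) chi -> (forall z, 0 <= chi z) ->
    0 <= Cintegral (cod c) (fun z =>
           complex.Re (hform (metric g c z) xi) * chi z +
           phi (bwd c z) * levi chi xi z).

Definition omega_psh (R : realType) (n : nat) (X : topologicalType)
    (S : complex_structure R n X) (g : hermitian_metric S) (phi : X -> R) :
    Prop :=
  (forall x0, exists (V : set X) (s : X -> R) (u : X -> \bar R),
     [/\ open V /\ V x0, mfd_smooth_on S V s, mfd_psh_on S V u &
         forall x, V x -> (phi x)%:E = ((s x)%:E + u x)%E]) /\
  ddc_current_ge0 g phi.

(* "Increasing" is taken in the weak sense. For such a kappa, positivity on
   ]0, l] only excludes kappa = 0, for which kappa (A t) / kappa t has no
   meaning; a strictly increasing kappa satisfies both conditions. *)
Record modulus_of_continuity (R : realType) (l : R) (kappa : R -> R) : Prop :=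
  ModulusOfContinuity {
    modulus_cont : {within `[0, l], continuous kappa};
    modulus_le : forall s t, 0 <= s -> s <= t -> t <= l -> kappa s <= kappa t;
    modulus_subadd : forall s t, 0 <= s -> 0 <= t -> s + t <= l ->
      kappa (s + t) <= kappa s + kappa t;
    modulus0 : kappa 0 = 0;
    modulus_gt0 : forall t, 0 < t -> t <= l -> 0 < kappa t }.

Record regularizing_kernel (R : realType) (n : nat) (rho : Cn R n -> R) :
    Prop := RegularizingKernel {
  kernel_ge0 : forall xi, 0 <= rho xi;
  kernel_radial : forall xi eta, enorm xi = enorm eta -> rho xi = rho eta;
  kernel_bounded : exists M, forall xi, rho xi <= M;
  kernel_borel : borel_fun rho;
  kernel_compact : compact (closure [set xi | rho xi != 0]);
  kernel_support : closure [set xi | rho xi != 0] `<=` @uball R n;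
  kernel_mass : Cintegral (@uball R n) rho = 1 }.

Definition regularization (R : realType) (n : nat) (rho : Cn R n -> R)
    (delta : R) (v : Cn R n -> R) (z : Cn R n) : R :=
  Cintegral (@uball R n) (fun xi => v (z + delta%:C%C *: xi) * rho xi).

(* Points of W at distance > delta from the boundary of W; the distance to an
   empty boundary is +oo. *)
Definition shrink (R : realType) (n : nat) (W : set (Cn R n)) (delta : R) :
    set (Cn R n) :=
  [set z | W z /\ (delta%:E <
     ereal_inf [set (enorm (z - w))%:E | w in closure W `\` interior W])%E].

Definition centered_chart (R : realType) (n : nat) (X : topologicalType)
    (S : complex_structure R n X) (x0 : X) (c : chart R n X) : Prop :=
  [/\ atlas S c, dom c x0, fwd c x0 = 0, connected (cod c) &
      exists M, forall z, cod c z -> enorm z <= M].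

Definition chart_shrink (R : realType) (n : nat) (X : Type)
    (c : chart R n X) (delta : R) : set X :=
  [set x | dom c x /\ shrink (cod c) delta (fwd c x)].

Definition local_regularization (R : realType) (n : nat) (X : Type)
    (rho : Cn R n -> R) (c : chart R n X) (delta : R) (phi : X -> R) (x : X) :
    R :=
  regularization rho delta (phi \o bwd c) (fwd c x).

(* Main.v *)
Require Import Defs.
From HB Require Import structures.
From mathcomp Require Import all_boot all_order all_algebra.
From mathcomp Require Import complex ring lra measurable_realfun.
From mathcomp Require Import all_classical all_reals all_analysis.
Set Implicit Arguments.
Unset Strict Implicit.
Unset Printing Implicit Defensive.
Import Order.TTheory GRing.Theory Num.Theory numFieldNormedType.Exports.
Local Open Scope classical_set_scope.
Local Open Scope ring_scope.

(** The proof works in a ball around 0 of a chart (U, F).  Put g = phi o F^-1, let M bound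
|phi|, and extend g + M by 0 outside the ball to a bounded Borel function U >= 0.

Submean inequality.  Write phi = s + u with s smooth and u plurisubharmonic.  Since s is
Lipschitz near 0, the mean of U over a circle of radius at most d centered at x is at least
U(x) - L d ([quasi_psh_local]); this error is harmless because t <= c kappa(t)
([lin_le_kappa]).

From the regularization to ball means.  The hypothesis bounds the averages of U against
the dilates of rho from above.  As rho is only a bounded radial function, average it over
all dilates: K(z) = \int_1^oo rho(s z) ds is radial, integrable, nonincreasing along rays,
and hence at least some c > 0 on a punctured ball of radius a.  So K - c 1_(B(0,a)) is a
nonnegative radial weight (up to a null set), against which the submean inequality gives a
lower bound; subtracting it from the upper bound for the weight K leaves an upper bound for
the mean of U over the ball B(x, a d), namely U(x) + C (kappa(d) + L d) ([ball_mean]).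

Oscillation decay.  Let r = a d and t = |y - x| <= r / 2.  The ball B(y, r - t) is contained
in B(x, r), and fills it up to a proportion O(t / r).  Comparing the submean inequality at y
with the bound of the mean over B(x, r) yields, for any m >= 0 with U >= U(x) - m on B(x, r),
  U(y) - U(x) <= C kappa(d) + C L d + C m t / r          ([osc_step]).

Scales.  The condition on the upper limit makes kappa contract under dilation by A: kappa(A t)
<= (A / 4) kappa(t), which iterates to kappa(B t) <= e B kappa(t) for any e > 0 and a suitable
B >= 2 ([kappa_scale]).  Use the oscillation estimate with r = B t and m = Q kappa(B t), the
bound already known at the scale B t: the last term is at most C Q kappa(B t) / B <=
C e Q kappa(t), and with C e <= 1/2 a fixed constant Q reproduces itself at the scale t
([scale_induction], [local_modulus]).

Geometry.  In a chart the metric dominates the Euclidean one ([metric_lower]).  Therefore the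
chart distance to x, truncated so that it is constant far from x, grows along any piecewise
C^1 curve by at most a constant times the length ([trunc_dist_curve_length]), and the geodesic
distance to x dominates the chart distance to x ([chart_dist_le]).  This gives the estimate
near each point, compactness makes it uniform, and for distances bounded below boundedness of
phi suffices. *)

(** * Lebesgue measure under affine maps of the line *)

Section Lebesgue1.
Context (R : realType).
Local Notation mu := (@lebesgue_measure R).

Lemma measurable_addr (a : R) :
  measurable_fun [set: measurableTypeR R] (fun x : measurableTypeR R => (x + a : measurableTypeR R)).
Proof. exact: measurable_funD. Qed.

Lemma measurable_mulr (s : R) :
  measurable_fun [set: measurableTypeR R] (fun x : measurableTypeR R => (s * x : measurableTypeR R)).
Proof. exact: measurable_funM. Qed.

Lemma lebesgue_measureD (a : R) (A : set R) : measurable A ->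
  mu ((fun x => x + a) @^-1` A) = mu A.
Proof.
move=> mA.
pose nu : {measure set (measurableTypeR R) -> \bar R} :=
  measure_function_pushforward__canonical__measure_function_Measure mu (measurable_addr a).
suff -> : mu A = nu A by [].
apply: lebesgue_measure_unique mA => X [[x y] xy <-].
rewrite /nu /= /pushforward.
have -> : (fun t => t + a) @^-1` `]x, y] = `]x - a, y - a]%classic :> set R.
  by apply/seteqP; split=> t /=; rewrite !in_itv /= ltrBlDr lerBrDr.
rewrite !lebesgue_measure_itv /= !lte_fin ltrD2r.
by case: ifP => // _; rewrite -!EFinD; congr (_%:E); ring.
Qed.

Lemma lebesgue_measureM (s : R) (A : set R) : 0 < s -> measurable A ->
  mu A = (s%:E * mu ((fun x : R => (s * x)%R) @^-1` A))%E.
Proof.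
move=> s0 mA.
pose nu0 : {measure set (measurableTypeR R) -> \bar R} :=
  measure_function_pushforward__canonical__measure_function_Measure mu (measurable_mulr s).
pose nu : {measure set (measurableTypeR R) -> \bar R} := mscale (NngNum (ltW s0)) nu0.
suff -> : mu A = nu A by [].
apply: lebesgue_measure_unique mA => X [[x y] xy <-].
rewrite /nu /= /mscale /nu0 /= /pushforward.
have -> : (fun t => s * t) @^-1` `]x, y] = `]s^-1 * x, s^-1 * y]%classic :> set R.
  by apply/seteqP; split=> t /=; rewrite !in_itv /= ltr_pdivrMl // ler_pdivlMl.
rewrite !lebesgue_measure_itv /= !lte_fin ltr_pM2l ?invr_gt0//.
case: ifP => _; last by rewrite mule0.
by rewrite -?EFinB -?EFinM -mulrBr mulrA divff ?gt_eqF ?mul1r.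
Qed.

Lemma ge0_integralDr (a : R) (f : R -> \bar R) :
  measurable_fun [set: R] f -> (forall x, 0 <= f x)%E ->
  (\int[mu]_x f (x + a)%R = \int[mu]_x f x)%E.
Proof.
move=> mf f0.
transitivity (\int[pushforward mu (fun x : measurableTypeR R => (x + a)%R : measurableTypeR R)]_x f x)%E.
  by rewrite (ge0_integral_pushforward (measurable_addr a)).
apply: eq_measure_integral => //=; first exact: measurable_addr.
by move=> ? A mA _; exact: lebesgue_measureD.
Qed.

Lemma ge0_integralMl (s : R) (f : R -> \bar R) : 0 < s ->
  measurable_fun [set: R] f -> (forall x, 0 <= f x)%E ->
  (\int[mu]_x f x = s%:E * \int[mu]_x f (s * x)%R)%E.
Proof.
move=> s0 mf f0.
have -> : (\int[mu]_x f (s * x)%R = \int[pushforward mu (fun x : measurableTypeR R => (s * x)%R : measurableTypeR R)]_x f x)%E.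
  by rewrite (ge0_integral_pushforward (measurable_mulr s)).
have ms := measurable_mulr s.
rewrite -(ge0_integral_mscale _ _ (NngNum (ltW s0))) //=.
apply: eq_measure_integral => A mA _.
by rewrite /mscale /= /pushforward; exact: lebesgue_measureM.
Qed.

End Lebesgue1.

(** * Lebesgue measure of R^m: translations, dilations, shears *)

Section LebesgueTuple.
Context (R : realType).

Definition tbox (m k : nat) : set (m.-tuple R) :=
  [set t | forall i, - k%:R <= tnth t i <= k%:R].
Arguments tbox : clear implicits.

Lemma measurable_tbox m k : measurable (tbox m k).
Proof.
have -> : tbox m k = \bigcap_(i in [set: 'I_m])
    ((fun t => tnth t i) @^-1` `[- k%:R, k%:R]).
  by apply/seteqP; split=> t /= H i; [move=> _|]; have := H i; rewrite /= in_itv /=; apply.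
apply: fin_bigcap_measurable => // i _.
rewrite -[X in measurable X]setTI.
by apply: measurable_tnth => //; exact: measurable_itv.
Qed.

Lemma preimage_cons_tbox m k :
  (fun p : m.-tuple R * measurableTypeR R => [the m.+1.-tuple R of (p.2 : R) :: p.1]) @^-1` tbox m.+1 k
  = tbox m k `*` `[- k%:R, k%:R]%classic.
Proof.
apply/seteqP; split=> -[t h] /=.
  move=> H; split=> [i|]; last by have := H ord0; rewrite tnth0 /= in_itv.
  by have := H (lift ord0 i); rewrite tnthS.
move=> [H]; rewrite in_itv /= => hh i.
have [j ->|->] := unliftP ord0 i; first by rewrite tnthS.
by rewrite tnth0.
Qed.

Lemma lebesgue_tuple_tbox m k : (lebesgue_tuple R m (tbox m k) < +oo)%E.
Proof.
elim: m => [|m IH].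
  by rewrite /= diracE; case: (_ \in _); rewrite ltry.
rewrite /= /pushforward preimage_cons_tbox.
rewrite product_measure1E //; first last.
- exact: measurable_tbox.
rewrite lte_mul_pinfty //.
  by rewrite ge0_fin_numE.
have -> : forall A, lebesgue_measure_lebesgue_measure__canonical__measure_function_SigmaFiniteMeasure R A = lebesgue_measure A by [].
by rewrite lebesgue_measure_itv /=; case: ifP => _; rewrite ?ltry // -EFinD ltry.
Qed.

Lemma bigcup_tbox m : \bigcup_k tbox m k = [set: m.-tuple R].
Proof.
apply/seteqP; split=> // t _.
exists (\max_(i < m) Num.bound `|tnth t i|) => // i.
rewrite -ler_norml (le_trans (ltW (archi_boundP (normr_ge0 _)))) //.
by rewrite ler_nat (leq_bigmax_cond (F := fun i => Num.bound `|tnth t i|)).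
Qed.

Lemma lebesgue_tuple_sigma_finite m : sigma_finite setT (lebesgue_tuple R m).
Proof.
exists (tbox m); first by rewrite bigcup_tbox.
by move=> k; split; [exact: measurable_tbox|exact: lebesgue_tuple_tbox].
Qed.

(** A copy of [lebesgue_tuple] that carries its sigma-finiteness as a canonical instance,
    which the Fubini-Tonelli lemmas look for. *)
Definition lam m : set (m.-tuple R) -> \bar R := lebesgue_tuple R m.
HB.instance Definition _ m := Measure.on (lam (m := m)).
HB.instance Definition _ m := Measure_isSigmaFinite.Build _ _ _ (lam (m := m))
  (lebesgue_tuple_sigma_finite m).

Local Notation mu := (@lebesgue_measure R).
Local Notation lamb m := (@lam m).

Lemma lam_recl m (f : m.+1.-tuple R -> \bar R) : measurable_fun setT f ->
  (forall t, 0 <= f t)%E ->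
  (\int[lamb m.+1]_t f t = \int[lamb m]_t \int[mu]_h f [the m.+1.-tuple R of h :: t])%E.
Proof.
move=> mf f0.
pose cp (p : m.-tuple R * measurableTypeR R) := [the m.+1.-tuple R of (p.2 : R) :: p.1].
have mc : measurable_fun [set: m.-tuple R * measurableTypeR R] cp := @measurable_cons_pair R m.
pose pm : {measure set (m.-tuple R * measurableTypeR R) -> \bar R} := (lamb m \x mu)%E.
transitivity (\int[pm]_p (f \o cp) p)%E; last first.
  apply: (fubini_tonelli1 (m1 := lamb m) (m2 := mu) (f \o cp)).
    exact: (measurableT_comp mf mc).
  by move=> p; exact: f0.
exact: (ge0_integral_pushforward mc pm measurableT mf (fun t _ => f0 t)).
Qed.

Lemma lam_recr m (f : m.+1.-tuple R -> \bar R) : measurable_fun setT f ->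
  (forall t, 0 <= f t)%E ->
  (\int[lamb m.+1]_t f t = \int[mu]_h \int[lamb m]_t f [the m.+1.-tuple R of h :: t])%E.
Proof.
move=> mf f0; rewrite lam_recl //.
apply: (fubini_tonelli (m1 := lamb m) (m2 := mu) (fun p : m.-tuple R * measurableTypeR R => f [the m.+1.-tuple R of (p.2 : R) :: p.1])) => //.
exact: (measurableT_comp mf (@measurable_cons_pair R m)).
Qed.

Lemma measurable_integral_cons m (g : m.+1.-tuple R -> \bar R) : measurable_fun setT g ->
  (forall t, 0 <= g t)%E ->
  measurable_fun setT (fun t : m.-tuple R => \int[mu]_h g [the m.+1.-tuple R of h :: t])%E.
Proof.
move=> mg g0.
pose cp (p : m.-tuple R * measurableTypeR R) := [the m.+1.-tuple R of (p.2 : R) :: p.1].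
have mc : measurable_fun [set: m.-tuple R * measurableTypeR R] cp := @measurable_cons_pair R m.
apply: (measurable_fun_fubini_tonelli_F (m2 := mu) (g \o cp)).
  exact: (measurableT_comp mg mc).
by move=> p; exact: g0.
Qed.

Lemma measurable_fun_mktuple d (D : measurableType d) p (f : 'I_p -> D -> R) :
  (forall i, measurable_fun setT (f i)) ->
  measurable_fun setT (fun t => mktuple (fun i => f i t)).
Proof.
move=> mf; apply/measurable_fun_tnthP => i.
by rewrite (_ : _ \o _ = f i) //; apply/funext => t /=; rewrite tnth_mktuple.
Qed.

Definition tadd m (a : 'I_m -> R) (t : m.-tuple R) : m.-tuple R :=
  [tuple tnth t i + a i | i < m].

Definition tscale m (s : R) (t : m.-tuple R) : m.-tuple R :=
  [tuple s * tnth t i | i < m].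

Definition tshear m (i k : 'I_m) (c : R) (t : m.-tuple R) : m.-tuple R :=
  [tuple tnth t j + (if j == i then c * tnth t k else 0) | j < m].

Lemma measurable_tadd m (a : 'I_m -> R) : measurable_fun setT (tadd a).
Proof.
apply: measurable_fun_mktuple => i; apply: measurable_funD => //.
exact: measurable_tnth.
Qed.

Lemma measurable_tscale m s : measurable_fun setT (@tscale m s).
Proof.
apply: measurable_fun_mktuple => i; apply: measurable_funM => //.
exact: measurable_tnth.
Qed.

Lemma measurable_tshear m (i k : 'I_m) c : measurable_fun setT (tshear i k c).
Proof.
apply: measurable_fun_mktuple => j; apply: measurable_funD.
  exact: measurable_tnth.
case: (j == i) => //; apply: measurable_funM => //.
exact: measurable_tnth.
Qed.

Lemma measurable_cons1 m (h : R) : measurable_fun setT (fun t : m.-tuple R => [the m.+1.-tuple R of h :: t]).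
Proof. exact: measurable_cons. Qed.

Lemma measurable_cons2 m (t : m.-tuple R) : measurable_fun setT (fun h : measurableTypeR R => [the m.+1.-tuple R of (h : R) :: t]).
Proof. exact: measurable_cons. Qed.

Lemma integral_tadd m (a : 'I_m -> R) (f : m.-tuple R -> \bar R) :
  measurable_fun setT f -> (forall t, 0 <= f t)%E ->
  (\int[lamb m]_t f (tadd a t) = \int[lamb m]_t f t)%E.
Proof.
elim: m a f => [|m IH] a f mf f0.
  by apply: eq_integral => t _; rewrite (tuple0 t) (tuple0 (tadd _ _)).
have mfa : measurable_fun setT (f \o tadd a) := measurableT_comp mf (measurable_tadd a).
have f0a t : (0 <= (f \o tadd a) t)%E by exact: f0.
rewrite (lam_recl mfa f0a) (lam_recl mf f0).
rewrite -(IH (fun i => a (lift ord0 i)) (fun t => \int[mu]_h f [the m.+1.-tuple R of h :: t])%E); last 2 first.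
- exact: measurable_integral_cons.
- by move=> t; exact: integral_ge0.
apply: eq_integral => t _.
rewrite -(ge0_integralDr (a ord0) (f := fun h => f [the m.+1.-tuple R of h :: tadd (fun i => a (lift ord0 i)) t])) //; last exact: (measurableT_comp mf (measurable_cons2 _)).
apply: eq_integral => h _; congr f.
apply: eq_from_tnth => i; rewrite tnth_mktuple.
case: (unliftP ord0 i) => [j ->|->]; last by rewrite !tnth0.
by rewrite !tnthS tnth_mktuple.
Qed.

Lemma integral_tscale m (s : R) (f : m.-tuple R -> \bar R) : 0 < s ->
  measurable_fun setT f -> (forall t, 0 <= f t)%E ->
  (\int[lamb m]_t f t = (s ^+ m)%:E * \int[lamb m]_t f (tscale s t))%E.
Proof.
move=> s0; elim: m f => [|m IH] f mf f0.
  rewrite expr0 mul1e.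
  by apply: eq_integral => t _; rewrite (tuple0 t) (tuple0 (tscale _ _)).
have mfa : measurable_fun setT (f \o tscale s) := measurableT_comp mf (measurable_tscale s).
have f0a t : (0 <= (f \o tscale s) t)%E by exact: f0.
rewrite (lam_recl mf f0) (lam_recl mfa f0a) exprS EFinM -muleA.
rewrite (IH (fun t => \int[mu]_h f [the m.+1.-tuple R of h :: t])%E); last 2 first.
- exact: measurable_integral_cons.
- by move=> t; exact: integral_ge0.
rewrite muleCA; congr (_ * _)%E.
have mG := measurable_integral_cons mfa f0a.
have G0 (t : m.-tuple R) : (0 <= \int[mu]_h (f \o tscale s) [the m.+1.-tuple R of h :: t])%E.
  by apply: integral_ge0 => h _; exact: f0a.
transitivity (\int[lamb m]_t (s%:E * \int[mu]_h (f \o tscale s) [the m.+1.-tuple R of h :: t]))%E; last first.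
  rewrite ge0_integralZl //.
  by rewrite lee_fin ltW.
apply: eq_integral => t _.
rewrite (ge0_integralMl s0) //; last exact: (measurableT_comp mf (measurable_cons2 _)).
congr (_ * _)%E; apply: eq_integral => h _; congr f.
apply: eq_from_tnth => i; rewrite tnth_mktuple.
case: (unliftP ord0 i) => [j ->|->]; last by rewrite !tnth0.
by rewrite !tnthS tnth_mktuple.
Qed.

(** A shear translates one coordinate by an amount that the other coordinates determine, so
    by Tonelli it reduces to translation invariance. If the sheared coordinate is the first
    one, integrate over it first; if not, freeze the first one and use induction. *)
Lemma integral_tshear m (i k : 'I_m) c (f : m.-tuple R -> \bar R) : i != k ->
  measurable_fun setT f -> (forall t, 0 <= f t)%E ->
  (\int[lamb m]_t f (tshear i k c t) = \int[lamb m]_t f t)%E.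
Proof.
elim: m i k f => [[]//|m IH] i k f ik mf f0.
have mfa : measurable_fun setT (f \o tshear i k c) := measurableT_comp mf (measurable_tshear i k c).
have f0a t : (0 <= (f \o tshear i k c) t)%E by exact: f0.
case: (unliftP ord0 i) => [i' ii'|i0]; last first.
  case: (unliftP ord0 k) => [k' kk'|k0]; last by rewrite i0 k0 eqxx in ik.
  rewrite (lam_recl mfa f0a) (lam_recl mf f0); apply: eq_integral => t _.
  rewrite -(ge0_integralDr (c * tnth t k') (f := fun h => f [the m.+1.-tuple R of h :: t])) //; last exact: (measurableT_comp mf (measurable_cons2 _)).
  apply: eq_integral => h _; congr f.
  apply: eq_from_tnth => j; rewrite tnth_mktuple i0 kk'.
  case: (unliftP ord0 j) => [j' ->|->]; last by rewrite eqxx !tnth0 tnthS.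
  by rewrite !tnthS addr0.
rewrite (lam_recr mfa f0a) (lam_recr mf f0); apply: eq_integral => h _.
case: (unliftP ord0 k) => [k' kk'|k0].
  have ik' : i' != k' by apply: contra ik => /eqP e; rewrite ii' kk' e.
  rewrite -(IH _ _ (fun t => f [the m.+1.-tuple R of h :: t]) ik') //; last exact: (measurableT_comp mf (measurable_cons1 _)).
  apply: eq_integral => t _; congr f.
  apply: eq_from_tnth => j; rewrite tnth_mktuple ii' kk'.
  case: (unliftP ord0 j) => [j' ->|->]; last by rewrite !tnth0 addr0.
  by rewrite !tnthS tnth_mktuple (inj_eq lift_inj).
rewrite -(integral_tadd (fun j => if j == i' then c * h else 0)
  (f := fun t => f [the m.+1.-tuple R of h :: t])) //; last exact: (measurableT_comp mf (measurable_cons1 _)).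
apply: eq_integral => t _; congr f.
apply: eq_from_tnth => j; rewrite tnth_mktuple ii' k0.
case: (unliftP ord0 j) => [j' ->|->]; last by rewrite !tnth0 addr0.
by rewrite !tnthS tnth_mktuple (inj_eq lift_inj) tnth0.
Qed.

End LebesgueTuple.

(** * The Euclidean norm and topology of C^n *)

Section Enorm.
Context (R : realType) (n : nat).
Implicit Types z w : Cn R n.

(** The real part of the Hermitian inner product. *)
Definition edot z w : R := \sum_j (complex.Re (z ord0 j) * complex.Re (w ord0 j) + complex.Im (z ord0 j) * complex.Im (w ord0 j)).

Lemma edot_ge0 z : 0 <= edot z z.
Proof. by apply: sumr_ge0 => j _; rewrite -!expr2 addr_ge0 ?sqr_ge0. Qed.

Lemma enorm_sqr z : enorm z ^+ 2 = edot z z.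
Proof.
rewrite /enorm sqr_sqrtr; last by apply: sumr_ge0 => j _; rewrite addr_ge0 ?sqr_ge0.
by apply: eq_bigr => j _; rewrite -!expr2.
Qed.

Lemma enorm_ge0 z : 0 <= enorm z. Proof. exact: sqrtr_ge0. Qed.

Lemma cReD (x y : R[i]) : complex.Re (x + y) = complex.Re x + complex.Re y.
Proof. by case: x; case: y. Qed.
Lemma cImD (x y : R[i]) : complex.Im (x + y) = complex.Im x + complex.Im y.
Proof. by case: x; case: y. Qed.
Lemma cReN (x : R[i]) : complex.Re (- x) = - complex.Re x.
Proof. by case: x. Qed.
Lemma cImN (x : R[i]) : complex.Im (- x) = - complex.Im x.
Proof. by case: x. Qed.
Lemma creal_M (x y : R) : ((x * y)%:C)%C = (x%:C)%C * (y%:C)%C.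
Proof. by apply/eqP; rewrite eq_complex /=; apply/andP; split; apply/eqP; ring. Qed.
Lemma cReM (x y : R[i]) : complex.Re (x * y) =
  complex.Re x * complex.Re y - complex.Im x * complex.Im y.
Proof. by case: x; case: y. Qed.
Lemma cImM (x y : R[i]) : complex.Im (x * y) =
  complex.Re x * complex.Im y + complex.Im x * complex.Re y.
Proof. by case: x; case: y => *; rewrite /= addrC [X in X + _ = _]mulrC addrC [in RHS]addrC // [X in _ = X + _]mulrC. Qed.

Lemma edot_lin z w (t : R) : edot (z + t%:C%C *: w) (z + t%:C%C *: w) =
  edot z z + 2 * t * edot z w + t ^+ 2 * edot w w.
Proof.
rewrite /edot !mulr_sumr -!big_split /=; apply: eq_bigr => j _.
rewrite !mxE !cReD !cImD !cReM !cImM /=.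
by ring.
Qed.

Lemma edot_CS z w : edot z w ^+ 2 <= edot z z * edot w w.
Proof.
have [w0|w0] := eqVneq (edot w w) 0.
  have H t := edot_ge0 (z + t%:C%C *: w).
  have [->|d0] := eqVneq (edot z w) 0; first by rewrite expr0n /= mulr_ge0 ?edot_ge0.
  have := H (- (edot z z + 1) / (2 * edot z w)).
  rewrite edot_lin w0 mulr0 addr0.
  have -> : 2 * (- (edot z z + 1) / (2 * edot z w)) * edot z w = - (edot z z + 1) by field.
  by lra.
have wp : 0 < edot w w by rewrite lt_def w0 edot_ge0.
have := edot_ge0 (z + (- edot z w / edot w w)%:C%C *: w).
rewrite edot_lin -(pmulr_lge0 _ wp).
suff -> : (edot z z + 2 * (- edot z w / edot w w) * edot z w +
    (- edot z w / edot w w) ^+ 2 * edot w w) * edot w w =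
    edot z z * edot w w - edot z w ^+ 2 by rewrite subr_ge0.
by field.
Qed.

Lemma ler_enormD z w : enorm (z + w) <= enorm z + enorm w.
Proof.
rewrite -(@ler_pXn2r _ 2) ?nnegrE ?addr_ge0 ?enorm_ge0 //.
rewrite sqrrD !enorm_sqr.
have := edot_lin z w 1; rewrite scale1r => ->.
have : edot z w <= enorm z * enorm w; last by lra.
rewrite (le_trans (ler_norm _)) // -(@ler_pXn2r _ 2) ?nnegrE ?mulr_ge0 ?enorm_ge0 //.
by rewrite real_normK ?num_real // exprMn !enorm_sqr edot_CS.
Qed.

Lemma enormZ (u : R[i]) z : enorm (u *: z) = Num.sqrt (complex.Re u ^+ 2 + complex.Im u ^+ 2) * enorm z.
Proof.
rewrite /enorm -sqrtrM ?addr_ge0 ?sqr_ge0 // mulr_sumr; congr Num.sqrt.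
apply: eq_bigr => j _; rewrite !mxE cReM cImM; by ring.
Qed.

Lemma enormZr (t : R) z : enorm (t%:C%C *: z) = `|t| * enorm z.
Proof. by rewrite enormZ /= expr0n addr0 sqrtr_sqr. Qed.

Lemma enormZ_expi (t : R) z : enorm (expi t *: z) = enorm z.
Proof. by rewrite enormZ /= cos2Dsin2 sqrtr1 mul1r. Qed.

Lemma enormN z : enorm (- z) = enorm z.
Proof.
congr Num.sqrt; apply: eq_bigr => j _.
by rewrite !mxE cReN cImN !sqrrN.
Qed.

Lemma enormB z w : enorm (z - w) = enorm (w - z).
Proof. by rewrite -enormN opprB. Qed.

Lemma enorm0 : enorm (0 : Cn R n) = 0.
Proof.
rewrite /enorm big1 ?sqrtr0 // => j _.
by rewrite mxE /= !expr0n addr0.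
Qed.

Lemma ler_enorm_Re z j : `|complex.Re (z ord0 j)| <= enorm z.
Proof.
rewrite -(@ler_pXn2r _ 2) ?nnegrE ?enorm_ge0 // real_normK ?num_real //.
rewrite sqr_sqrtr; last by apply: sumr_ge0 => k _; rewrite addr_ge0 ?sqr_ge0.
rewrite (bigD1 j) //= -addrA lerDl addr_ge0 ?sqr_ge0 //.
by apply: sumr_ge0 => k _; rewrite addr_ge0 ?sqr_ge0.
Qed.

Lemma ler_enorm_Im z j : `|complex.Im (z ord0 j)| <= enorm z.
Proof.
rewrite -(@ler_pXn2r _ 2) ?nnegrE ?enorm_ge0 // real_normK ?num_real //.
rewrite sqr_sqrtr; last by apply: sumr_ge0 => k _; rewrite addr_ge0 ?sqr_ge0.
rewrite (bigD1 j) //= [X in _ <= X + _]addrC -addrA lerDl addr_ge0 ?sqr_ge0 //.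
by apply: sumr_ge0 => k _; rewrite addr_ge0 ?sqr_ge0.
Qed.

Lemma enorm_eq0 z : enorm z = 0 -> z = 0.
Proof.
move=> z0; apply/rowP => j; rewrite mxE.
have := ler_enorm_Re z j; have := ler_enorm_Im z j.
rewrite z0 !normr_le0; case: (z ord0 j) => a b /= /eqP -> /eqP -> //.
Qed.

Lemma enorm_le_sum z : enorm z <= \sum_j (`|complex.Re (z ord0 j)| + `|complex.Im (z ord0 j)|).
Proof.
have S0 : 0 <= \sum_j (`|complex.Re (z ord0 j)| + `|complex.Im (z ord0 j)|).
  by apply: sumr_ge0 => j _; rewrite addr_ge0.
rewrite -(@ler_pXn2r _ 2) ?nnegrE ?enorm_ge0 //.
rewrite sqr_sqrtr; last by apply: sumr_ge0 => k _; rewrite addr_ge0 ?sqr_ge0.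
rewrite expr2 mulr_suml; apply: ler_sum => j _.
apply: (@le_trans _ _ ((`|complex.Re (z ord0 j)| + `|complex.Im (z ord0 j)|) ^+ 2)).
  rewrite sqrrD !real_normK ?num_real // lerD2r lerDl.
  by rewrite mulrn_wge0 // mulr_ge0.
rewrite expr2 ler_wpM2l ?addr_ge0 // (bigD1 j) //= lerDl.
by apply: sumr_ge0 => k _; rewrite addr_ge0.
Qed.

Lemma ler_enorm_coord z j :
  Num.sqrt (complex.Re (z ord0 j) ^+ 2 + complex.Im (z ord0 j) ^+ 2) <= enorm z.
Proof.
rewrite ler_sqrt; last by apply: sumr_ge0 => k _; rewrite addr_ge0 ?sqr_ge0.
rewrite [leRHS](bigD1 j) //= lerDl.
by apply: sumr_ge0 => k _; rewrite addr_ge0 ?sqr_ge0.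
Qed.

End Enorm.

Section Topology.
Context (R : realType) (n : nat).
Implicit Types z w : Cn R n.

(** The topology is that of the sup norm with values in R[i]; here and in [nbhs_enormP] it
    is matched with the Euclidean balls used everywhere else. *)
Lemma nbhs_enorm_ball z e : 0 < e -> nbhs z [set w : Cn R n | enorm (w - z) < e].
Proof.
move=> e0.
have N0 : 0 < (n.+1 + n.+1)%:R :> R by rewrite ltr0n.
apply/nbhs_ballP; exists (e / (n.+1 + n.+1)%:R)%:C%C => /=.
  by rewrite ltcE /= eqxx divr_gt0.
move=> w [_ H] /=.
have Hj j : `|complex.Re ((w - z) ord0 j)| + `|complex.Im ((w - z) ord0 j)| <= e / (n.+1 + n.+1)%:R * 2.
  have := H ord0 j; rewrite -ball_normE /= normc_def ltcR => /ltW He.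
  rewrite mulr_natr mulr2n !mxE !cReD !cImD !cReN !cImN; apply: lerD; apply: le_trans He.
  - rewrite distrC -sqrtr_sqr ler_sqrt ?addr_ge0 ?sqr_ge0 // cReD cReN lerDl sqr_ge0 //.
  - rewrite distrC -sqrtr_sqr ler_sqrt ?addr_ge0 ?sqr_ge0 // cImD cImN lerDr sqr_ge0 //.
apply: le_lt_trans (enorm_le_sum _) _.
apply: le_lt_trans (ler_sum _ (fun j _ => Hj j)) _.
rewrite sumr_const card_ord -[ltLHS]mulr_natr.
have -> : e / (n.+1 + n.+1)%:R * 2 * n%:R = e * ((2 * n)%:R / (n.+1 + n.+1)%:R).
  by rewrite natrM; ring.
rewrite gtr_pMr // ltr_pdivrMr // mul1r ltr_nat mul2n -addnn.
by rewrite addSn addnS ltnS leqW.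
Qed.

Lemma nbhs_enormP z (A : set (Cn R n)) :
  nbhs z A <-> exists2 e : R, 0 < e & forall w, enorm (w - z) < e -> A w.
Proof.
split; last first.
  by move=> [e e0 eA]; apply: filterS (nbhs_enorm_ball z e0).
move/nbhs_ballP => [[e e'] /= e0 eA].
have := e0; rewrite ltcE /= => /andP[/eqP e'0 er0].
exists e => // w wz; apply: eA; split => // i j.
rewrite (ord1 i) e'0 -ball_normE /= normc_def ltcR.
apply: le_lt_trans wz; rewrite enormB.
by have := ler_enorm_coord (z - w) j; rewrite !mxE.
Qed.

Lemma continuous_enormP (f : Cn R n -> R) z :
  {for z, continuous f} <->
  forall e, 0 < e -> exists2 d : R, 0 < d & forall w, enorm (w - z) < d -> `|f w - f z| < e.
Proof.
split=> [cf e e0|H].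
  have /nbhs_enormP[d d0 dH] : nbhs z (f @^-1` [set y | `|f z - y| < e]).
    by apply: (cf); apply/nbhs_ballP; exists e => //; rewrite -ball_normE.
  by exists d => // w /dH /=; rewrite distrC.
rewrite /prop_for /continuous_at; apply/(@cvgrPdist_lt _ _ _ (nbhs z) (nbhs_filter z)) => e /H[d d0 dH].
apply/nbhs_enormP; exists d => // w /dH.
by rewrite distrC.
Qed.

End Topology.

(** * Integrals over C^n and their invariance under rotations *)

Section CIntegral.
Context (R : realType) (n : nat).
Local Notation mu := (@lebesgue_measure R).
Local Notation T := ((n + n).-tuple R).
Local Notation ofr := (@of_real_coords R n).
Local Notation lamn := (lam (m := n + n)).

Definition to_real (z : Cn R n) : T :=
  [tuple match fintype.split i with inl j => complex.Re (z ord0 j) | inr j => complex.Im (z ord0 j) end | i < n + n].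

Lemma to_realK z : ofr (to_real z) = z.
Proof.
apply/rowP => j; rewrite mxE !tnth_mktuple.
rewrite (unsplitK (inl j)) (unsplitK (inr j)).
by case: (z ord0 j).
Qed.

Lemma Re_ofr t j : complex.Re (ofr t ord0 j) = tnth t (lshift n j).
Proof. by rewrite mxE. Qed.

Lemma Im_ofr t j : complex.Im (ofr t ord0 j) = tnth t (rshift n j).
Proof. by rewrite mxE. Qed.

Definition cmeas (f : Cn R n -> \bar R) := measurable_fun [set: T] (f \o ofr).

Definition cint (f : Cn R n -> \bar R) : \bar R := (\int[lamn]_t f (ofr t))%E.

Definition measurable_coords d (D : measurableType d) (g : D -> Cn R n) := forall j,
  measurable_fun setT (fun x => complex.Re (g x ord0 j) : R) /\
  measurable_fun setT (fun x => complex.Im (g x ord0 j) : R).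

Lemma measurable_to_real d (D : measurableType d) (g : D -> Cn R n) : measurable_coords g ->
  measurable_fun setT (fun x => to_real (g x)).
Proof.
move=> mg; apply: measurable_fun_mktuple => i.
by case: (fintype.split i) => j; have [] := mg j.
Qed.

Lemma cmeas_comp d (D : measurableType d) (g : D -> Cn R n) f :
  cmeas f -> measurable_coords g -> measurable_fun setT (f \o g).
Proof.
move=> mf mg.
have -> : f \o g = (f \o ofr) \o (fun x => to_real (g x)).
  by apply/funext => x /=; rewrite to_realK.
exact: (measurableT_comp mf (measurable_to_real mg)).
Qed.

Lemma measurable_coords_ofr : measurable_coords ofr.
Proof.
move=> j; split.
  by under eq_fun do rewrite Re_ofr; exact: measurable_tnth.
by under eq_fun do rewrite Im_ofr; exact: measurable_tnth.
Qed.

Lemma measurable_coordsD d (D : measurableType d) (g h : D -> Cn R n) : measurable_coords g -> measurable_coords h ->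
  measurable_coords (fun x => g x + h x).
Proof.
move=> mg mh j; have [g1 g2] := mg j; have [h1 h2] := mh j; split.
  by under eq_fun do rewrite mxE cReD; exact: measurable_funD.
by under eq_fun do rewrite mxE cImD; exact: measurable_funD.
Qed.

Lemma measurable_coordsZ d (D : measurableType d) (u : D -> R[i]) (g : D -> Cn R n) :
  measurable_fun setT (fun x => complex.Re (u x) : R) ->
  measurable_fun setT (fun x => complex.Im (u x) : R) -> measurable_coords g ->
  measurable_coords (fun x => u x *: g x).
Proof.
move=> u1 u2 mg j; have [g1 g2] := mg j; split.
  by under eq_fun do rewrite mxE cReM; apply: measurable_funB; exact: measurable_funM.
by under eq_fun do rewrite mxE cImM; apply: measurable_funD; exact: measurable_funM.
Qed.

Lemma measurable_coords_cst d (D : measurableType d) z : measurable_coords (fun _ : D => z).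
Proof. by move=> j; split. Qed.

Lemma measurable_coords_comp d (D : measurableType d) d' (D' : measurableType d') (h : D' -> D) (g : D -> Cn R n) :
  measurable_fun setT h -> measurable_coords g -> measurable_coords (g \o h).
Proof.
by move=> mh mg j; have [g1 g2] := mg j; split; [exact: (measurableT_comp g1 mh)|exact: (measurableT_comp g2 mh)].
Qed.

(** Stated on integrals of nonnegative functions, and not on sets, so that such maps compose
    without any measurability of their own. *)
Definition preserves_cint (h : Cn R n -> Cn R n) := forall f : Cn R n -> \bar R,
  cmeas f -> (forall z, 0 <= f z)%E ->
  cmeas (f \o h) /\ cint (f \o h) = cint f.

Lemma preserves_cint_comp g h : preserves_cint g -> preserves_cint h -> preserves_cint (g \o h).
Proof.
move=> mg mh f mf f0; have [g1 g2] := mg f mf f0.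
have [h1 h2] := mh (f \o g) g1 (fun z => f0 (g z)).
by split => //; rewrite -g2 -h2.
Qed.

Lemma preserves_cint_lift (h : Cn R n -> Cn R n) (H : T -> T) :
  measurable_fun setT H ->
  (forall f, measurable_fun setT f -> (forall t, 0 <= f t)%E ->
     (\int[lamn]_t f (H t) = \int[lamn]_t f t)%E) ->
  (forall t, h (ofr t) = ofr (H t)) -> preserves_cint h.
Proof.
move=> mH iH hH f mf f0; split.
  rewrite /cmeas (_ : _ \o ofr = (f \o ofr) \o H).
    exact: measurableT_comp.
  by apply/funext => t /=; rewrite hH.
rewrite /cint -(iH (f \o ofr) mf) /=; last by move=> t; exact: f0.
by apply: eq_integral => t _ /=; rewrite hH.
Qed.

Lemma preserves_cintD a : preserves_cint (fun z => z + a).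
Proof.
apply: (@preserves_cint_lift _ (tadd (fun i => tnth (to_real a) i))).
- exact: measurable_tadd.
- by move=> f mf f0; exact: integral_tadd.
move=> t; apply/rowP => j; rewrite -{1}(to_realK a) !mxE.
by rewrite /tadd !tnth_mktuple (unsplitK (inl j)) (unsplitK (inr j)).
Qed.

Lemma cint_scale (s : R) f : 0 < s -> cmeas f -> (forall z, 0 <= f z)%E ->
  cint f = ((s ^+ (n + n))%:E * cint (fun z => f (s%:C%C *: z)))%E.
Proof.
move=> s0 mf f0; rewrite /cint (integral_tscale s0 mf) //; last by move=> t; exact: f0.
congr (_ * _)%E; apply: eq_integral => t _ /=; congr f.
apply/rowP => j; rewrite !mxE /tscale !tnth_mktuple.
by apply/eqP; rewrite eq_complex /= !mul0r subr0 addr0 !eqxx.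
Qed.

Definition map_coord (j : 'I_n) (w : R[i] -> R[i]) (z : Cn R n) : Cn R n :=
  \row_k if k == j then w (z ord0 k) else z ord0 k.

Lemma preserves_cint_shearRe j c : preserves_cint (map_coord j (fun x => (complex.Re x + c * complex.Im x) +i* complex.Im x)%C).
Proof.
apply: (@preserves_cint_lift _ (tshear (lshift n j) (rshift n j) c)).
- exact: measurable_tshear.
- by move=> f mf f0; apply: integral_tshear => //; rewrite eq_lrshift.
move=> t; apply/rowP => k; rewrite !mxE /tshear !tnth_mktuple (inj_eq (@lshift_inj _ _)) eq_rlshift addr0.
by case: eqP => [->|_] //=; rewrite ?addr0.
Qed.

Lemma preserves_cint_shearIm j c : preserves_cint (map_coord j (fun x => (complex.Re x) +i* (complex.Im x + c * complex.Re x))%C).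
Proof.
apply: (@preserves_cint_lift _ (tshear (rshift n j) (lshift n j) c)).
- exact: measurable_tshear.
- by move=> f mf f0; apply: integral_tshear => //; rewrite eq_rlshift.
move=> t; apply/rowP => k; rewrite !mxE /tshear !tnth_mktuple (inj_eq (@rshift_inj _ _)) eq_lrshift addr0.
by case: eqP => [->|_] //=; rewrite ?addr0.
Qed.

Lemma map_coord_comp j v w : map_coord j v \o map_coord j w = map_coord j (v \o w).
Proof.
by apply/funext => z; apply/rowP => k; rewrite !mxE; case: eqP.
Qed.

(** A plane rotation of angle other than pi is a product of three shears, each of
    determinant 1; with angle q the shears have slopes - tan (q/2), sin q and - tan (q/2),
    and tan (q/2) = s / (1 + c). *)
Lemma preserves_cint_rot1 j (c s : R) : c ^+ 2 + s ^+ 2 = 1 -> c != -1 ->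
  preserves_cint (map_coord j (fun x => (c +i* s)%C * x)).
Proof.
move=> cs c1.
have c1' : 1 + c != 0 by apply: contra c1 => /eqP h; apply/eqP; lra.
have -> : (fun x => (c +i* s)%C * x) =
   (fun x => (complex.Re x + (- s / (1 + c)) * complex.Im x) +i* complex.Im x)%C \o
   ((fun x => (complex.Re x) +i* (complex.Im x + s * complex.Re x))%C \o
    (fun x => (complex.Re x + (- s / (1 + c)) * complex.Im x) +i* complex.Im x)%C).
  have s2 : s ^+ 2 = 1 - c ^+ 2 by rewrite -cs; ring.
  apply/funext => -[a b] /=; apply/eqP; rewrite eq_complex /=; apply/andP; split; apply/eqP.
    apply: (mulIf c1'); apply: (mulIf c1').
    transitivity (a * (c * (1 + c) ^+ 2) - s * b * (1 + c) ^+ 2); first by ring.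
    transitivity (a * (1 + c) ^+ 2 - 2 * s * b * (1 + c) - s ^+ 2 * (a * (1 + c)) + s * b * s ^+ 2).
      by rewrite s2; ring.
    by field.
  apply: (mulIf c1').
  transitivity (b * (1 + c) + s * a * (1 + c) - s ^+ 2 * b).
    by rewrite s2; ring.
  by field.
rewrite -!map_coord_comp.
apply: preserves_cint_comp; first exact: preserves_cint_shearRe.
apply: preserves_cint_comp; first exact: preserves_cint_shearIm.
exact: preserves_cint_shearRe.
Qed.

(** The half-turn, where the three shears degenerate, is the square of a quarter-turn. *)
Lemma preserves_cint_rot2 j (c s : R) : c ^+ 2 + s ^+ 2 = 1 ->
  preserves_cint (map_coord j (fun x => (c +i* s)%C * x)).
Proof.
move=> cs; have [cN1|c1] := eqVneq c (-1); last exact: preserves_cint_rot1.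
have s0 : s = 0.
  by apply/eqP; rewrite -sqrf_eq0; apply/eqP; move: cs; rewrite cN1; lra.
have -> : (fun x => (c +i* s)%C * x) = (fun x => (0 +i* 1)%C * x) \o (fun x => (0 +i* 1)%C * x).
  by apply/funext => -[a b] /=; apply/eqP; rewrite eq_complex /= cN1 s0; apply/andP; split; apply/eqP; ring.
rewrite -map_coord_comp; apply: preserves_cint_comp; apply: preserves_cint_rot1; rewrite ?expr0n ?expr1n ?add0r //.
all: by rewrite eq_sym oppr_eq0 oner_eq0.
Qed.

Lemma preserves_cint_expi t : preserves_cint (fun z => expi t *: z).
Proof.
have H (s : seq 'I_n) : uniq s -> preserves_cint (fun z : Cn R n => \row_k if k \in s then expi t * z ord0 k else z ord0 k).
  elim: s => [_|j s IH /= /andP[js us]].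
    by move=> f mf f0; rewrite (_ : _ \o _ = f) //; apply/funext => z /=; congr f; apply/rowP => k; rewrite mxE.
  have -> : (fun z : Cn R n => \row_k if k \in j :: s then expi t * z ord0 k else z ord0 k) =
     map_coord j (fun x => expi t * x) \o (fun z : Cn R n => \row_k if k \in s then expi t * z ord0 k else z ord0 k).
    apply/funext => z; apply/rowP => k; rewrite !mxE in_cons.
    by case: eqP => [->|//]; rewrite (negbTE js).
  by apply: preserves_cint_comp (IH us); apply: preserves_cint_rot2; exact: cos2Dsin2.
have := H (enum 'I_n) (enum_uniq _).
congr preserves_cint; apply/funext => z; apply/rowP => k.
by rewrite !mxE mem_enum.
Qed.

End CIntegral.

(** * Circle means integrated against rotation invariant weights *)

Section CTonelli.
Context (R : realType) (n : nat).
Local Notation mu := (@lebesgue_measure R).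
Local Notation T := ((n + n).-tuple R).
Local Notation ofr := (@of_real_coords R n).
Local Notation lamn := (lam (m := n + n)).
Local Open Scope ereal_scope.

Lemma cint_swap (G : R -> Cn R n -> \bar R) :
  measurable_fun setT (fun p : T * measurableTypeR R => G p.2 (ofr p.1)) ->
  (forall s z, 0 <= G s z) ->
  [/\ cmeas (fun z => \int[mu]_s G s z),
      measurable_fun [set: measurableTypeR R] (fun s => cint (G s)) &
      \int[mu]_s cint (G s) = cint (fun z => \int[mu]_s G s z)].
Proof.
move=> mG G0.
pose g (p : T * measurableTypeR R) := G p.2 (ofr p.1).
have g0 p : 0 <= g p by exact: G0.
split; first exact: (measurable_fun_fubini_tonelli_F (m2 := mu) g mG g0).
  exact: (measurable_fun_fubini_tonelli_G (m1 := lamn) g mG g0).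
by rewrite /cint (fubini_tonelli (m1 := lamn) (m2 := mu) g mG g0).
Qed.

Lemma integral_weight (I : set R) (f : R -> \bar R) :
  \int[mu]_(t in I) f t = \int[mu]_t ((\1_I t)%:E * f t).
Proof.
rewrite integral_mkcond; apply: eq_integral => t _.
rewrite patchE indicE; case: (t \in I); rewrite ?mul1e ?mul0e //.
Qed.

Lemma cint_ge0 (f : Cn R n -> \bar R) : (forall z, 0 <= f z) -> 0 <= cint f.
Proof. by move=> f0; apply: integral_ge0. Qed.

Lemma le_cint (f g : Cn R n -> \bar R) : cmeas f -> cmeas g ->
  (forall z, 0 <= f z) -> (forall z, f z <= g z) -> cint f <= cint g.
Proof. by move=> mf mg f0 fg; apply: ge0_le_integral. Qed.

Lemma cintD (f g : Cn R n -> \bar R) : cmeas f -> cmeas g ->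
  (forall z, 0 <= f z) -> (forall z, 0 <= g z) -> cint (fun z => f z + g z) = cint f + cint g.
Proof. by move=> mf mg f0 g0; rewrite /cint ge0_integralD. Qed.

Lemma cintZl (k : \bar R) (f : Cn R n -> \bar R) : cmeas f ->
  (forall z, 0 <= f z) -> 0 <= k -> cint (fun z => k * f z) = k * cint f.
Proof. by move=> mf f0 k0; rewrite /cint ge0_integralZl. Qed.

Lemma cmeasM (f g : Cn R n -> \bar R) : cmeas f -> cmeas g -> cmeas (fun z => f z * g z).
Proof. by move=> mf mg; apply: emeasurable_funM. Qed.

Lemma cmeasD (f g : Cn R n -> \bar R) : cmeas f -> cmeas g -> cmeas (fun z => f z + g z).
Proof. by move=> mf mg; apply: emeasurable_funD. Qed.

Lemma cmeas_cst k : cmeas (fun _ : Cn R n => k).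
Proof. exact: measurable_cst. Qed.

Lemma measurable_expi_Re : measurable_fun setT (fun t : R => complex.Re (expi t) : R).
Proof. by apply: continuous_measurable_fun => x; exact: continuous_cos. Qed.

Lemma measurable_expi_Im : measurable_fun setT (fun t : R => complex.Im (expi t) : R).
Proof. by apply: continuous_measurable_fun => x; exact: continuous_sin. Qed.

Lemma measurable_coords_snd_expi :
  measurable_coords (fun p : T * measurableTypeR R => expi (p.2 : R) *: ofr p.1).
Proof.
apply: measurable_coordsZ.
- exact: (measurableT_comp measurable_expi_Re measurable_snd).
- exact: (measurableT_comp measurable_expi_Im measurable_snd).
- apply: (measurable_coords_comp (h := fst) measurable_fst); exact: measurable_coords_ofr.
Qed.

Local Notation I2 := (`[0%R, (2 * pi)%R]%classic : set R).

Lemma two_pi_gt0 : (0 < 2 * pi :> R)%R.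
Proof. by rewrite mulr_gt0 // pi_gt0. Qed.

Lemma mu_I2 : mu I2 = (2 * pi)%:E.
Proof. by rewrite lebesgue_measure_itv /= lte_fin two_pi_gt0 -EFinB subr0. Qed.

(** A rotation invariant weight does not see the rotations z |-> e^(it) z, so V may be
    replaced by its mean over them before integrating; this turns the circle-wise submean
    inequality into one for the weight k, without polar coordinates. *)
Lemma mean_cint (k V : Cn R n -> \bar R) (b : R) :
  cmeas k -> cmeas V -> (forall z, 0 <= k z) -> (forall z, 0 <= V z) -> (0 <= b)%R ->
  (forall t z, k (expi t *: z) = k z) ->
  (forall z, k z != 0 -> (2 * pi * b)%:E <= \int[mu]_(t in I2) V (expi t *: z)) ->
  b%:E * cint k <= cint (fun z => k z * V z).
Proof.
move=> mk mV k0 V0 b0 rk H.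
pose G (t : R) z := (\1_I2 t)%:E * (k z * V (expi t *: z)).
have mG : measurable_fun setT (fun p : T * measurableTypeR R => G p.2 (ofr p.1)).
  apply: emeasurable_funM.
    apply/measurable_EFinP; apply: (measurableT_comp _ measurable_snd).
    by apply: measurable_indic.
  apply: emeasurable_funM; first exact: (measurableT_comp mk measurable_fst).
  exact: (cmeas_comp mV measurable_coords_snd_expi).
have i0 t : 0 <= (\1_I2 t)%:E :> \bar R by rewrite lee_fin.
have G0 s z : 0 <= G s z by apply: mule_ge0 => //; exact: mule_ge0.
have [mI _ swap] := cint_swap mG G0.
have mkV : cmeas (fun z => k z * V z) by exact: cmeasM.
have kV0 z : 0 <= k z * V z by exact: mule_ge0.
have E t : cint (G t) = (\1_I2 t)%:E * cint (fun z => k z * V z).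
  have [m1 e1] := preserves_cint_expi t mkV kV0.
  transitivity (cint (fun z => (\1_I2 t)%:E * (k (expi t *: z) * V (expi t *: z)))).
    by apply: eq_integral => u _; rewrite /G rk.
  rewrite (cintZl m1 _ (i0 t)); last by move=> z; exact: kV0.
  by congr (_ * _); exact: e1.
have E2 z : \int[mu]_s G s z = k z * \int[mu]_(t in I2) V (expi t *: z).
  have mVz : measurable_fun setT (fun t : measurableTypeR R => V (expi t *: z)).
    have := cmeas_comp mV (g := fun t : measurableTypeR R => expi t *: z); apply.
    apply: measurable_coordsZ; [exact: measurable_expi_Re|exact: measurable_expi_Im|exact: measurable_coords_cst].
  transitivity (\int[mu]_t (k z * ((\1_I2 t)%:E * V (expi t *: z)))).
    by apply: eq_integral => t _; rewrite /G muleCA.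
  rewrite ge0_integralZl //; first by rewrite -integral_weight.
    by apply: emeasurable_funM => //; apply/measurable_EFinP; exact: measurable_indic.
  by move=> t _; exact: mule_ge0.
have : (2 * pi)%:E * (b%:E * cint k) <= (2 * pi)%:E * cint (fun z => k z * V z).
  have -> : (2 * pi)%:E * cint (fun z => k z * V z) = \int[mu]_s cint (G s).
    under eq_integral do rewrite E.
    by rewrite -integral_weight integral_cst //= mu_I2 muleC.
  rewrite swap -!cintZl ?lee_fin ?(ltW two_pi_gt0) //; first last.
  - by move=> z; rewrite mule_ge0.
  - by apply: cmeasM => //; exact: cmeas_cst.
  apply: le_cint => //.
  - by apply: cmeasM; [exact: cmeas_cst|apply: cmeasM => //; exact: cmeas_cst].
  - by move=> z; rewrite !mule_ge0 ?lee_fin ?(ltW two_pi_gt0).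
  move=> z; rewrite E2 muleA -EFinM muleC.
  have [->|kz] := eqVneq (k z) 0; first by rewrite !mul0e.
  by apply: lee_wpmul2l; [exact: k0|exact: H].
by rewrite lee_pmul2l ?lte_fin ?two_pi_gt0.
Qed.

End CTonelli.

(** * The kernel averaged along rays *)

Section Kernel.
Context (R : realType) (n : nat).
Local Notation mu := (@lebesgue_measure R).
Local Notation T := ((n + n).-tuple R).
Local Notation ofr := (@of_real_coords R n).
Local Notation lamn := (lam (m := n + n)).
Local Open Scope ereal_scope.

Lemma measurable_enorm : measurable_fun setT (fun t : T => enorm (ofr t)).
Proof.
have ms : measurable_fun [set: R] (@Num.sqrt R : R -> R).
  by apply: continuous_measurable_fun; exact: sqrt_continuous.
apply: (measurableT_comp ms).
have [H1 H2] : (forall j, measurable_fun setT (fun t : T => complex.Re (ofr t ord0 j) : R)) /\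
   (forall j, measurable_fun setT (fun t : T => complex.Im (ofr t ord0 j) : R)).
  by split=> j; have [] := @measurable_coords_ofr R n j.
apply: measurable_sum => j; apply: measurable_funD; apply: measurable_funX; [exact: H1|exact: H2].
Qed.

Definition ball_ind (a : R) (z : Cn R n) : \bar R := (if (enorm z < a)%R then 1%R else 0%R)%:E.

Lemma cmeas_ball_ind a : cmeas (ball_ind a).
Proof.
apply/measurable_EFinP.
apply: measurable_fun_ifT => //.
exact: (measurable_fun_ltr measurable_enorm).
Qed.

Lemma ball_ind_ge0 a z : 0 <= ball_ind a z.
Proof. by rewrite /ball_ind; case: ifP => _; rewrite lee_fin. Qed.

Lemma integral_sqrV : \int[mu]_(s in `[1%R, +oo[) ((s ^- 2)%R)%:E = 1.
Proof.
rewrite (@ge0_continuous_FTC2y R (fun s => s ^- 2)%R (fun s => - s^-1)%R 1%R 0%R).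
- by rewrite -EFinB sub0r opprK invr1.
- by move=> x x1; rewrite invr_ge0 sqr_ge0.
- apply/continuous_within_itvcyP; split.
    move=> x; rewrite in_itv /= andbT => x1.
    have x0 : (x ^+ 2 != 0)%R by rewrite expf_neq0 // gt_eqF // (lt_trans ltr01).
    apply: cvgV => //; exact: exprn_continuous.
  apply: cvg_at_right_filter; apply: cvgV; first by rewrite expr1n oner_neq0.
  exact: exprn_continuous.
- rewrite -oppr0; apply: cvgN; apply/gtr0_cvgV0.
    by near=> x; near: x; exact: nbhs_pinfty_gt.
  by [].
- move=> x x1; apply: derivableN; apply: derivableV => //.
  by rewrite gt_eqF // (lt_trans ltr01).
- apply: cvg_at_right_filter; apply: cvgN; apply: cvgV => //; exact: oner_neq0.
- move=> x; rewrite in_itv /= andbT => x1.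
  have x0 : (x != 0)%R by rewrite gt_eqF // (lt_trans ltr01).
  rewrite derive1E deriveN; last exact: derivableV.
  by rewrite deriveV // derive_id /GRing.scale /= mulr1 opprK.
Unshelve. all: by end_near. Qed.

(** The average of all dilates of rho that are at least as concentrated as rho itself.
    Unlike rho, it is monotone along rays, which makes it bounded below near 0. *)
Definition ray_integral (rho : Cn R n -> R) (z : Cn R n) : \bar R :=
  \int[mu]_(s in `[1%R, +oo[) (rho (s%:C%C *: z))%:E.

Section rho.
Context (rho : Cn R n -> R) (rk : regularizing_kernel rho).

Lemma cmeas_rho : cmeas (fun z => (rho z)%:E).
Proof. by apply/measurable_EFinP; exact: kernel_borel rk. Qed.

Lemma rho_supp z : rho z != 0%R -> (enorm z < 1)%R.
Proof. by move=> z0; apply: (kernel_support rk); exact: subset_closure. Qed.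

(** The integrands below vanish outside the unit ball, so the domain of integration may be
    dropped. *)
Lemma Cintegral_cint (f : Cn R n -> R) :
  (forall z, f z != 0%R -> (enorm z < 1)%R) ->
  Cintegral (@uball R n) f = fine (cint (fun z => (f z)%:E)).
Proof.
move=> fs; rewrite /Cintegral /Rintegral; congr fine.
rewrite integral_mkcond; apply: eq_integral => t _.
rewrite patchE; case: ifPn => //; rewrite notin_setE /= /uball /= => H.
by have [->//|/fs] := eqVneq (f (ofr t)) 0%R.
Qed.

Lemma cint_rho : cint (fun z => (rho z)%:E) = 1.
Proof.
have := kernel_mass rk; rewrite (Cintegral_cint rho_supp).
by case: (cint _) => //= [r ->//|H|H]; move: (@oner_neq0 R); rewrite -H eqxx.
Qed.

Lemma measurable_coords_scaleV : measurable_coords (fun p : T * measurableTypeR R => ((p.2 : R)%:C)%C *: ofr p.1).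
Proof.
apply: measurable_coordsZ.
- exact: measurable_snd.
- exact: measurable_cst.
- apply: (measurable_coords_comp (h := fst) measurable_fst); exact: measurable_coords_ofr.
Qed.

Local Notation I1 := (`[1%R, +oo[%classic : set R).

(** Exchange the two integrals and substitute z / s for z. The inner integral becomes a
    regularization at the scale 1 / s, and the weights s^(-2n) are integrable on [1, +oo[ as
    soon as n > 0. *)
Lemma cint_ray_integral (V : Cn R n -> \bar R) : cmeas V -> (forall z, 0 <= V z) ->
  let h s := (s ^- (n + n))%:E * cint (fun z => (rho z)%:E * V ((s^-1)%:C%C *: z)%R) in
  [/\ cmeas (ray_integral rho), measurable_fun I1 h &
  cint (fun z => ray_integral rho z * V z) = \int[mu]_(s in I1) h s].
Proof.
move=> mV V0 h.
have rho0 z : 0 <= (rho z)%:E by rewrite lee_fin; exact: kernel_ge0 rk z.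
have mI : measurable I1 by exact: measurable_itv.
have i0 (t : R) : 0 <= (\1_I1 t)%:E :> \bar R by rewrite lee_fin.
have mrs : measurable_fun setT (fun p : T * measurableTypeR R => (rho (((p.2 : R)%:C)%C *: ofr p.1))%:E).
  exact: (cmeas_comp cmeas_rho measurable_coords_scaleV).
have mind : measurable_fun setT (fun p : T * measurableTypeR R => (\1_I1 (p.2 : R))%:E : \bar R).
  by apply/measurable_EFinP; apply: (measurableT_comp _ measurable_snd); exact: measurable_indic.
have mK : cmeas (ray_integral rho).
  have [H _ _] := @cint_swap R n (fun s z => (\1_I1 s)%:E * (rho (s%:C%C *: z))%:E) (emeasurable_funM mind mrs) (fun s z => mule_ge0 (i0 s) (rho0 _)).
  rewrite /cmeas (_ : _ \o _ = (fun z => \int[mu]_s ((\1_I1 s)%:E * (rho (s%:C%C *: z))%:E)) \o ofr) //.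
  by apply/funext => t /=; rewrite /ray_integral integral_weight.
have G0 s z : 0 <= (\1_I1 s)%:E * ((rho (s%:C%C *: z))%:E * V z) by rewrite !mule_ge0.
have mV1 : measurable_fun setT (fun p : T * measurableTypeR R => V (ofr p.1)).
  exact: (measurableT_comp mV measurable_fst).
have mG : measurable_fun setT (fun p : T * measurableTypeR R => (\1_I1 (p.2 : R))%:E * ((rho (((p.2 : R)%:C)%C *: ofr p.1))%:E * V (ofr p.1))).
  by apply: emeasurable_funM => //; exact: emeasurable_funM.
have [_ mh0 E] := cint_swap mG G0.
have hE s : cint (fun z => (\1_I1 s)%:E * ((rho (s%:C%C *: z))%:E * V z)) = (\1_I1 s)%:E * h s.
  have [sI|sI] := boolP (s \in I1); last first.
    rewrite indicE (negbTE sI) mul0e; under [X in cint X]eq_fun do rewrite mul0e.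
    by rewrite /cint integral0.
  have s1 : (1 <= s)%R by move: sI; rewrite inE /= in_itv /= andbT.
  have s0 : (0 < s)%R by rewrite (lt_le_trans ltr01).
  rewrite indicE sI mul1e; under [X in cint X]eq_fun do rewrite mul1e.
  rewrite /h [X in _ * X](cint_scale s0); first last.
  - by move=> z; rewrite mule_ge0.
  - apply: cmeasM; first exact: cmeas_rho.
    apply: (cmeas_comp mV); by apply: measurable_coordsZ; [exact: measurable_cst|exact: measurable_cst|exact: measurable_coords_ofr].
  rewrite muleA -EFinM mulVf ?mul1e; last by rewrite expf_neq0 // gt_eqF.
  apply: eq_integral => t _; congr (_ * V _).
  by rewrite scalerA -creal_M mulVf ?gt_eqF // scale1r.
have mhh : measurable_fun setT (h \_ I1).
  rewrite (_ : _ \_ _ = fun s => cint (fun z => (\1_I1 s)%:E * ((rho (s%:C%C *: z))%:E * V z))); first exact: mh0.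
  by apply/funext => s; rewrite hE patchE indicE; case: (s \in I1); rewrite ?mul1e ?mul0e.
split; [exact: mK|exact: (measurable_restrictT h mI).2 mhh|].
transitivity (cint (fun z => \int[mu]_s ((\1_I1 s)%:E * ((rho (s%:C%C *: z))%:E * V z)))).
  apply: eq_integral => t _.
  rewrite /ray_integral integral_weight -ge0_integralZr //.
  - by apply: eq_integral => s _; rewrite muleA.
  - apply: emeasurable_funM; first by apply/measurable_EFinP; exact: measurable_indic.
    apply: (cmeas_comp cmeas_rho (g := fun s : measurableTypeR R => ((s : R)%:C)%C *: ofr t)).
    by apply: measurable_coordsZ; [exact: measurable_id|exact: measurable_cst|exact: measurable_coords_cst].
  - by move=> s _; rewrite mule_ge0.
rewrite -E [RHS]integral_weight; apply: eq_integral => s _; exact: hE.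
Qed.

End rho.
End Kernel.

(** * From the regularization to means over balls *)

Section Volume.
Context (R : realType) (n : nat).
Context (n_gt0 : (0 < n)%N).
Local Notation mu := (@lebesgue_measure R).
Local Notation T := ((n + n).-tuple R).
Local Notation ofr := (@of_real_coords R n).
Local Notation lamn := (lam (m := n + n)).
Local Open Scope ereal_scope.

Lemma cint_ball_scale (r : R) : (0 < r)%R ->
  cint (@ball_ind R n r) = (r ^+ (n + n))%:E * cint (@ball_ind R n 1).
Proof.
move=> r0; rewrite (cint_scale r0); [|exact: cmeas_ball_ind|exact: ball_ind_ge0].
congr (_ * _); apply: eq_integral => t _.
by rewrite /ball_ind enormZr gtr0_norm // -ltr_pdivlMl // mulVf // gt_eqF.
Qed.

Lemma cint_ball1_fin : cint (@ball_ind R n 1) < +oo.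
Proof.
have mb : measurable (@tbox R (n + n) 1) by exact: measurable_tbox.
apply: (@le_lt_trans _ _ (\int[lamn]_t (\1_(@tbox R (n + n) 1) t)%:E)); last first.
  rewrite integral_indic // setIT; exact: lebesgue_tuple_tbox.
apply: ge0_le_integral => //.
- by move=> t _; exact: ball_ind_ge0.
- exact: cmeas_ball_ind.
- by apply/measurable_EFinP; exact: measurable_indic.
move=> t _; rewrite /ball_ind; case: ifPn => [H|_]; rewrite lee_fin // indicE mem_set //=.
move=> i; rewrite -ler_norml.
case: (fintype.splitP i) => j ij.
  rewrite (_ : i = lshift n j); last exact: val_inj.
  by rewrite -Re_ofr (le_trans (ler_enorm_Re _ _)) // ltW.
rewrite (_ : i = rshift n j); last exact: val_inj.
by rewrite -Im_ofr (le_trans (ler_enorm_Im _ _)) // ltW.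
Qed.

Let N0 : set T := ofr @^-1` [set 0%R].

Lemma measurable_N0 : measurable N0.
Proof.
have -> : N0 = (fun t => enorm (ofr t)) @^-1` [set 0%R].
  apply/seteqP; split=> t /=; first by rewrite /N0 /= => ->; rewrite enorm0.
  exact: enorm_eq0.
rewrite -[X in measurable X]setTI; apply: measurable_enorm => //.
Qed.

(** The value ray_integral rho 0 may be infinite, so identities between kernels hold outside
    the origin only. Doubling z fixes {0} and multiplies volumes by 2^(2n) > 1, hence {0},
    which has finite measure, is a null set. *)
Lemma lam_N0 : lamn N0 = 0.
Proof.
pose f (z : Cn R n) : \bar R := (if z == 0%R then 1%R else 0%R)%:E.
have ffE t : f (ofr t) = (\1_N0 t)%:E.
  rewrite /f indicE; case: eqP => [H|H]; first by rewrite mem_set.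
  by rewrite memNset.
have fE : cint f = lamn N0.
  rewrite -(setIT N0) -(integral_indic lamn measurableT measurable_N0) //.
  by apply: eq_integral => t _; exact: ffE.
have mf : cmeas f.
  rewrite /cmeas (_ : f \o ofr = fun t => (\1_N0 t)%:E); last exact/funext.
  by apply/measurable_EFinP; apply: measurable_indic; exact: measurable_N0.
have f0 z : 0 <= f z by rewrite /f; case: ifP => _; rewrite lee_fin.
have fin : cint f < +oo.
  apply: le_lt_trans cint_ball1_fin; apply: le_cint => //; first exact: cmeas_ball_ind.
  move=> z; rewrite /f /ball_ind; case: eqP => [->|_]; rewrite ?enorm0 ?ltr01 //.
  by case: ifP => _; rewrite lee_fin.
have c0 : 0 <= cint f by exact: cint_ge0.
have := cint_scale (ltr0n R 2) mf f0.
have -> : cint (fun z => f ((2%:R)%:C%C *: z)) = cint f.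
  apply: eq_integral => t _; rewrite /f scaler_eq0 eq_complex /= eqxx andbT.
  by rewrite pnatr_eq0.
rewrite -fE; case: (cint f) c0 fin => // r r0 _.
move=> []; rewrite -[LHS]mul1r => /eqP; rewrite -subr_eq0 -mulrBl mulf_eq0 => /orP[|/eqP -> //].
rewrite subr_eq0 eq_sym -natrX pnatr_eq1 gtn_eqF //.
by rewrite (leq_ltn_trans _ (ltn_expl _ _)) // addn_gt0 n_gt0.
Qed.

Lemma cint_ae (f g : Cn R n -> \bar R) : cmeas f -> cmeas g ->
  (forall z, 0 <= f z) -> (forall z, 0 <= g z) ->
  (forall z, z != 0%R -> f z = g z) -> cint f = cint g.
Proof.
move=> mf mg f0 g0 fg; apply: ge0_ae_eq_integral => //.
exists N0; split; [exact: measurable_N0|exact: lam_N0|].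
move=> t /= H; apply: contrapT => Nt; apply: H => _; apply: fg.
by apply/eqP.
Qed.

Lemma measurable_sV N : measurable_fun (`[1%R, +oo[%classic : set R) (fun s : R => (s ^- N)%:E).
Proof.
apply/measurable_EFinP; apply: subspace_continuous_measurable_fun => //.
apply/continuous_within_itvcyP; split.
  move=> x; rewrite in_itv /= andbT => x1.
  have x0 : (x ^+ N != 0)%R by rewrite expf_neq0 // gt_eqF // (lt_trans ltr01).
  apply: cvgV => //; exact: exprn_continuous.
apply: cvg_at_right_filter; apply: cvgV; first by rewrite expr1n oner_neq0.
exact: exprn_continuous.
Qed.

Section KernelMean.
Context (rho : Cn R n -> R) (rk : regularizing_kernel rho).

Lemma cmeas_ray_integral : cmeas (ray_integral rho).
Proof. by have [] := cint_ray_integral rk (cmeas_cst 0) (fun=> lexx 0). Qed.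

Lemma ray_integral_ge0 z : 0 <= ray_integral rho z.
Proof. by apply: integral_ge0 => t _; rewrite lee_fin; exact: kernel_ge0 rk _. Qed.

Lemma ray_integral_radial z w : enorm z = enorm w -> ray_integral rho z = ray_integral rho w.
Proof.
move=> zw; apply: eq_integral => s _; congr (_%:E).
by apply: (kernel_radial rk); rewrite !enormZr zw.
Qed.

Lemma measurable_rho_ray z : measurable_fun [set: measurableTypeR R] (fun s : measurableTypeR R => (rho (s%:C%C *: z))%:E).
Proof.
apply: (cmeas_comp (cmeas_rho rk) (g := fun s : measurableTypeR R => ((s : R)%:C)%C *: z)).
by apply: measurable_coordsZ; [exact: measurable_id|exact: measurable_cst|exact: measurable_coords_cst].
Qed.

(** Substituting x / r for x in the integral of the right-hand side moves its lower bound 1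
    to r and gives a factor 1 / r >= 1. *)
Lemma ray_integral_mono (r : R) z : (0 < r <= 1)%R -> ray_integral rho z <= ray_integral rho (r%:C%C *: z).
Proof.
move=> /andP[r0 r1].
have k0 w : 0 <= (rho w)%:E by rewrite lee_fin; exact: kernel_ge0 rk w.
have i0 (t : R) : 0 <= (\1_(`[1%R, +oo[) t)%:E :> \bar R by rewrite lee_fin.
have mI : measurable_fun [set: measurableTypeR R] (fun s : measurableTypeR R => (\1_(`[1%R, +oo[) (s : R))%:E : \bar R).
  by apply/measurable_EFinP; apply: measurable_indic; exact: measurable_itv.
have mray := measurable_rho_ray (r%:C%C *: z).
have mprod := emeasurable_funM mI mray.
apply: (@le_trans _ _ (r%:E * ray_integral rho (r%:C%C *: z))); last first.
  rewrite -[leRHS]mul1e; apply: lee_wpmul2r; first exact: ray_integral_ge0.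
  by rewrite lee_fin.
rewrite {1}/ray_integral integral_weight (ge0_integralMl r0); last 2 first.
- exact: (emeasurable_funM mI (measurable_rho_ray z)).
- by move=> x; exact: mule_ge0.
apply: lee_wpmul2l; first by rewrite lee_fin ltW.
rewrite /ray_integral [leRHS]integral_weight; apply: ge0_le_integral => //.
- by move=> x _; exact: mule_ge0.
- have -> : (fun x => (\1_(`[1%R, +oo[) (r * x)%R)%:E * (rho ((r * x)%R%:C%C *: z))%:E) =
    (fun x => (\1_(`[1%R, +oo[) (x : R))%:E * (rho ((x)%R%:C%C *: z))%:E) \o (fun x : measurableTypeR R => (r * x)%R : measurableTypeR R) by [].
  apply: measurableT_comp; last exact: measurable_mulr.
  exact: (emeasurable_funM mI (measurable_rho_ray z)).
move=> x _; rewrite creal_M [(r%:C%C * _)%R]mulrC -scalerA; apply: lee_wpmul2r => //.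
rewrite lee_fin !indicE ler_nat.
case: (boolP (r * x \in _)%R) => // H.
rewrite mem_set //= in_itv /= andbT.
move: H; rewrite inE /= in_itv /= andbT => H.
have x0 : (0 < x)%R by rewrite -(pmulr_rgt0 _ r0) (lt_le_trans ltr01).
by rewrite (le_trans H) // ger_pMl.
Qed.

Let power_tail : \bar R := \int[mu]_(s in `[1%R, +oo[) (s ^- (n + n))%:E.

Lemma power_tail_fin : power_tail < +oo.
Proof.
apply: (@le_lt_trans _ _ 1); last exact: ltry.
rewrite -(integral_sqrV R); apply: ge0_le_integral => //.
- by move=> x; rewrite /= in_itv /= andbT => x1; rewrite lee_fin invr_ge0 exprn_ge0 // (le_trans ler01).
- exact: measurable_sV.
- exact: measurable_sV.
move=> x; rewrite /= in_itv /= andbT => x1.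
rewrite lee_fin lef_pV2 ?posrE ?exprn_gt0 ?(lt_le_trans ltr01) //.
by rewrite ler_weXn2l // addnn -muln2 leq_pmull.
Qed.

Lemma power_tail_gt0 : 0 < power_tail.
Proof.
apply: (@lt_le_trans _ _ (\int[mu]_(s in `[1%R, 2%R]) (2 ^- (n + n))%:E)).
  rewrite integral_cst //= lebesgue_measure_itv /= lte_fin ltr1n.
  by rewrite -EFinB -EFinM lte_fin mulr_gt0 // ?invr_gt0 ?exprn_gt0 // subr_gt0 ltr1n.
apply: (@le_trans _ _ (\int[mu]_(s in `[1%R, 2%R]) (s ^- (n + n))%:E)).
  apply: ge0_le_integral => //.
  - have sub : (`[1%R, 2%R]%classic : set R) `<=` `[1%R, +oo[%classic.
      by move=> x; rewrite /= !in_itv /= => /andP[-> _].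
    exact: (measurable_funS (measurable_itv _) sub (measurable_sV (n + n))).
  move=> x; rewrite /= in_itv /= => /andP[x1 x2].
  have x0 : (0 < x)%R by rewrite (lt_le_trans ltr01).
  by rewrite lee_fin lef_pV2 ?posrE ?exprn_gt0 // lerXn2r ?nnegrE ?(ltW x0).
apply: ge0_subset_integral => //.
- exact: measurable_sV.
- by move=> x; rewrite /= in_itv /= andbT => x1; rewrite lee_fin invr_ge0 exprn_ge0 // (le_trans ler01).
by move=> x; rewrite /= !in_itv /= => /andP[-> _].
Qed.

Lemma cint_ray_integral1 : cint (ray_integral rho) = power_tail.
Proof.
have [_ _ E] := cint_ray_integral rk (cmeas_cst 1) (fun=> lee01).
transitivity (cint (fun z => ray_integral rho z * 1)).
  by apply: eq_integral => t _; rewrite mule1.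
rewrite E; apply: eq_integral => s _.
rewrite (_ : cint _ = 1) ?mule1 //; apply: etrans (cint_rho rk).
by apply: eq_integral => t _ /=; rewrite mule1.
Qed.

(** Otherwise the kernel vanishes outside 0, although its total mass is positive; once
    positive at z0 it is at least as large at all points closer to 0, being radial and
    monotone. *)
Lemma ray_integral_lower : exists a c : R, [/\ (0 < a)%R, (0 < c)%R &
  forall z, z != 0%R -> (enorm z < a)%R -> c%:E <= ray_integral rho z].
Proof.
have [z0 z00 kz0] : exists2 z0, z0 != 0%R & 0 < ray_integral rho z0.
  apply: contrapT => H.
  have K0 z : z != 0%R -> ray_integral rho z = 0.
    move=> zn; apply/eqP; rewrite eq_le ray_integral_ge0 andbT leNgt; apply/negP => k0.
    by apply: H; exists z.
  have := power_tail_gt0; rewrite -cint_ray_integral1 (cint_ae (g := fun=> 0) cmeas_ray_integral) //.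
  - by rewrite /cint integral0 ltxx.
  - exact: cmeas_cst.
  - exact: ray_integral_ge0.
have a0 : (0 < enorm z0)%R.
  by rewrite lt_def enorm_ge0 andbT; apply: contra z00 => /eqP/enorm_eq0 ->.
exists (enorm z0), (if ray_integral rho z0 is r%:E then r else 1%R); split => //.
  by move: kz0; case: (ray_integral _ _).
move=> z zn za.
have zp : (0 < enorm z)%R.
  by rewrite lt_def enorm_ge0 andbT; apply: contra zn => /eqP/enorm_eq0 ->.
apply: (@le_trans _ _ (ray_integral rho z0)).
  by move: kz0; case: (ray_integral _ _) => //= _; rewrite leey.
rewrite (@ray_integral_radial z ((enorm z / enorm z0)%:C%C *: z0)%R); last first.
  by rewrite enormZr ger0_norm ?divr_ge0 ?enorm_ge0 // divfK // gt_eqF.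
apply: ray_integral_mono; rewrite divr_gt0 //= ler_pdivrMr // mul1r ltW //.
Qed.

Lemma ray_integral_supp z : ray_integral rho z != 0 -> (enorm z < 1)%R.
Proof.
apply: contraR; rewrite -leNgt => z1; apply/eqP; apply: integral0_eq => s.
rewrite /= in_itv /= andbT => s1; congr (_%:E).
apply/eqP; apply: contraT => /(rho_supp rk); rewrite enormZr ltNge.
by rewrite mulr_ege1 // ger0_norm // (le_trans ler01).
Qed.

(** The kernel rho is bounded with mass 1 and lives on the unit ball, which therefore is not
    a null set. *)
Lemma cint_ball1_gt0 : 0 < cint (@ball_ind R n 1).
Proof.
rewrite lt0e cint_ge0 ?andbT; last exact: ball_ind_ge0.
apply/eqP => b0; have [M rM] := kernel_bounded rk.
have M0 : (0 <= M)%R by apply: le_trans (rM 0%R); exact: kernel_ge0 rk _.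
have := cint_rho rk; apply/eqP; rewrite lt_eqF //.
apply: (@le_lt_trans _ _ (cint (fun z : Cn R n => M%:E * ball_ind 1 z))); last first.
  rewrite cintZl ?lee_fin //; [|exact: cmeas_ball_ind|exact: ball_ind_ge0].
  by rewrite b0 mule0 lte01.
apply: le_cint.
- exact: cmeas_rho.
- by apply: cmeasM; [exact: cmeas_cst|exact: cmeas_ball_ind].
- by move=> z; rewrite lee_fin; exact: kernel_ge0 rk _.
move=> z; rewrite /ball_ind -EFinM lee_fin; case: ifPn => [_|z1]; first by rewrite mulr1.
by have [->|/(rho_supp rk)] := eqVneq (rho z) 0%R; [rewrite mulr0|rewrite (negbTE z1)].
Qed.

(** The submean inequality, integrated against the radial weight k = max (0, K - c 1_B) with
    B the ball of radius a, bounds the integral of k V from below by b times the mass of k.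
    The bound on the dilates bounds the integral of K V from above by b + E times the mass
    of K. As K = k + c 1_B outside 0, subtraction leaves the bound of the integral of V on
    B. *)
Lemma ball_mean : exists a C : R, [/\ (0 < a <= 1)%R, (0 <= C)%R &
  forall (V : Cn R n -> \bar R) (b E : R), cmeas V -> (forall z, 0 <= V z) ->
  (0 <= b)%R -> (0 <= E)%R ->
  (forall z, (enorm z < 1)%R ->
     (2 * pi * b)%:E <= \int[mu]_(t in `[0%R, (2 * pi)%R]) V (expi t *: z)%R) ->
  (forall s : R, (1 <= s)%R ->
     cint (fun z => (rho z)%:E * V ((s^-1)%:C%C *: z)%R) <= (b + E)%:E) ->
  cint (fun z : Cn R n => ball_ind a z * V z) <= (b + C * E)%:E * cint (@ball_ind R n a)].
Proof.
have [a0 [c [a00 c0 kc0]]] := ray_integral_lower.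
pose a := Num.min a0 1%R.
have ap : (0 < a)%R by rewrite lt_min a00 ltr01.
have kc z : z != 0%R -> (enorm z < a)%R -> c%:E <= ray_integral rho z.
  by move=> zn za; apply: kc0 => //; apply: lt_le_trans za _; rewrite ge_min lexx.
have power_tailE : exists2 s : R, power_tail = s%:E & (0 < s)%R.
  move: power_tail_fin power_tail_gt0; case: power_tail => // s _ sp; by exists s.
have [s sE sp] := power_tailE.
have bE : exists2 v : R, cint (@ball_ind R n a) = v%:E & (0 < v)%R.
  rewrite (cint_ball_scale ap).
  move: cint_ball1_fin cint_ball1_gt0; case: (cint _) => // v _ vp.
  by exists (a ^+ (n + n) * v)%R; rewrite ?mulr_gt0 ?exprn_gt0.
have [v vE vp] := bE.
exists a, (s / (c * v))%R; split.
- by rewrite ap ge_min lexx orbT.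
- by rewrite divr_ge0 ?mulr_ge0 ?ltW.
move=> V b E mV V0 b0 E0 sub reg.
(* The maximum only matters at the origin. *)
pose k (z : Cn R n) : \bar R := maxe 0 (ray_integral rho z - c%:E * ball_ind a z).
have k0 z : 0 <= k z by rewrite /k le_max lexx.
have mcb : cmeas (fun z : Cn R n => c%:E * ball_ind a z).
  by apply: cmeasM; [exact: cmeas_cst|exact: cmeas_ball_ind].
have cb0 (z : Cn R n) : 0 <= c%:E * ball_ind a z.
  by rewrite mule_ge0 ?ball_ind_ge0 // lee_fin ltW.
have mk : cmeas k.
  apply: measurable_maxe => //; apply: emeasurable_funB => //; exact: cmeas_ray_integral.
have kE z : z != 0%R -> ray_integral rho z = k z + c%:E * ball_ind a z.
  move=> zn; have fin : c%:E * ball_ind a z \is a fin_num by rewrite /ball_ind -EFinM.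
  rewrite /k (max_idPr _) ?subeK // sube_ge0 //.
  rewrite /ball_ind; case: ifPn => za; last by rewrite mule0 ray_integral_ge0.
  by rewrite mule1; exact: kc.
have rk' t z : k (expi t *: z)%R = k z.
  rewrite /k /ball_ind enormZ_expi (@ray_integral_radial _ z) //; exact: enormZ_expi.
have ks z : k z != 0 -> (enorm z < 1)%R.
  move=> kz; apply: ray_integral_supp; apply: contra kz => /eqP kz0.
  rewrite /k kz0 sub0e; apply/eqP/max_idPl; rewrite oppe_le0 //.
have M1 := mean_cint mk mV k0 V0 b0 rk' (fun z kz => sub z (ks z kz)).
have mkV : cmeas (fun z => k z * V z) by exact: cmeasM.
have kV0 z : 0 <= k z * V z by exact: mule_ge0.
have mbV : cmeas (fun z : Cn R n => ball_ind a z * V z) by apply: cmeasM => //; exact: cmeas_ball_ind.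
have bV0 z : 0 <= ball_ind a z * V z by rewrite mule_ge0 ?ball_ind_ge0.
have c0' : 0 <= c%:E by rewrite lee_fin ltW.
have K1 : cint k + c%:E * v%:E = s%:E.
  rewrite -vE -sE -cint_ray_integral1 -cintZl //; [|exact: cmeas_ball_ind|exact: ball_ind_ge0].
  rewrite -cintD //; apply: cint_ae.
  - exact: cmeasD.
  - exact: cmeas_ray_integral.
  - by move=> z; rewrite adde_ge0.
  - exact: ray_integral_ge0.
  - by move=> z zn; rewrite [RHS]kE.
have [_ mh K2] := cint_ray_integral rk mV V0.
have K3 : cint (fun z => ray_integral rho z * V z) =
    cint (fun z => k z * V z) + c%:E * cint (fun z : Cn R n => ball_ind a z * V z).
  rewrite -cintZl // -cintD //; last 2 first.
  - by apply: cmeasM => //; exact: cmeas_cst.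
  - by move=> z; rewrite mule_ge0.
  apply: cint_ae.
  - by apply: cmeasM => //; exact: cmeas_ray_integral.
  - apply: cmeasD => //; apply: cmeasM => //; exact: cmeas_cst.
  - by move=> z; rewrite mule_ge0 ?ray_integral_ge0.
  - by move=> z; rewrite adde_ge0 // mule_ge0.
  - by move=> z zn; rewrite kE // ge0_muleDl // muleA.
have K4 : cint (fun z => ray_integral rho z * V z) <= (b + E)%:E * s%:E.
  rewrite K2 -sE /power_tail muleC -ge0_integralZr ?lee_fin ?addr_ge0 //; last 2 first.
  - exact: measurable_sV.
  - by move=> x; rewrite /= in_itv /= andbT => x1; rewrite lee_fin invr_ge0 exprn_ge0 // (le_trans ler01).
  apply: ge0_le_integral => //.
  - move=> x; rewrite /= in_itv /= andbT => x1; rewrite mule_ge0 //.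
      by rewrite lee_fin invr_ge0 exprn_ge0 // (le_trans ler01).
    by apply: cint_ge0 => z; rewrite mule_ge0 // lee_fin; exact: kernel_ge0 rk _.
  - by apply: emeasurable_funM; [exact: measurable_sV|exact: measurable_cst].
  - move=> x; rewrite /= in_itv /= andbT => x1.
    apply: lee_wpmul2l; last exact: reg.
    by rewrite lee_fin invr_ge0 exprn_ge0 // (le_trans ler01).
have k1 : 0 <= cint k by exact: cint_ge0.
have J0 : 0 <= cint (fun z : Cn R n => ball_ind a z * V z) by exact: cint_ge0.
have J1 : 0 <= cint (fun z : Cn R n => k z * V z) by exact: cint_ge0.
move: K4; rewrite K3 vE => K4.
have := le_trans (leeD2r (c%:E * cint (fun z : Cn R n => ball_ind a z * V z)) M1) K4.
move: K1 k1 J0; case: (cint k) => [q||] //.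
case: (cint (fun z : Cn R n => ball_ind a z * V z)) => // [J|]; last first.
  by rewrite gt0_muley ?lte_fin //= => _ _ _; rewrite -EFinM.
rewrite -!EFinM -!EFinD !lee_fin => -[K1] q0 J0.
rewrite -K1 => H.
have {H} : (c * J <= b * c * v + E * (q + c * v))%R by nra.
rewrite K1 => H.
rewrite -(ler_pM2l c0) (le_trans H) //.
by rewrite le_eqVlt; apply/orP; left; apply/eqP; field; rewrite !gt_eqF.
Qed.

End KernelMean.
End Volume.

(** * One step of oscillation decay *)

Section Osc.
Context (R : realType) (n : nat).
Context (n_gt0 : (0 < n)%N).
Local Notation mu := (@lebesgue_measure R).
Local Notation T := ((n + n).-tuple R).
Local Notation ofr := (@of_real_coords R n).
Context (rho : Cn R n -> R) (rk : regularizing_kernel rho).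

Lemma exprB_le (r r' : R) N : 0 < r -> 0 <= r' <= r ->
  r ^+ N - r' ^+ N <= N%:R * ((r - r') / r) * r ^+ N.
Proof.
move=> r0 /andP[r'0 r'r]; elim: N => [|N IH]; first by rewrite !expr0 subrr !mul0r.
have e1 : r ^+ N.+1 - r' ^+ N.+1 = r * (r ^+ N - r' ^+ N) + (r - r') * r' ^+ N.
  by rewrite !exprS; ring.
have e2 : N.+1%:R * ((r - r') / r) * r ^+ N.+1 =
    r * (N%:R * ((r - r') / r) * r ^+ N) + (r - r') * r ^+ N.
  by rewrite -natr1 exprS; field; rewrite gt_eqF.
rewrite e1 e2; apply: lerD; first by rewrite ler_pM2l.
by rewrite ler_wpM2l ?subr_ge0 // lerXn2r // nnegrE ltW.
Qed.

Lemma cmeas_affine (U : Cn R n -> R) x (s : R) : cmeas (EFin \o U) ->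
  cmeas (fun z => (U (x + s%:C%C *: z))%:E).
Proof.
move=> mU; apply: (cmeas_comp mU); apply: measurable_coordsD; first exact: measurable_coords_cst.
by apply: measurable_coordsZ; [exact: measurable_cst|exact: measurable_cst|exact: measurable_coords_ofr].
Qed.

Lemma cmeas_translate (U : Cn R n -> \bar R) x : cmeas U -> cmeas (fun z => U (x + z)).
Proof.
move=> mU; apply: (cmeas_comp mU); apply: measurable_coordsD; [exact: measurable_coords_cst|exact: measurable_coords_ofr].
Qed.

(** With r = a d and r' = r - |y - x|, split B(x, r) into B(y, r') and its complement D. On
    the first part the submean inequality at y gives the lower bound U(y) - L of the mean,
    on D the lower bound is U(x) - m, and the mean over B(x, r) is at most U(x) + C (E + L)
    by [ball_mean]. The volume of D is O(|y - x| / r) times that of B(x, r). *)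
Lemma osc_step : exists a C : R, [/\ 0 < a <= 1, 0 <= C &
  forall (U : Cn R n -> R) (x y : Cn R n) (d L E m : R),
  cmeas (EFin \o U) -> (forall z, 0 <= U z) ->
  0 < d -> 0 <= L -> 0 <= E -> 0 <= m ->
  (forall z, enorm z < d -> ((2 * pi * U x)%:E <=
     \int[mu]_(t in `[0%R, (2 * pi)%R]) (U (x + expi t *: z)%R + L)%:E)%E) ->
  (forall z, enorm z < d -> ((2 * pi * U y)%:E <=
     \int[mu]_(t in `[0%R, (2 * pi)%R]) (U (y + expi t *: z)%R + L)%:E)%E) ->
  (forall d' : R, 0 < d' <= d ->
     (cint (fun z => (rho z)%:E * (U (x + d'%:C%C *: z)%R)%:E) <= (U x + E)%:E)%E) ->
  enorm (y - x) <= a * d / 2 ->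
  (forall p, enorm (p - x) < a * d -> U x - m <= U p) ->
  U y - U x <= C * (E + L) + C * m * (enorm (y - x) / (a * d))].
Proof.
have [a [C1 [a01 C10 BM]]] := ball_mean n_gt0 rk.
have /andP[a0 a1] := a01.
pose N := (n + n)%N.
exists a, (2 ^+ N * (C1 + 1 + N%:R)).
split => //; first by rewrite mulr_ge0 ?exprn_ge0 // !addr_ge0.
move=> U x y d L E m mU U0 d0 L0 E0 m0 subx suby reg txy osc.
pose r := a * d; pose t := enorm (y - x); pose h := y - x.
have r0 : 0 < r by rewrite mulr_gt0.
have t0 : 0 <= t by exact: enorm_ge0.
have rd : r <= d by rewrite ger_pMl.
pose r' := r - t.
have r'0 : 0 < r'.
  by rewrite subr_gt0 (le_lt_trans txy) // -/r ltr_pdivrMr // ltr_pMr // ltr1n.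
have r'r : r' <= r by rewrite gerBl.
have rr' : r <= 2 * r' by rewrite /r' mulrBr mulrDl !mul1r; move: txy; rewrite -/t -/r; lra.
have [v vE vp] : exists2 v : R, cint (@ball_ind R n 1) = v%:E & 0 < v.
  have := cint_ball1_fin R n; have := cint_ball1_gt0 rk.
  by case: (cint _) => // v vp _; exists v.
have volE s : 0 < s -> cint (@ball_ind R n s) = (s ^+ N * v)%:E.
  by move=> s0; rewrite cint_ball_scale // vE EFinM.
have mUx : cmeas (fun z => (U (x + z))%:E) by exact: (cmeas_translate _ mU).
have mUy : cmeas (fun z => (U (y + z))%:E) by exact: (cmeas_translate _ mU).
have mb s : cmeas (@ball_ind R n s) by exact: cmeas_ball_ind.
have Ux0 z : (0 <= (U (x + z))%:E)%E by rewrite lee_fin.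
have b0 s (z : Cn R n) : (0 <= ball_ind s z)%E by exact: ball_ind_ge0.
(* Rescaling by d turns the bounds on the regularizations into those of [ball_mean]. *)
have Jx : (cint (fun z => ball_ind r z * (U (x + z))%:E) <= ((U x + C1 * (E + L)) * (r ^+ N * v))%:E)%E.
  rewrite (cint_scale d0); first last.
  - by move=> z; rewrite mule_ge0.
  - exact: cmeasM.
  have -> : r ^+ N * v = d ^+ N * (a ^+ N * v) by rewrite /r exprMn; ring.
  rewrite mulrCA EFinM; apply: lee_wpmul2l; first by rewrite lee_fin exprn_ge0 ?ltW.
  rewrite EFinM -(volE a a0).
  pose V (z : Cn R n) := (U (x + d%:C%C *: z) + L)%:E.
  have V0 z : (0 <= V z)%E by rewrite lee_fin addr_ge0.
  have mV : cmeas V.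
    by apply: (cmeasD (f := fun z => (U (x + d%:C%C *: z))%:E) (g := fun _ => L%:E)); [exact: cmeas_affine|exact: cmeas_cst].
  apply: (le_trans _ (BM V (U x) (E + L) mV V0 (U0 x) _ _ _)); last 3 first.
  - by rewrite addr_ge0.
  - move=> z z1; have := subx (d%:C%C *: z).
    rewrite enormZr gtr0_norm // gtr_pMr // => /(_ z1) H.
    apply: (le_trans H); rewrite le_eqVlt; apply/orP; left; apply/eqP.
    by apply: eq_integral => s _; rewrite /V !scalerA [X in X *: _]mulrC.
  - move=> s s1; have s0 : 0 < s by rewrite (lt_le_trans ltr01).
    have ds : 0 < d / s <= d by rewrite divr_gt0 //= ler_pdivrMr // ler_peMr // ltW.
    have mUs : cmeas (fun z => (rho z)%:E * (U (x + (d / s)%:C%C *: z))%:E)%E.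
      by apply: cmeasM; [exact: cmeas_rho|exact: cmeas_affine].
    have rho0 z : (0 <= (rho z)%:E)%E by rewrite lee_fin (kernel_ge0 rk).
    have -> : cint (fun z => (rho z)%:E * V (s^-1%:C%C *: z))%E =
       (cint (fun z => (rho z)%:E * (U (x + (d / s)%:C%C *: z))%:E) + L%:E * cint (fun z => (rho z)%:E))%E.
      rewrite -cintZl ?lee_fin //; last exact: cmeas_rho.
      rewrite -cintD //; last 3 first.
      - by apply: cmeasM; [exact: cmeas_cst|exact: cmeas_rho].
      - by move=> z; rewrite mule_ge0 // lee_fin.
      - by move=> z; rewrite mule_ge0 // lee_fin.
      apply: eq_integral => u _; rewrite /V scalerA -creal_M -!EFinM -EFinD; congr (_%:E).
      by ring.
    rewrite cint_rho // mule1 addrA EFinD leeD2r //.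
    exact: reg.
  apply: le_cint.
  - apply: cmeasM; last exact: cmeas_affine.
    rewrite (_ : (fun z => ball_ind r (d%:C%C *: z)) = ball_ind a) //.
    apply/funext => z; rewrite /ball_ind enormZr gtr0_norm // /r.
    by rewrite [a * d]mulrC ltr_pM2l.
  - by apply: cmeasM.
  - by move=> z; rewrite mule_ge0 // lee_fin.
  move=> z; rewrite {1}/ball_ind enormZr gtr0_norm // /r [a * d]mulrC ltr_pM2l //.
  by apply: lee_wpmul2l; [case: ifP => _; rewrite lee_fin|rewrite /V lee_fin lerDl].
pose sb (z : Cn R n) : \bar R := ball_ind r' (z - h).
have sb0 z : (0 <= sb z)%E by exact: ball_ind_ge0.
have [msb sbE] : cmeas sb /\ cint sb = (r' ^+ N * v)%:E.
  have [m1 e1] := preserves_cintD (- h) (mb r') (b0 r').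
  by split; [exact: m1|rewrite -volE // -e1].
(* All integrals are taken with x as the origin, so the mean at y is translated by h. *)
have Jy : ((U y * (r' ^+ N * v))%:E <=
    cint (fun z => sb z * (U (x + z))%:E) + (L * (r' ^+ N * v))%:E)%E.
  pose V (z : Cn R n) := ((U (y + z))%:E + L%:E)%E.
  have V0 z : (0 <= V z)%E by rewrite /V -EFinD lee_fin addr_ge0.
  have mV : cmeas V by apply: cmeasD => //; exact: cmeas_cst.
  have := mean_cint (mb r') mV (b0 r') V0 (U0 y).
  rewrite volE // -EFinM => /(_ _ _)/le_trans; apply.
  - by move=> s z; rewrite /ball_ind enormZ_expi.
  - move=> z; rewrite /ball_ind; case: ifPn => [zr _|]; last by rewrite eqxx.
    by apply: suby; rewrite (lt_le_trans zr) // (le_trans r'r).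
  have [_ <-] := preserves_cintD (- h) (f := fun z => (ball_ind r' z * V z)%E) (cmeasM (mb r') mV) (fun z => mule_ge0 (b0 r' z) (V0 z)).
  rewrite EFinM -sbE -cintZl ?lee_fin // -cintD; last 4 first.
  - exact: cmeasM.
  - by apply: cmeasM => //; exact: cmeas_cst.
  - by move=> z; rewrite mule_ge0.
  - by move=> z; rewrite mule_ge0 // lee_fin.
  rewrite le_eqVlt; apply/orP; left; apply/eqP; apply: eq_integral => s _ /=.
  rewrite /V /sb ge0_muleDr ?lee_fin // [(L%:E * _)%E]muleC; congr (_ * (U _)%:E + _)%E.
  by rewrite /h; move: (ofr s) => w; rewrite opprB; apply/rowP => j; rewrite !mxE; ring.
(* The complement of B(y, r') in B(x, r), with x moved to the origin. *)
pose D (z : Cn R n) : \bar R := (if (enorm z < r) && ~~ (enorm (z - h)%R < r') then 1 else 0)%:E.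
have subset z : enorm (z - h) < r' -> enorm z < r.
  move=> H; rewrite -(subrK h z) (le_lt_trans (ler_enormD _ _)) //.
  by rewrite -(subrK t r) ltrD2r.
have bE z : ball_ind r z = (sb z + D z)%E.
  rewrite /ball_ind /sb /D /ball_ind -EFinD; congr (_%:E).
  case: (boolP (enorm (z - h) < r')) => H; first by rewrite (subset _ H) andbF addr0.
  by rewrite andbT add0r.
have D0 z : (0 <= D z)%E by rewrite /D; case: ifP; rewrite lee_fin.
have mD : cmeas D.
  have -> : D = (fun z => ball_ind r z - sb z)%E.
    apply/funext => z; rewrite bE [(sb z + _)%E]addeC addeK //; rewrite /sb /ball_ind; by case: ifP.
  by apply: emeasurable_funB; [exact: mb|exact: msb].
have volD : ((r' ^+ N * v)%:E + cint D = (r ^+ N * v)%:E)%E.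
  rewrite -sbE -cintD // -volE //; apply: eq_integral => s _.
  by rewrite bE.
have JD : (cint (fun z => ball_ind r z * (U (x + z))%:E) =
    cint (fun z => sb z * (U (x + z))%:E) + cint (fun z => D z * (U (x + z))%:E))%E.
  rewrite -cintD; last 4 first.
  - exact: cmeasM.
  - exact: cmeasM.
  - by move=> z; rewrite mule_ge0.
  - by move=> z; rewrite mule_ge0.
  by apply: eq_integral => s _; rewrite bE ge0_muleDl.
have JDge : ((U x - m)%:E * cint D <= cint (fun z => D z * (U (x + z))%:E))%E.
  have [i0|i0] := leP 0 (U x - m); last first.
    apply: (@le_trans _ _ 0%E); last by apply: cint_ge0 => z; rewrite mule_ge0.
    by apply: mule_le0_ge0; [rewrite lee_fin ltW|exact: cint_ge0].
  rewrite -cintZl ?lee_fin //; apply: le_cint.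
  - by apply: cmeasM => //; exact: cmeas_cst.
  - exact: cmeasM.
  - by move=> z; rewrite mule_ge0 // lee_fin.
  move=> z; rewrite muleC /D; case: ifPn => [/andP[zr _]|_]; rewrite ?mul0e // !mul1e lee_fin.
  by apply: osc; rewrite addrC addKr.
have S0 : (0 <= cint (fun z => sb z * (U (x + z))%:E))%E by apply: cint_ge0 => z; rewrite mule_ge0.
have S1 : (0 <= cint (fun z => D z * (U (x + z))%:E))%E by apply: cint_ge0 => z; rewrite mule_ge0.
rewrite JD in Jx.
have F1 := le_lt_trans (le_trans (leeDl _ S1) Jx) (ltry _).
have F2 := le_lt_trans (le_trans (leeDr _ S0) Jx) (ltry _).
move: Jx Jy JDge volD S0 S1 F1 F2.
have : (0 <= cint D)%E by exact: cint_ge0.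
case: (cint D) => // dv _.
case: (cint (fun z => sb z * _))%E => // js.
case: (cint (fun z => D z * _))%E => // jd.
rewrite -!EFinM -!EFinD !lee_fin => H1 H2 H3 [H4] _ _ _ _.
have H5 : (U y - L) * r' ^+ N + (U x - m) * (r ^+ N - r' ^+ N) <= (U x + C1 * (E + L)) * r ^+ N.
  rewrite -(ler_pM2r vp).
  have -> : ((U y - L) * r' ^+ N + (U x - m) * (r ^+ N - r' ^+ N)) * v =
     U y * (r' ^+ N * v) - L * (r' ^+ N * v) + (U x - m) * dv.
    have -> : dv = r ^+ N * v - r' ^+ N * v by rewrite -H4; ring.
    by ring.
  rewrite -mulrA; lra.
have rN0 : 0 < r' ^+ N by rewrite exprn_gt0.
have Q : r ^+ N <= 2 ^+ N * r' ^+ N.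
  by rewrite -exprMn lerXn2r // nnegrE ?ltW // mulr_gt0.
have B := exprB_le N r0 (introT andP (conj (ltW r'0) r'r)).
have rt : r - r' = t by rewrite /r'; ring.
rewrite rt in B.
rewrite -(ler_pM2r rN0).
have tr0 : 0 <= t / r by rewrite divr_ge0 // ltW.
have E1 : (U y - U x) * r' ^+ N <= L * r' ^+ N + C1 * (E + L) * r ^+ N + m * (r ^+ N - r' ^+ N).
  by nra.
apply: (le_trans E1).
have E2 : m * (r ^+ N - r' ^+ N) <= m * (N%:R * (t / r)) * (2 ^+ N * r' ^+ N).
  rewrite -mulrA; apply: ler_wpM2l => //; apply: (le_trans B).
  by rewrite ler_wpM2l // mulr_ge0.
have E3 : C1 * (E + L) * r ^+ N <= C1 * (E + L) * (2 ^+ N * r' ^+ N).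
  by rewrite ler_wpM2l // mulr_ge0 // addr_ge0.
have p1 : 1 <= 2 ^+ N :> R by rewrite exprn_ege1 // ler1n.
have E4 : L * r' ^+ N <= (E + L) * (2 ^+ N * r' ^+ N).
  apply: (@le_trans _ _ ((E + L) * r' ^+ N)).
    by apply: ler_wpM2r; [exact: ltW|rewrite lerDr].
  by apply: ler_wpM2l; [rewrite addr_ge0|rewrite ler_peMl // ltW].
apply: (le_trans (lerD (lerD E4 E3) E2)).
set X := 2 ^+ N; set Y := r' ^+ N; set S := t / r.
have X0 : 0 <= X by rewrite exprn_ge0.
have Y0 : 0 <= Y by rewrite ltW.
have P1 : 0 <= X * Y * ((E + L) * N%:R) by rewrite !mulr_ge0 // addr_ge0.
have S0' : 0 <= S by exact: tr0.
clearbody X Y S.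
have C1' : 0 <= C1 + 1 by rewrite addr_ge0.
have P2 : 0 <= X * Y * (m * S * (C1 + 1)) by rewrite !mulr_ge0.
by rewrite -subr_ge0; apply: le_trans (addr_ge0 P1 P2) _; rewrite le_eqVlt; apply/orP; left; apply/eqP; ring.
Qed.
End Osc.

(** * Consequences of the growth condition on the modulus of continuity *)

Section Modulus.
Context (R : realType) (l : R) (kappa : R -> R).
Context (l0 : 0 < l) (km : modulus_of_continuity l kappa).

Lemma kappa_ge0 t : 0 <= t <= l -> 0 <= kappa t.
Proof.
by move=> /andP[t0 tl]; rewrite -(modulus0 km); exact: (modulus_le km).
Qed.

Lemma kappa_natM (N : nat) t : 0 <= t -> N%:R * t <= l -> kappa (N%:R * t) <= N%:R * kappa t.
Proof.
move=> t0; elim: N => [|N IH] Nt; first by rewrite !mul0r (modulus0 km).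
have Nt' : N%:R * t <= l by apply: le_trans Nt; rewrite ler_wpM2r // ler_nat.
rewrite -natr1 !mulrDl !mul1r; apply: (le_trans (modulus_subadd km _ _ _)) => //.
- by rewrite mulr_ge0.
- by move: Nt; rewrite -natr1 mulrDl mul1r.
by rewrite lerD2r IH.
Qed.

(** Subadditivity: N t lies in [l/2, l] for some N <= l / t, so kappa (l/2) <= (l / t) kappa
    t. *)
Lemma lin_le_kappa : exists2 c : R, 0 < c & forall t, 0 <= t <= l -> t <= c * kappa t.
Proof.
have l2 : 0 < l / 2 by rewrite divr_gt0.
have l2l : l / 2 <= l by rewrite ler_pdivrMr // ler_peMr ?ler1n // ltW.
have kl : 0 < kappa (l / 2) by exact: (modulus_gt0 km).
exists (l / kappa (l / 2)); first by rewrite divr_gt0.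
move=> t /andP[t0 tl].
have [->|tn] := eqVneq t 0; first by rewrite (modulus0 km) mulr0.
have tp : 0 < t by rewrite lt_def tn t0.
pose N := Num.truncn (l / t).
have lt1 : 1 <= l / t by rewrite ler_pdivlMr // mul1r.
have /andP[N1 N2] := truncn_itv (le_trans ler01 lt1).
rewrite -/N in N1 N2.
have N0 : (0 < N)%N.
  by rewrite lt0n; apply: contraL lt1 => /eqP N0; move: N2; rewrite N0 -ltNge.
have Nt : N%:R * t <= l by rewrite -ler_pdivlMr.
have lNt : l / 2 <= N%:R * t.
  move: N2; rewrite ltr_pdivrMr // => N2.
  have : N.+1%:R * t <= 2 * (N%:R * t).
    by rewrite mulrA ler_wpM2r // -natrM ler_nat mul2n -addnn -addn1 leq_add2l.
  by lra.
have H := le_trans (modulus_le km (ltW l2) lNt Nt) (kappa_natM t0 Nt).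
have k0 : 0 <= kappa t by apply: kappa_ge0; rewrite t0.
have H2 : kappa (l / 2) <= l / t * kappa t.
  by apply: (le_trans H); rewrite ler_wpM2r.
rewrite mulrAC ler_pdivlMr // mulrC -ler_pdivlMr //.
by rewrite mulrAC.
Qed.

Context (n : nat).
Context (n0 : (0 < n)%N).
Context (limsup : exists2 A : R, 0 < A &
       (limf_esup (fun t : R =>
          ((4 * n%:R * kappa (A * t)) / (A * kappa t))%:E) 0^'+ < 1)%E).

(** Since n >= 1, the hypothesis gives the contraction for small t. That A >= 4 is
    automatic: A < 1 would contradict subadditivity, because then t <= N A t <= 2 t for some
    N; so A >= 1 and monotony gives kappa t <= kappa (A t) <= A/4 * kappa t. *)
Lemma kappa_contract : exists2 A : R, 4 <= A & exists2 t0, 0 < t0 & forall t, 0 < t < t0 ->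
  kappa (A * t) <= A / 4 * kappa t.
Proof.
have [A A0 lA] := limsup.
have [_ [V V0 <-] Vsup] := ereal_inf_lt lA.
have [t1 /= t10 Vt] : exists2 t1 : R, 0 < t1 & forall t, 0 < t < t1 -> V t.
  move: V0 => [e /= e0 eV]; exists e => // t /andP[tp te].
  by apply: eV => //=; rewrite sub0r normrN gtr0_norm.
have A1 : 0 < 1 + A by rewrite addr_gt0.
pose t0 := Num.min t1 (l / (2 * (1 + A))).
have t00 : 0 < t0 by rewrite lt_min t10 divr_gt0 // mulr_gt0.
have inl t : 0 < t < t0 -> [/\ t < t1, 2 * t <= l & A * t <= l].
  rewrite lt_min => /and3P[tp tt1]; rewrite ltr_pdivlMr ?mulr_gt0 // => H.
  have At : 0 < A * t by rewrite mulr_gt0.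
  have E : t * (2 * (1 + A)) = 2 * t + 2 * (A * t) by ring.
  by split => //; lra.
have K t : 0 < t < t0 -> kappa (A * t) <= A / 4 * kappa t.
  move=> tt; have /andP[tp _] := tt; have [tt1 tl Atl] := inl t tt.
  have kt : 0 < kappa t by apply: (modulus_gt0 km) => //; lra.
  have kAt : 0 <= kappa (A * t) by apply: kappa_ge0; rewrite Atl andbT mulr_ge0 // ltW.
  have : (((4 * n%:R * kappa (A * t)) / (A * kappa t))%:E < 1)%E.
    apply: le_lt_trans Vsup; apply: ereal_sup_ubound; exists t => //.
    by apply: Vt; rewrite tp.
  rewrite lte_fin ltr_pdivrMr ?mulr_gt0 // mul1r => H.
  have n1 : 1 <= n%:R :> R by rewrite ler1n.
  have : 4 * kappa (A * t) <= 4 * n%:R * kappa (A * t).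
    by rewrite ler_wpM2r // ler_peMr.
  by lra.
(* If A < 1, an integer N with 1 <= N A <= 2 gives kappa t <= kappa (N A t) <= 2/4 kappa t.
   *)
have A2 : 1 <= A.
  rewrite leNgt; apply/negP => A11.
  pose t := t0 / 2.
  have tt : 0 < t < t0 by rewrite /t divr_gt0 //= ltr_pdivrMr // ltr_pMr // ltr1n.
  have /andP[tp _] := tt; have [tt1 tl Atl] := inl t tt.
  have kt : 0 < kappa t by apply: (modulus_gt0 km) => //; lra.
  have kAt : 0 <= kappa (A * t) by apply: kappa_ge0; rewrite Atl andbT mulr_ge0 // ltW.
  pose N := (Num.truncn A^-1).+1.
  have /andP[N1 N2] : (Num.truncn A^-1)%:R <= A^-1 < N%:R by apply: truncn_itv; rewrite invr_ge0 ltW.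
  have NA : N%:R * A <= 2.
    have -> : N%:R = (Num.truncn A^-1)%:R + 1 :> R by rewrite natr1.
    rewrite mulrDl mul1r.
    have : (Num.truncn A^-1)%:R * A <= 1 by rewrite -ler_pdivlMr // mul1r.
    by lra.
  have NA1 : 1 <= N%:R * A by rewrite -ler_pdivrMr // mul1r ltW.
  have NAt : N%:R * (A * t) <= l.
    by rewrite mulrA (le_trans _ tl) // ler_wpM2r // ltW.
  have tNAt : t <= N%:R * (A * t) by rewrite mulrA ler_peMl // ltW.
  have H1 := le_trans (modulus_le km (ltW tp) tNAt NAt) (kappa_natM (mulr_ge0 (ltW A0) (ltW tp)) NAt).
  have H2 : N%:R * kappa (A * t) <= N%:R * (A / 4 * kappa t) by rewrite ler_wpM2l // K.
  have H3 : N%:R * (A / 4 * kappa t) <= 2 / 4 * kappa t.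
    by rewrite mulrA ler_wpM2r ?(ltW kt) // mulrA ler_wpM2r // invr_ge0.
  by lra.
exists A; last by exists t0.
pose t := t0 / 2.
have tt : 0 < t < t0 by rewrite /t divr_gt0 //= ltr_pdivrMr // ltr_pMr // ltr1n.
have /andP[tp _] := tt; have [tt1 tl Atl] := inl t tt.
have kt : 0 < kappa t by apply: (modulus_gt0 km) => //; lra.
have tAt : t <= A * t by rewrite ler_peMl // ltW.
have H := le_trans (modulus_le km (ltW tp) tAt Atl) (K t tt).
move: H.
by rewrite -[X in X <= _]mul1r ler_pM2r // ler_pdivlMr // mul1r.
Qed.

(** Iterating the contraction k times with 4^(-k) <= e, for B = A^k. *)
Lemma kappa_scale (e : R) : 0 < e -> exists B t1 : R, [/\ 2 <= B, 0 < t1 &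
  forall t, 0 < t <= t1 -> kappa (B * t) <= e * B * kappa t].
Proof.
move=> e0; have [A A4 [t0 t00 K]] := kappa_contract.
have A0 : 0 < A by rewrite (lt_le_trans _ A4).
have A1 : 1 <= A by rewrite (le_trans _ A4) // ler1n.
have KX k t : 0 < t -> A ^+ k * t < t0 -> kappa (A ^+ k * t) <= (A / 4) ^+ k * kappa t.
  move=> tp; elim: k => [|k IH] H; first by rewrite !expr0 !mul1r.
  have Ak : A ^+ k * t < t0.
    by apply: le_lt_trans H; apply: ler_wpM2r; [exact: ltW|rewrite exprS ler_peMl // exprn_ge0 // ltW].
  rewrite exprS -mulrA (le_trans (K _ _)) //.
    by rewrite mulr_gt0 // exprn_gt0.
  rewrite exprS -[leRHS]mulrA; apply: ler_wpM2l; first by rewrite divr_ge0 // ltW.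
  exact: IH.
pose k := (Num.bound e^-1).+1.
have e4 : 4^-1 ^+ k <= e.
  rewrite exprVn -(invrK e) lef_pV2 ?posrE ?exprn_gt0 ?invr_gt0 //.
  apply: (le_trans (ltW (archi_boundP (ltW _)))); first by rewrite invr_gt0.
  rewrite -natrX ler_nat (leq_trans (leqnSn _)) // ltnW // ltn_expl //.
have k2 : 2 <= A ^+ k.
  apply: (@le_trans _ _ A); first by apply: le_trans A4; rewrite ler_nat.
  by rewrite exprS ler_peMr ?(ltW A0) // exprn_ege1.
clearbody k.
exists (A ^+ k), (Num.min (t0 / (2 * A ^+ k)) l); split.
- exact: k2.
- by rewrite lt_min l0 andbT divr_gt0 // mulr_gt0 // exprn_gt0.
move=> t /andP[tp]; rewrite le_min => /andP[+ tl]; rewrite ler_pdivlMr ?mulr_gt0 ?exprn_gt0 // => tt.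
have Akt : 0 < A ^+ k * t by rewrite mulr_gt0 // exprn_gt0.
have At0 : A ^+ k * t < t0.
  have E : t * (2 * A ^+ k) = 2 * (A ^+ k * t) by ring.
  by lra.
apply: (le_trans (KX k t tp At0)).
rewrite exprMn [e * _]mulrC -!mulrA ler_wpM2l ?exprn_ge0 ?(ltW A0) //.
apply: ler_wpM2r => //.
by apply: kappa_ge0; rewrite (ltW tp).
Qed.

End Modulus.

(** * Induction over scales *)

Section Scales.
Context (R : realType) (n : nat) (l : R) (kappa : R -> R).
Context (l0 : 0 < l) (km : modulus_of_continuity l kappa).
Context (ks : forall e : R, 0 < e -> exists B t1 : R, [/\ 2 <= B, 0 < t1 &
  forall t, 0 < t <= t1 -> kappa (B * t) <= e * B * kappa t]).

(** The modulus of continuity at the scale t is controlled by the one at the scale B t, with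
    a factor C / B; as kappa (B t) <= e B kappa t, the product is at most C e <= 1/2 times
    the wanted bound. The domain has to shrink with the scale: at the scale t the points are
    taken in the ball of radius r0/2 + 2 t, which leaves room for the points at distance B t
    needed at the next scale. *)
Lemma scale_induction (U : Cn R n -> R) (M r0 a C K d0 : R) :
  (forall x, 0 <= U x <= M) -> 0 < r0 -> 0 < a <= 1 -> 0 <= C -> 0 <= K -> 0 < d0 ->
  (forall x y (d m : R), enorm x < r0 -> enorm y < r0 -> 0 < d <= d0 -> 0 <= m ->
     enorm (y - x) <= a * d / 2 ->
     (forall p, enorm (p - x) < a * d -> U x - m <= U p) ->
     U y - U x <= K * kappa d + C * m * (enorm (y - x) / (a * d))) ->
  exists Q t0 : R, [/\ 0 <= Q, 0 < t0 <= l & forall x y, enorm x < r0 / 2 -> enorm y < r0 / 2 ->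
    enorm (y - x) <= t0 -> U y - U x <= Q * kappa (enorm (y - x))].
Proof.
move=> U0 r00 /andP[a0 a1] C0 K0 d00 step.
pose e := (2 * (C + 1))^-1.
have e0 : 0 < e by rewrite invr_gt0 mulr_gt0 // ltr_wpDl.
have Ce : C * e <= 1 / 2.
  rewrite /e ler_pdivrMr ?mulr_gt0 ?ltr_wpDl //.
  by rewrite mulrA divfK // mul1r lerDl.
have [B [t1 [B2 t10 kB]]] := ks e0.
have B0 : 0 < B by rewrite (lt_le_trans _ B2).
pose N := (Num.bound a^-1).
(* The radius d with a d = B t is B t / a, and kappa (B t / a) <= N kappa (B t). *)
have aN : a^-1 <= N%:R by rewrite ltW // archi_boundP // invr_ge0 ltW.
have N1 : 1 <= N%:R :> R by rewrite (le_trans _ aN) // invf_ge1.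
have N0 : 0 < N%:R :> R by rewrite (lt_le_trans ltr01).
pose t0 := Num.min (r0 / 4) (Num.min (a * d0) (Num.min (l / N%:R) (B * t1))).
have t00 : 0 < t0 by rewrite !lt_min !mulr_gt0 ?divr_gt0 ?invr_gt0.
have [tr ta tl tt1] : [/\ t0 <= r0 / 4, t0 <= a * d0, t0 * N%:R <= l & t0 <= B * t1].
  have : t0 <= t0 by [].
  by rewrite {2}/t0 !le_min => /and4P[-> -> + ->]; rewrite ler_pdivlMr.
have tl' : t0 <= l by rewrite (le_trans _ tl) // ler_peMr // ltW.
have M0 : 0 <= M by have /andP[/le_trans] := U0 0; apply.
have kpos t : 0 < t -> t <= l -> 0 < kappa t by exact: (modulus_gt0 km).
have tB0 : 0 < t0 / B by rewrite divr_gt0.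
have tBt : t0 / B <= t0 by rewrite ler_pdivrMr // ler_peMr ?(ltW t00) // (le_trans _ B2) // ler1n.
pose Q := M / kappa (t0 / B) + 2 * (K * N%:R * (e * B)).
have Q0 : 0 <= Q.
  by rewrite addr_ge0 // ?divr_ge0 ?mulr_ge0 // ltW // kpos // (le_trans tBt).
exists Q, t0; split; [by []|by rewrite t00|].
have kmono s t : 0 <= s -> s <= t -> t <= l -> kappa s <= kappa t by exact: (modulus_le km).
have big t x y : t0 / B <= t -> t <= t0 -> U y - U x <= Q * kappa t.
  move=> tB tt0; have kB0 : 0 < kappa (t0 / B) by apply: kpos => //; rewrite (le_trans tBt).
  have kt : kappa (t0 / B) <= kappa t by apply: kmono; rewrite ?(ltW tB0) // (le_trans tt0).
  have /andP[_ UM] := U0 y; have /andP[Ux _] := U0 x.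
  apply: (@le_trans _ _ M); first by lra.
  apply: (@le_trans _ _ (M / kappa (t0 / B) * kappa t)).
    by rewrite mulrAC ler_pdivlMr // ler_wpM2l.
  rewrite ler_wpM2r ?(le_trans (ltW kB0)) // /Q lerDl.
  by rewrite !mulr_ge0 // ltW.
have claim k : forall t x y, t0 / B ^+ k <= t -> t <= t0 ->
    enorm x < r0 / 2 + 2 * t -> enorm y < r0 / 2 + 2 * t -> enorm (y - x) <= t ->
    U y - U x <= Q * kappa t.
  elim: k => [|k IH] t x y tk tt0 xr yr yx.
    by apply: big => //; apply: le_trans tBt _; move: tk; rewrite expr0 divr1.
  have [tB|tB] := leP (t0 / B) t; first exact: big.
  have tp : 0 < t by apply: lt_le_trans tk; rewrite divr_gt0 // exprn_gt0.
  have Bt0 : B * t <= t0 by rewrite mulrC -ler_pdivlMr // ltW.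
  have Btp : 0 < B * t by rewrite mulr_gt0.
  have tBt2 : 2 * t <= B * t by rewrite ler_wpM2r // ltW.
  have aBt : a * (B * t / a) = B * t by rewrite mulrC divfK // gt_eqF.
  have d1 : 0 < B * t / a <= d0.
    rewrite divr_gt0 //= ler_pdivrMr // [d0 * a]mulrC; exact: le_trans ta.
  have Bk : t0 / B ^+ k <= B * t.
    move: tk; rewrite exprS invfM mulrA mulrAC ler_pdivrMr // => /le_trans; apply.
    by rewrite mulrC.
  have kBt0 : 0 <= kappa (B * t) by rewrite ltW // kpos // (le_trans Bt0).
  have xr0 : enorm x < r0 by lra.
  have yr0 : enorm y < r0 by lra.
  have hyx : enorm (y - x) <= a * (B * t / a) / 2 by rewrite aBt; lra.
  have hosc p : enorm (p - x) < a * (B * t / a) -> U x - Q * kappa (B * t) <= U p.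
    rewrite aBt => px.
    have := IH (B * t) p x Bk Bt0 _ _ _; rewrite lerBlDr lerBlDl; apply.
    - rewrite -(subrK x p) (le_lt_trans (ler_enormD _ _)) //; lra.
    - by lra.
    - by rewrite enormB ltW.
  have := step x y (B * t / a) (Q * kappa (B * t)) xr0 yr0 d1 (mulr_ge0 Q0 kBt0) hyx hosc.
  rewrite aBt => S1.
  have k1 : kappa (B * t / a) <= N%:R * kappa (B * t).
    have NB : N%:R * (B * t) <= l.
      by apply: le_trans tl; rewrite [t0 * _]mulrC ler_wpM2l // ltW.
    apply: le_trans (kappa_natM km (ltW Btp) NB).
    apply: kmono => //; first by rewrite divr_ge0 // ltW.
    by rewrite mulrC ler_wpM2r // ltW.
  have k2 : kappa (B * t) <= e * B * kappa t.
    apply: kB; rewrite tp /= -(ler_pM2l B0) (le_trans Bt0) //.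
  have q1 : enorm (y - x) / (B * t) <= B^-1.
    by rewrite ler_pdivrMr // mulKf // gt_eqF.
  have kt0 : 0 <= kappa t by rewrite ltW // kpos // (le_trans tt0).
  have E1 : K * kappa (B * t / a) <= K * N%:R * (e * B) * kappa t.
    have -> : K * N%:R * (e * B) * kappa t = K * (N%:R * (e * B * kappa t)) by ring.
    apply: ler_wpM2l => //; apply: (le_trans k1); apply: ler_wpM2l => //; exact: ltW.
  have E2 : C * (Q * kappa (B * t)) * (enorm (y - x) / (B * t)) <= 1 / 2 * (Q * kappa t).
    apply: (@le_trans _ _ (C * (Q * kappa (B * t)) * B^-1)).
      by rewrite ler_wpM2l // !mulr_ge0.
    apply: (@le_trans _ _ (C * (Q * (e * B * kappa t)) * B^-1)).
      by rewrite ler_wpM2r ?invr_ge0 ?(ltW B0) // ler_wpM2l // ler_wpM2l.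
    have -> : C * (Q * (e * B * kappa t)) / B = C * e * (Q * kappa t).
      by field; rewrite gt_eqF.
    by rewrite ler_wpM2r // mulr_ge0.
  have E3 : 2 * (K * N%:R * (e * B)) * kappa t <= Q * kappa t.
    rewrite ler_wpM2r // /Q lerDr divr_ge0 // ltW // kpos // (le_trans tBt) //.
  by lra.
move=> x y xr yr yx.
have [/eqP yx0|yxn] := boolP (enorm (y - x) == 0).
  have /eqP := enorm_eq0 yx0; rewrite subr_eq0 => /eqP ->.
  by rewrite !subrr enorm0 (modulus0 km) mulr0.
have yxp : 0 < enorm (y - x) by rewrite lt_def yxn enorm_ge0.
have B1 : 1 < B by lra.
have [k kP] : exists k, t0 / enorm (y - x) <= 2 ^+ k.
  exists (Num.bound (t0 / enorm (y - x))).
  apply: (le_trans (ltW (archi_boundP _))); first by rewrite divr_ge0 // ltW.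
  by rewrite -natrX ler_nat ltnW // ltn_expl.
have kB2 : 2 ^+ k <= B ^+ k by rewrite lerXn2r // nnegrE ltW.
have h2 : 0 < 2 * enorm (y - x) by rewrite mulr_gt0.
apply: (claim k) => //.
- rewrite ler_pdivrMr ?exprn_gt0 // mulrC -ler_pdivrMr //.
  exact: le_trans kP kB2.
- by rewrite (lt_trans xr) // ltrDl.
- by rewrite (lt_trans yr) // ltrDl.
Qed.

End Scales.

(** * The modulus of continuity in a ball of C^n *)

Section Borel.
Context (R : realType) (n : nat).
Local Notation T := ((n + n).-tuple R).
Local Notation ofr := (@of_real_coords R n).

Definition ofq (q : (n + n).-tuple rat) : Cn R n := ofr (map_tuple ratr q).

Lemma measurable_enorm_shift (z : Cn R n) : measurable_fun setT (fun t : T => enorm (ofr t - z)).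
Proof.
have mU : cmeas (fun z : Cn R n => (enorm z)%:E).
  by apply/measurable_EFinP; exact: measurable_enorm.
have := cmeas_comp mU (g := fun t : T => ofr t - z) _.
move=> H; apply/measurable_EFinP; apply: H.
by apply: measurable_coordsD; [exact: measurable_coords_ofr|exact: measurable_coords_cst].
Qed.

Lemma rat_dense (z : Cn R n) (e : R) : 0 < e -> exists q, enorm (ofq q - z) < e.
Proof.
move=> e0; pose h := e / (n.+1 + n.+1)%:R.
have h0 : 0 < h by rewrite divr_gt0 // ltr0n.
have Hi (i : 'I_(n + n)) : exists q : rat, `|ratr q - tnth (to_real z) i| < h.
  have : tnth (to_real z) i - h < tnth (to_real z) i + h by lra.
  move=> /rat_in_itvoo[q]; rewrite in_itv /= => /andP[q1 q2]; exists q.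
  by rewrite ltr_norml; apply/andP; split; lra.
pose q i := projT1 (cid (Hi i)).
have qP i : `|ratr (q i) - tnth (to_real z) i| < h := projT2 (cid (Hi i)).
exists (mktuple q).
apply: le_lt_trans (enorm_le_sum _) _.
apply: (@le_lt_trans _ _ (\sum_(j < n) (h + h))).
  apply: ler_sum => j _; rewrite !mxE cReD cImD cReN cImN /= !tnth_map !tnth_ord_tuple.
  have := qP (lshift n j); have := qP (rshift n j).
  rewrite !tnth_mktuple (unsplitK (inl j)) (unsplitK (inr j)) => /ltW H1 /ltW H2.
  exact: lerD.
rewrite sumr_const card_ord -[ltLHS]mulr_natr.
have -> : (h + h) * n%:R = e * ((2 * n)%:R / (n.+1 + n.+1)%:R).
  by rewrite /h natrM; ring.
rewrite gtr_pMr // ltr_pdivrMr // mul1r ltr_nat mul2n -addnn.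
by rewrite addSn addnS ltnS leqW.
Qed.

(** An open set is the union of the balls with rational centers and radii 1/(k+1) that it
    contains. *)
Lemma open_measurable_ofr (A : set (Cn R n)) :
  (forall z, A z -> exists2 e : R, 0 < e & forall w, enorm (w - z) < e -> A w) ->
  measurable (ofr @^-1` A).
Proof.
move=> oA.
pose F (p : (n + n).-tuple rat * nat) : set T :=
  if pselect (forall w, enorm (w - ofq p.1) < (p.2.+1%:R)^-1 -> A w)
  then [set t | enorm (ofr t - ofq p.1) < (p.2.+1%:R)^-1] else set0.
have -> : ofr @^-1` A = \bigcup_p F p.
  apply/seteqP; split=> t /=.
    move=> /oA[e e0 eA].
    pose k := Num.bound (2 / e).
    have ke : k.+1%:R^-1 < e / 2.
      rewrite -[e / 2]invrK ltf_pV2 ?posrE ?invr_gt0 ?divr_gt0 // invf_div.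
      apply: lt_trans (archi_boundP _) _; first by rewrite divr_ge0 // ltW.
      by rewrite ltr_nat.
    have k0 : 0 < k.+1%:R^-1 :> R by rewrite invr_gt0.
    have [q qt] := rat_dense (ofr t) k0.
    exists (q, k) => //; rewrite /F /=; case: pselect => [yes|no]; first by rewrite /= enormB.
    exfalso; apply: no => w wq; apply: eA; rewrite -(subrKA (ofq q)).
    by rewrite (le_lt_trans (ler_enormD _ _)) // (splitr e) ltrD // (lt_trans _ ke).
  by move=> [p _]; rewrite /F; case: pselect => // H; exact: H.
apply: countable_bigcupT_measurable; first exact: countableP.
move=> p; rewrite /F; case: pselect => [yes|no]; last exact: measurable0.
rewrite -[X in measurable X]setTI.
apply: (measurable_fun_ltr (measurable_enorm_shift _) (measurable_cst _)) => //.
Qed.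

End Borel.

Section Local.
Context (R : realType) (n : nat).
Local Notation mu := (@lebesgue_measure R).
Local Notation T := ((n + n).-tuple R).
Local Notation ofr := (@of_real_coords R n).
Context (rho : Cn R n -> R) (rk : regularizing_kernel rho).
Context (l : R) (kappa : R -> R) (l0 : 0 < l) (km : modulus_of_continuity l kappa).
Context (n0 : (0 < n)%N).
Context (limsup : exists2 A : R, 0 < A &
       (limf_esup (fun t : R =>
          ((4 * n%:R * kappa (A * t)) / (A * kappa t))%:E) 0^'+ < 1)%E).

Definition usc_on (r0 : R) (g : Cn R n -> R) := forall z a, enorm z < r0 -> g z < a ->
  exists2 e : R, 0 < e & forall w, enorm (w - z) < e -> g w < a.

(** The addition of M makes the function nonnegative before it is cut off, so that all
    integrals below exist. *)
Definition ball_cut (r0 M : R) (g : Cn R n -> R) (z : Cn R n) : R :=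
  if enorm z < r0 then g z + M else 0.

Lemma measurable_cut r0 M g : (forall z, `|g z| <= M) -> usc_on r0 g ->
  cmeas (EFin \o ball_cut r0 M g).
Proof.
move=> gM ug; apply/measurable_EFinP.
apply: (measurability _ (RGenInftyO.measurableE R)) => _ [_ [a ->] <-].
rewrite setTI.
have [a0|a0] := leP a 0.
  rewrite (_ : _ @^-1` _ = set0); first exact: measurable0.
  apply/seteqP; split => // t /=; rewrite in_itv /= => H.
  have : 0 <= ball_cut r0 M g (ofr t).
    rewrite /ball_cut; case: ifP => // _; have := gM (ofr t).
    by rewrite ler_norml => /andP[+ _]; lra.
  by move: H => /=; lra.
rewrite (_ : _ @^-1` _ = ofr @^-1` [set z | enorm z < r0 /\ g z + M < a] `|`
   [set t | ~~ (enorm (ofr t) < r0)]); last first.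
  apply/seteqP; split => t /=; rewrite in_itv /= /ball_cut; case: ifPn => H.
  - by left.
  - by right.
  - by move=> [[]|].
  - by move=> _.
apply: measurableU.
  apply: open_measurable_ofr => z [zr]; rewrite -ltrBrDr => gz.
  have [e e0 eP] := ug z _ zr gz.
  exists (Num.min e (r0 - enorm z)); first by rewrite lt_min e0 subr_gt0.
  move=> w; rewrite lt_min => /andP[we wr]; split; last by rewrite -ltrBrDr; exact: eP.
  rewrite -(subrK z w) (le_lt_trans (ler_enormD _ _)) //.
  by rewrite -ltrBrDr.
rewrite (_ : [set t | ~~ _] = ~` [set t | enorm (ofr t) < r0]); last first.
  by apply/seteqP; split => t /= /negP.
apply: measurableC; rewrite -[X in measurable X]setTI.
by apply: (measurable_fun_ltr (@measurable_enorm R n) (measurable_cst r0)).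
Qed.

(** The regularization at x only looks at the ball of radius d around x, where the cut-off
    is not active, and rho has mass 1. *)
Lemma regularization_cut r0 M g x d : (forall z, `|g z| <= M) -> usc_on r0 g ->
  0 < d -> enorm x + d < r0 ->
  cint (fun z => (rho z)%:E * (ball_cut r0 M g (x + d%:C%C *: z))%:E)%E =
  (regularization rho d g x + M)%:E.
Proof.
move=> gM ug d0 xd.
have M0 : 0 <= M by exact: le_trans (gM 0).
have mc := cmeas_affine x d (measurable_cut gM ug).
have mr := cmeas_rho rk.
have inb z : rho z != 0 -> ball_cut r0 M g (x + d%:C%C *: z) = g (x + d%:C%C *: z) + M.
  move=> /(rho_supp rk) z1; rewrite /ball_cut ifT // (le_lt_trans (ler_enormD _ _)) //.
  rewrite enormZr gtr0_norm //; apply: lt_trans xd.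
  by rewrite ltrD2l gtr_pMr.
have cut0 z : 0 <= ball_cut r0 M g z <= 2 * M.
  rewrite /ball_cut; case: ifP => _; last by rewrite lexx mulr_ge0.
  by have := gM z; rewrite ler_norml => /andP[? ?]; apply/andP; split; lra.
pose G1 z := ((rho z)%:E * (ball_cut r0 M g (x + d%:C%C *: z))%:E)%E.
pose G2 z := (M * rho z)%:E.
have rho0 z : 0 <= rho z by exact: kernel_ge0 rk z.
have irho : (lam (m := n + n)).-integrable setT (fun t => (rho (ofr t))%:E).
  apply/integrableP; split; first exact: mr.
  rewrite (_ : (\int[_]_x _ = cint (fun z => (rho z)%:E))%E); first by rewrite (cint_rho rk) ltry.
  by apply: eq_integral => t _; rewrite gee0_abs // lee_fin.
have iG1 : (lam (m := n + n)).-integrable setT (G1 \o ofr).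
  apply: (le_integrable measurableT) (integrableZl measurableT (2 * M) irho).
    exact: cmeasM.
  move=> t _; rewrite /G1 -!EFinM !abse_EFin lee_fin !ger0_norm ?mulr_ge0 //.
    by have /andP[? ?] := cut0 (x + d%:C%C *: ofr t); rewrite mulrC ler_wpM2r.
  by have /andP[] := cut0 (x + d%:C%C *: ofr t).
have iG2 : (lam (m := n + n)).-integrable setT (G2 \o ofr).
  exact: (integrableZl measurableT M irho).
have E2 : cint G2 = M%:E.
  rewrite (_ : cint G2 = cint (fun z => M%:E * (rho z)%:E)%E) //.
  by rewrite cintZl ?lee_fin // (cint_rho rk) mule1.
have rs z : g (x + d%:C%C *: z) * rho z != 0 -> enorm z < 1.
  by rewrite mulf_eq0 negb_or => /andP[_]; exact: rho_supp.
have E3 : regularization rho d g x = fine (cint (fun z => (g (x + d%:C%C *: z) * rho z)%:E)).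
  exact: Cintegral_cint.
have E1 : cint (fun z => (g (x + d%:C%C *: z) * rho z)%:E) = (cint G1 - cint G2)%E.
  rewrite /cint -(integralB measurableT iG1 iG2); apply: eq_integral => t _.
  rewrite /G1 /G2 /= -EFinM -EFinB; congr (_%:E).
  have [->|r1] := eqVneq (rho (ofr t)) 0; first by rewrite !mulr0 mul0r subrr.
  by rewrite inb //; ring.
rewrite E3 E1 E2 -/(G1).
have : cint G1 \is a fin_num by exact: integrable_fin_num.
change (cint G1 \is a fin_num -> cint G1 = (fine (cint G1 - M%:E) + M)%:E).
by case: (cint G1) => // q _; rewrite -EFinB /= subrK.
Qed.

(** [osc_step] provides the inductive step of [scale_induction] for the cut-off function;
    the error L d of the submean inequality is absorbed in kappa d. *)
Lemma local_modulus (g : Cn R n -> R) (r0 M L C1 d1 : R) :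
  (forall z, `|g z| <= M) -> 0 < r0 -> 0 <= L -> 0 <= C1 -> 0 < d1 -> usc_on r0 g ->
  (forall x z d, enorm x + enorm z < r0 -> enorm z <= d ->
    ((2 * pi * (g x + M))%:E <=
      \int[mu]_(t in `[0%R, (2 * pi)%R]) (g (x + expi t *: z)%R + M + L * d)%:E)%E) ->
  (forall x d, enorm x < r0 / 2 -> 0 < d < d1 ->
     regularization rho d g x - g x <= C1 * kappa d) ->
  exists Q t0 : R, [/\ 0 <= Q, 0 < t0 <= l & forall x y, enorm x < r0 / 4 -> enorm y < r0 / 4 ->
    enorm (y - x) <= t0 -> g y - g x <= Q * kappa (enorm (y - x))].
Proof.
move=> gM r00 L0 C10 d10 ug sub reg.
have [a [C [a01 C0 osc]]] := osc_step n0 rk.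
have [c c0 lin] := lin_le_kappa l0 km.
have mU := measurable_cut gM ug.
pose U := ball_cut r0 M g.
have U0 z : 0 <= U z <= 2 * M.
  have M0 : 0 <= M by exact: le_trans (gM 0).
  rewrite /U /ball_cut; case: ifP => _; last by rewrite lexx mulr_ge0.
  by have := gM z; rewrite ler_norml => /andP[? ?]; apply/andP; split; lra.
have UE z : enorm z < r0 -> U z = g z + M by rewrite /U /ball_cut => ->.
pose d0 := Num.min (r0 / 4) (Num.min (d1 / 2) l).
have d00 : 0 < d0 by rewrite !lt_min l0 !divr_gt0.
have r02 : 0 < r0 / 2 by rewrite divr_gt0.
have K0 : 0 <= C * (C1 + L * c) by rewrite mulr_ge0 // addr_ge0 // mulr_ge0 // ltW.
have [|Q [t0 [Q0 t00 H]]] := @scale_induction R n l kappa l0 km (kappa_scale l0 km n0 limsup) U (2 * M) (r0 / 2) a C (C * (C1 + L * c)) d0 U0 r02 a01 C0 K0 d00.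
  move=> x y d m xr yr /andP[dp]; rewrite !le_min => /and3P[dr dd dl] m0 yx om.
  have kd0 : 0 <= kappa d by apply: (kappa_ge0 km); rewrite (ltW dp).
  have dkd : d <= c * kappa d by apply: lin; rewrite (ltW dp).
  have subU w : enorm w < r0 / 2 -> forall z, enorm z < d -> ((2 * pi * U w)%:E <=
     \int[mu]_(t in `[0%R, (2 * pi)%R]) (U (w + expi t *: z)%R + L * d)%:E)%E.
    move=> wr z zd.
    have wz : enorm w + enorm z < r0 by lra.
    rewrite UE; last by lra.
    apply: (le_trans (sub w z d wz (ltW zd))).
    rewrite le_eqVlt; apply/orP; left; apply/eqP; apply: eq_integral => s _.
    rewrite UE // (le_lt_trans (ler_enormD _ _)) // enormZ_expi //.
  have regU d' : 0 < d' <= d ->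
     (cint (fun z => (rho z)%:E * (U (x + d'%:C%C *: z)%R)%:E) <= (U x + C1 * kappa d)%:E)%E.
    move=> /andP[d'0 d'd].
    rewrite regularization_cut //; last by lra.
    have d'1 : 0 < d' < d1 by rewrite d'0 /=; lra.
    have := reg x d' xr d'1.
    have : C1 * kappa d' <= C1 * kappa d by rewrite ler_wpM2l // (modulus_le km) // ltW.
    rewrite UE; last by lra.
    by rewrite lee_fin; lra.
  have Ld0 : 0 <= L * d by rewrite mulr_ge0 // ltW.
  have := osc U x y d (L * d) (C1 * kappa d) m mU (fun z => proj1 (andP (U0 z))) dp Ld0 (mulr_ge0 C10 kd0) m0 (subU x xr) (subU y yr) regU yx om.
  move=> H; apply: (le_trans H); rewrite lerD2r.
  rewrite -mulrA ler_wpM2l // mulrDl lerD2l -mulrA ler_wpM2l //.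
exists Q, t0; split => // x y xr yr yx.
have := H x y _ _ yx; rewrite !UE; try by lra.
Qed.

End Local.

(** * Hermitian forms compared with the Euclidean norm *)

Lemma cRe_conj (R : realType) (x : R[i]) : complex.Re (Num.conj x) = complex.Re x.
Proof. by case: x. Qed.
Lemma cIm_conj (R : realType) (x : R[i]) : complex.Im (Num.conj x) = - complex.Im x.
Proof. by case: x. Qed.

Lemma cRe_sum (R : realType) (I : Type) (r : seq I) (P : pred I) (F : I -> R[i]) :
  complex.Re (\sum_(i <- r | P i) F i) = \sum_(i <- r | P i) complex.Re (F i).
Proof. by elim/big_rec2: _ => // i y1 y2 _ <-; rewrite cReD. Qed.

Lemma cvg_sumr (R : realType) (T : Type) (F : set_system T) (FF : Filter F) (I : Type) (r : seq I)
    (f : I -> T -> R) (a : I -> R) : (forall i, f i @ F --> a i) ->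
  (fun x => \sum_(i <- r) f i x) @ F --> \sum_(i <- r) a i.
Proof.
move=> fa; elim: r => [|i r IH].
  by under eq_cvg do rewrite big_nil; rewrite big_nil; exact: cvg_cst.
by under eq_cvg do rewrite big_cons; rewrite big_cons; apply: cvgD.
Qed.

Section HForm.
Local Open Scope sesquilinear_scope.
Context (R : realType) (n : nat).

(** The real and imaginary parts of v_j (v_k)^*. *)
Definition hpr (v : Cn R n) j k : R := complex.Re (v ord0 j) * complex.Re (v ord0 k) + complex.Im (v ord0 j) * complex.Im (v ord0 k).
Definition hpi (v : Cn R n) j k : R := complex.Im (v ord0 j) * complex.Re (v ord0 k) - complex.Re (v ord0 j) * complex.Im (v ord0 k).

Lemma hformE (H : 'M[R[i]]_n) v : complex.Re (hform H v) =
  \sum_j \sum_k (complex.Re (H j k) * hpr v j k - complex.Im (H j k) * hpi v j k).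
Proof.
rewrite /hform mxE cRe_sum exchange_big /=; apply: eq_bigr => k _.
rewrite !mxE mulr_suml cRe_sum; apply: eq_bigr => j _.
rewrite !cReM !cImM cRe_conj cIm_conj /hpr /hpi; ring.
Qed.

Lemma hpr_le v j k : `|hpr v j k| <= 2 * enorm v ^+ 2.
Proof.
rewrite /hpr (le_trans (ler_normD _ _)) // mulr_natl mulr2n !normrM expr2.
by apply: lerD; apply: ler_pM => //; rewrite ?ler_enorm_Re ?ler_enorm_Im.
Qed.

Lemma hpi_le v j k : `|hpi v j k| <= 2 * enorm v ^+ 2.
Proof.
rewrite /hpi (le_trans (ler_normB _ _)) // mulr_natl mulr2n !normrM expr2.
by apply: lerD; apply: ler_pM => //; rewrite ?ler_enorm_Re ?ler_enorm_Im.
Qed.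

Lemma hform_mul (H J : 'M[R[i]]_n) v : hform (J *m H *m J ^t*) v = hform H (v *m J).
Proof.
rewrite /hform.
have -> : (v *m J) ^t* = J ^t* *m v ^t* by rewrite trmx_mul map_mxM.
by rewrite !mulmxA.
Qed.

End HForm.

Section Compact.
Context (R : realType) (n : nat).

Definition ofrow (v : 'rV[R]_(n + n)) : Cn R n := of_real_coords (mktuple (v ord0)).

Lemma continuous_ofrow : continuous ofrow.
Proof.
move=> v A /nbhs_enormP[e e0 eA].
have N0 : 0 < (n.+1 + n.+1)%:R :> R by rewrite ltr0n.
apply/nbhs_ballP; exists (e / (n.+1 + n.+1)%:R) => /=; first by rewrite divr_gt0.
move=> w [_ wv]; apply: eA.
set h := _ / _ in wv.
have hi i : `|w ord0 i - v ord0 i| <= h.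
  by have := wv ord0 i; rewrite -ball_normE /= distrC => /ltW.
apply: le_lt_trans (enorm_le_sum _) _.
apply: (@le_lt_trans _ _ (\sum_(j < n) (h + h))).
  apply: ler_sum => j _; rewrite !mxE cReD cImD cReN cImN /= !tnth_mktuple.
  by apply: lerD; exact: hi.
rewrite sumr_const card_ord -[ltLHS]mulr_natr.
have -> : (h + h) * n%:R = e * ((2 * n)%:R / (n.+1 + n.+1)%:R).
  by rewrite /h natrM; ring.
rewrite gtr_pMr // ltr_pdivrMr // mul1r ltr_nat mul2n -addnn.
by rewrite addSn addnS ltnS leqW.
Qed.

Lemma continuous_enorm_sub (x : Cn R n) : continuous (fun z : Cn R n => enorm (z - x)).
Proof.
move=> z; apply/continuous_enormP => e e0; exists e => // w wz.
apply: le_lt_trans wz; rewrite ler_norml; apply/andP; split.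
  rewrite lerNl opprB lerBlDl.
  have -> : z - x = (w - x) + (z - w) by apply/rowP => j; rewrite !mxE; ring.
  by rewrite (le_trans (ler_enormD _ _)) // [enorm (z - w)]enormB.
rewrite lerBlDl.
have -> : w - x = (z - x) + (w - z) by apply/rowP => j; rewrite !mxE; ring.
exact: ler_enormD.
Qed.

Lemma closed_enorm_ball (x : Cn R n) r : closed [set z : Cn R n | enorm (z - x) <= r].
Proof.
rewrite (_ : [set z | _] = (fun z : Cn R n => enorm (z - x)) @^-1` [set t | t <= r]) //.
apply: closed_comp; last exact: closed_le.
by move=> z _; exact: continuous_enorm_sub.
Qed.

Lemma compact_enorm_ball (r : R) (x : Cn R n) : compact [set z : Cn R n | enorm (z - x) <= r].
Proof.
set I := `[- (r + enorm x), r + enorm x]%classic.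
have cC := @rV_compact R (n + n) (fun _ => I) (fun _ => @segment_compact R _ _).
have cI := @continuous_compact _ _ ofrow _ (continuous_subspaceT continuous_ofrow) cC.
apply: (subclosed_compact _ cI); first exact: closed_enorm_ball.
move=> z /= zx; exists (\row_i tnth (to_real z) i).
  move=> i; rewrite mxE /I /= in_itv /= -ler_norml.
  apply: (@le_trans _ _ (enorm z)); last first.
    rewrite -{1}(subrK x z) (le_trans (ler_enormD _ _)) // lerD2r //.
  rewrite tnth_mktuple; case: (fintype.split i) => j.
    exact: ler_enorm_Re.
  exact: ler_enorm_Im.
rewrite /ofrow -[RHS]to_realK; congr of_real_coords.
by apply: eq_from_tnth => i; rewrite tnth_mktuple mxE.
Qed.

Lemma continuous_cRe j : continuous (fun z : Cn R n => complex.Re (z ord0 j) : R).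
Proof.
move=> z; apply/continuous_enormP => e e0; exists e => // w wz.
apply: le_lt_trans wz; have := ler_enorm_Re (w - z) j.
by rewrite !mxE cReD cReN.
Qed.

Lemma continuous_cIm j : continuous (fun z : Cn R n => complex.Im (z ord0 j) : R).
Proof.
move=> z; apply/continuous_enormP => e e0; exists e => // w wz.
apply: le_lt_trans wz; have := ler_enorm_Im (w - z) j.
by rewrite !mxE cImD cImN.
Qed.

End Compact.

Section HLower.
Context (R : realType) (n : nat).

Lemma continuous_hpr j k : continuous (fun v : Cn R n => hpr v j k).
Proof.
move=> v; exact: (cvgD (cvgM (continuous_cRe (j := j) (x := v)) (continuous_cRe (j := k) (x := v))) (cvgM (continuous_cIm (j := j) (x := v)) (continuous_cIm (j := k) (x := v)))).
Qed.

Lemma continuous_hpi j k : continuous (fun v : Cn R n => hpi v j k).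
Proof.
move=> v; exact: (cvgB (cvgM (continuous_cIm (j := j) (x := v)) (continuous_cRe (j := k) (x := v))) (cvgM (continuous_cRe (j := j) (x := v)) (continuous_cIm (j := k) (x := v)))).
Qed.

Lemma continuous_hform (H : 'M[R[i]]_n) : continuous (fun v => complex.Re (hform H v) : R).
Proof.
rewrite (_ : (fun v => _) = fun v => \sum_j \sum_k (complex.Re (H j k) * hpr v j k - complex.Im (H j k) * hpi v j k)); last first.
  by apply/funext => v; rewrite hformE.
move=> v; apply: (@cvg_sumr R _ (nbhs v) (nbhs_filter v)) => j; apply: (@cvg_sumr R _ (nbhs v) (nbhs_filter v)) => k.
exact: (cvgB (cvgM (cvg_cst (complex.Re (H j k))) (continuous_hpr (j := j) (k := k) (x := v)))
  (cvgM (cvg_cst (complex.Im (H j k))) (continuous_hpi (j := j) (k := k) (x := v)))).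
Qed.

Lemma hform_scale (H : 'M[R[i]]_n) (t : R) w :
  complex.Re (hform H (t%:C%C *: w)) = t ^+ 2 * complex.Re (hform H w).
Proof.
rewrite !hformE mulr_sumr; apply: eq_bigr => j _; rewrite mulr_sumr; apply: eq_bigr => k _.
by rewrite /hpr /hpi !mxE !cReM !cImM /=; ring.
Qed.

(** The form is homogeneous of degree 2, and by compactness it attains a positive minimum on
    the unit sphere. *)
Lemma hform_lower (H : 'M[R[i]]_n) : (forall v : Cn R n, v != 0 -> 0 < hform H v) ->
  exists2 m : R, 0 < m & forall v, m * enorm v ^+ 2 <= complex.Re (hform H v).
Proof.
move=> Hpos.
pose Sph := [set v : Cn R n | enorm v = 1].
have [S0|/set0P S0] := eqVneq Sph set0.
  exists 1 => // v; have [->|v0] := eqVneq v 0.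
    by rewrite enorm0 expr0n mulr0 hformE big1 // => j _; rewrite big1 // => k _; rewrite /hpr /hpi !mxE /=; ring.
  have vp : enorm v != 0 by apply: contra v0 => /eqP/enorm_eq0 ->.
  have : Sph ((enorm v)^-1%:C%C *: v).
    by rewrite /Sph /= enormZr ger0_norm ?invr_ge0 ?enorm_ge0 // mulVf.
  by rewrite S0.
have cS : compact Sph.
  apply: (subclosed_compact _ (@compact_enorm_ball R n 1 0)); last by move=> v; rewrite /Sph /= subr0 => ->.
  rewrite (_ : Sph = (fun z : Cn R n => enorm (z - 0)) @^-1` [set 1]).
    apply: closed_comp; last exact: closed_eq.
    by move=> z _; exact: continuous_enorm_sub.
  by apply/seteqP; split => z /=; rewrite subr0.
have [c cS' cmin] := compact_EVT_min S0 cS (continuous_subspaceT (@continuous_hform H)).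
have c0 : c != 0.
  by apply: contraPneq (oner_neq0 R) => e; move: cS'; rewrite inE /Sph /= e enorm0 => <-; rewrite eqxx.
exists (complex.Re (hform H c)).
  by have := Hpos c c0; rewrite ltcE /= => /andP[_].
move=> v; have [->|v0] := eqVneq v 0.
  rewrite enorm0 expr0n mulr0 hformE big1 // => j _; rewrite big1 // => k _; rewrite /hpr /hpi !mxE /=; ring.
have vp : 0 < enorm v by rewrite lt_def enorm_ge0 andbT; apply: contra v0 => /eqP/enorm_eq0 ->.
pose w := (enorm v)^-1%:C%C *: v.
have wS : Sph w by rewrite /Sph /= enormZr ger0_norm ?invr_ge0 ?enorm_ge0 // mulVf // gt_eqF.
have vw : v = (enorm v)%:C%C *: w by rewrite scalerA -creal_M divff ?scale1r // gt_eqF.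
have hw : complex.Re (hform H v) = enorm v ^+ 2 * complex.Re (hform H w).
  by rewrite {1}vw hform_scale.
rewrite hw mulrC ler_wpM2l ?sqr_ge0 //.
by apply: cmin; rewrite inE.
Qed.

Lemma hform_perturb (H H' : 'M[R[i]]_n) e v :
  (forall j k, `|complex.Re (H j k) - complex.Re (H' j k)| <= e) ->
  (forall j k, `|complex.Im (H j k) - complex.Im (H' j k)| <= e) ->
  complex.Re (hform H v) - complex.Re (hform H' v) <= (n * n)%:R * (4 * e) * enorm v ^+ 2.
Proof.
move=> h1 h2.
rewrite !hformE -sumrB.
have -> : (n * n)%:R * (4 * e) * enorm v ^+ 2 = \sum_(j < n) \sum_(k < n) (4 * e * enorm v ^+ 2).
  by rewrite !sumr_const !card_ord -mulrnA -[RHS]mulr_natl; ring.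
apply: ler_sum => j _; rewrite -sumrB; apply: ler_sum => k _.
have -> : 4 * e * enorm v ^+ 2 = e * (2 * enorm v ^+ 2) + e * (2 * enorm v ^+ 2) by ring.
have -> : complex.Re (H j k) * hpr v j k - complex.Im (H j k) * hpi v j k -
   (complex.Re (H' j k) * hpr v j k - complex.Im (H' j k) * hpi v j k) =
   (complex.Re (H j k) - complex.Re (H' j k)) * hpr v j k - (complex.Im (H j k) - complex.Im (H' j k)) * hpi v j k by ring.
apply: le_trans (ler_norm _) _; apply: le_trans (ler_normB _ _) _.
by rewrite !normrM; apply: lerD; apply: ler_pM => //; rewrite ?hpr_le ?hpi_le.
Qed.
End HLower.

(** * A growth estimate along an interval *)

Section Cousin.
Context (R : realType).
Local Notation mu := (@lebesgue_measure R).

(** Cousin's lemma, by the supremum argument. It replaces a subdivision of [0, 1] that is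
    fine enough for a local estimate. *)
Lemma cousin01 (P : R -> R -> Prop) :
  (forall a b c, a <= b -> b <= c -> P a b -> P b c -> P a c) ->
  (forall t, 0 <= t <= 1 -> exists2 h : R, 0 < h & forall s1 s2,
     0 <= s1 -> s1 <= t -> t <= s2 -> s2 <= 1 -> t - h < s1 -> s2 < t + h -> P s1 s2) ->
  P 0 1.
Proof.
move=> add loc.
pose E := [set t : R | 0 <= t <= 1 /\ P 0 t].
have E0 : E 0.
  split; first by rewrite lexx ler01.
  have [|h h0 H] := loc 0; first by rewrite lexx ler01.
  by apply: H => //; lra.
have ubE : ubound E 1 by move=> t [/andP[]].
have supE : has_sup E by split; [exists 0|exists 1].
pose c := sup E.
have c0 : 0 <= c by exact: (sup_upper_bound supE E0).
have c1 : c <= 1 by apply: ge_sup => //; exists 0.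
have [|h h0 H] := loc c; first by rewrite c0.
have [e Ee ce] : exists2 e, E e & c - h < e by exact: (sup_adherent h0 supE).
have ec : e <= c by exact: (sup_upper_bound supE Ee).
have [/andP[e0 e1] Pe] := Ee.
pose s := Num.min 1 (c + h / 2).
have h2 : 0 < h / 2 by rewrite divr_gt0.
have cs : c <= s by rewrite le_min c1 lerDl ltW.
have s1 : s <= 1 by rewrite ge_min lexx.
have sh : s < c + h by rewrite gt_min; apply/orP; right; rewrite ltrD2l ltr_pdivrMr // ltr_pMr // ltr1n.
have Ps : P 0 s by apply: (add 0 e s) => //; [exact: le_trans cs|exact: H].
have Es : E s by split => //; rewrite s1 (le_trans c0).
have sc : s <= c by exact: (sup_upper_bound supE Es).
suff <- : s = 1 by [].
by move: sc; rewrite /s; have [hh|hh] := leP 1 (c + h / 2) => // sc'; exfalso; lra.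
Qed.

Lemma integrable_itv (w : R -> R) a b : (forall t, a <= t <= b -> {for t, continuous w}) ->
  mu.-integrable `[a, b] (EFin \o w).
Proof.
move=> cw; apply: (@continuous_compact_integrable R w); first exact: segment_compact.
apply: continuous_in_subspaceT => t; rewrite inE /= in_itv /= => tab.
exact: cw.
Qed.

(** A mean value inequality for a function that has no derivative at the points where a
    truncation is active: a bound of the local growth by a continuous rate is enough. *)
Lemma growth_le_integral (f w : R -> R) :
  (forall t, 0 <= t <= 1 -> {for t, continuous w}) ->
  (forall t, 0 <= t <= 1 -> forall e, 0 < e -> exists2 h, 0 < h & forall s, 0 <= s <= 1 ->
      `|s - t| < h -> `|f s - f t| <= (w t + e) * `|s - t|) ->
  f 1 - f 0 <= \int[mu]_(t in `[0%R, 1%R]) w t.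
Proof.
move=> cw loc; apply/ler_addgt0Pr => e e0.
have int a b : 0 <= a -> b <= 1 -> mu.-integrable `[a, b] (EFin \o w).
  move=> a0 b1; apply: integrable_itv => t /andP[at' tb]; apply: cw.
  by rewrite (le_trans a0) //= (le_trans tb).
pose P a b := 0 <= a -> b <= 1 -> f b - f a <= (\int[mu]_(t in `[a, b]) w t) + e * (b - a).
suff : P 0 1 by move=> /(_ (lexx _) (lexx _)); rewrite subr0 mulr1.
apply: cousin01.
  move=> a b c ab bc Pab Pbc a0 c1.
  have := Pab a0 (le_trans bc c1); have := Pbc (le_trans a0 ab) c1.
  have := @Rintegral_itvB R w (BLeft a) (BRight c) b (int a c a0 c1) _ _.
  rewrite Rintegral_itv_obnd_cbnd; last first.
    apply: (integrableS _ _ _ (int b c (le_trans a0 ab) c1)) => //.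
    exact: subset_itv_oc_cc.
  by move=> /(_ ab bc); lra.
move=> t t01.
have e3 : 0 < e / 2 by rewrite divr_gt0.
have [h h0 H] := loc t t01 (e / 2) e3.
have [d d0 D] : exists2 d, 0 < d & forall s, `|s - t| < d -> w t - e / 2 <= w s.
  have := cw t t01 => /cvgrPdist_lt/(_ (e / 2) e3) [d /= d0 dP].
  exists d => // s std; have := dP s; rewrite /= distrC => /(_ std).
  by rewrite ltr_norml => /andP[_]; lra.
exists (Num.min h d); first by rewrite lt_min h0.
move=> s1 s2 s10 s1t ts2 s21 hs1 hs2 _ _.
have [h1 h2] : t - s1 < Num.min h d /\ s2 - t < Num.min h d by split; lra.
move: h1 h2; rewrite !lt_min => /andP[h1 d1] /andP[h2 d2].
have F1 : f t - f s1 <= (w t + e / 2) * (t - s1).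
  have := H s1; rewrite s10 (le_trans s1t) /=; last by case/andP: t01.
  rewrite distrC ger0_norm ?subr_ge0 // => /(_ isT h1).
  by rewrite distrC; apply: le_trans; exact: ler_norm.
have F2 : f s2 - f t <= (w t + e / 2) * (s2 - t).
  have := H s2; rewrite s21 (le_trans _ ts2) /=; last by case/andP: t01.
  rewrite ger0_norm ?subr_ge0 // => /(_ isT h2).
  by apply: le_trans; exact: ler_norm.
have F3 : (w t - e / 2) * (s2 - s1) <= \int[mu]_(s in `[s1, s2]) w s.
  have -> : (w t - e / 2) * (s2 - s1) = \int[mu]_(s in `[s1, s2]) (w t - e / 2).
    rewrite Rintegral_cst // [X in fine X](_ : _ = (s2 - s1)%:E) //.
    rewrite /= lebesgue_measure_itv /= lte_fin; case: ltP => // s21'.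
    have -> : s2 = s1 by apply/le_anti; rewrite s21' (le_trans s1t ts2).
    by rewrite subrr.
  apply: le_Rintegral => //; [|exact: int|].
    by apply: integrable_itv => x _; exact: cvg_cst.
  move=> x; rewrite /= in_itv /= => /andP[x1 x2]; apply: D.
  by rewrite ltr_norml; apply/andP; split; lra.
have -> : f s2 - f s1 = (f s2 - f t) + (f t - f s1) by ring.
apply: (le_trans (lerD F2 F1)).
apply: le_trans (lerD F3 (lexx _)).
by rewrite le_eqVlt; apply/orP; left; apply/eqP; field.
Qed.

End Cousin.

(** * First order expansions in Euclidean norms *)

Section Norms.
Context (R : realType) (n : nat).
Implicit Types (w : Cn R n).

(** The norm of the normed module takes values in R[i]; [normr_le_enorm] and
    [enorm_le_normr] are what it takes to read little-o statements in Euclidean norms. *)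
Lemma normr_le_enorm w : `|w| <= ((enorm w)%:C)%C.
Proof.
have [->|w0] := eqVneq w 0; first by rewrite normr0 lecE /= eqxx enorm_ge0.
have [|[i j] wE] := @mx_norm_neq0 _ _ _ w.
  by apply: contra w0 => /eqP/mx_norm_eq0 ->.
by rewrite -[leLHS]/(mx_norm w) wE /= (ord1 i) normc_def lecR ler_enorm_coord.
Qed.

Lemma enorm_le_normr w : ((enorm w)%:C)%C <= (n + n)%:R * `|w|.
Proof.
have H j : `|w ord0 j| <= `|w|.
  rewrite -[leRHS]/(mx_norm w) mx_normE -[leLHS]nngE num_le.
  exact: (le_bigmax _ (fun i : 'I_1 * 'I_n => `|w i.1 i.2|%:nng) (ord0, j)).
apply: (@le_trans _ _ ((\sum_j (`|complex.Re (w ord0 j)| + `|complex.Im (w ord0 j)|))%:C%C)).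
  by rewrite lecR enorm_le_sum.
rewrite (rmorph_sum (real_complex R)) /=.
apply: (@le_trans _ _ (\sum_(j < n) (`|w| + `|w|))).
  apply: ler_sum => j _; rewrite rmorphD /=; apply: lerD; apply: le_trans (H j).
    exact: normc_ge_Re.
  rewrite normc_def lecR -sqrtr_sqr ler_sqrt ?addr_ge0 ?sqr_ge0 //.
  by rewrite lerDr sqr_ge0.
by rewrite sumr_const card_ord -mulr2n -mulrnA mulr_natl mul2n addnn.
Qed.

Lemma enorm_mulmx_le (J : 'M[R[i]]_n) : exists2 C : R, 0 <= C &
  forall w, enorm (w *m J) <= C * enorm w.
Proof.
exists (\sum_j \sum_k (2 * (`|complex.Re (J k j)| + `|complex.Im (J k j)|))).
  by apply: sumr_ge0 => j _; apply: sumr_ge0 => k _; rewrite mulr_ge0 // addr_ge0.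
move=> w; apply: le_trans (enorm_le_sum _) _.
rewrite mulr_suml; apply: ler_sum => j _; rewrite mulr_suml.
have imsum (F : 'I_n -> R[i]) : complex.Im (\sum_k F k) = \sum_k complex.Im (F k).
  by elim/big_rec2: _ => // i y1 y2 _ <-; rewrite cImD.
rewrite mxE cRe_sum imsum.
apply: (@le_trans _ _ (\sum_k (`|complex.Re (w ord0 k * J k j)| + `|complex.Im (w ord0 k * J k j)|))).
  by rewrite big_split; apply: lerD; exact: ler_norm_sum.
apply: ler_sum => k _; rewrite cReM cImM.
apply: (le_trans (lerD (ler_normB _ _) (ler_normD _ _))); rewrite !normrM.
have := ler_enorm_Re w k; have := ler_enorm_Im w k.
set b := `|complex.Re (w _ _)|; set a := `|complex.Im (w _ _)|; set c := `|complex.Re (J _ _)|; set d := `|complex.Im (J _ _)|; set e := enorm w => h1 h2.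
have [? ? ? ?] : [/\ 0 <= a, 0 <= b, 0 <= c & 0 <= d] by rewrite !normr_ge0.
have h3 : b * c <= e * c by rewrite ler_wpM2r.
have h4 : a * d <= e * d by rewrite ler_wpM2r.
have h5 : b * d <= e * d by rewrite ler_wpM2r.
have h6 : a * c <= e * c by rewrite ler_wpM2r.
by lra.
Qed.

Lemma differentiable_enorm (f : Cn R n -> Cn R n) (z : Cn R n) : differentiable f z ->
  forall e : R, 0 < e -> exists2 h : R, 0 < h & forall w, enorm (w - z) < h ->
    enorm (f w - f z - (w - z) *m jacobian f z) <= e * enorm (w - z).
Proof.
move=> df e e0.
have /eqaddoEx : forall h, f (h + z) = f z + 'd f z h +o_(h \near (0 : Cn R n)) h := diff_locallyx df.
move=> H; have /eqaddoP H2 := funext H.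
have e'0 : 0 < ((e / (n.+1 + n.+1)%:R)%:C)%C by rewrite ltcE /= eqxx divr_gt0 // ltr0n.
have /nbhs_enormP[h h0 hP] := H2 _ e'0.
exists h => // w wz; have := hP (w - z); rewrite subr0 => /(_ wz).
set D := f w - f z - (w - z) *m jacobian f z.
have -> : ((fun x : Cn R n => f (x + z)) - (fun x : Cn R n => f z + 'd f z x)) (w - z) = D.
  by rewrite /D /jacobian mul_rV_lin1 -[X in X - _ = _]/(f (w - z + z)) subrK opprD addrA.
move=> HD.
have N0 : 0 < (n.+1 + n.+1)%:R :> R by rewrite ltr0n.
have n20 : 0 <= (n + n)%:R :> R[i] by rewrite ler0n.
have H3 : ((enorm D)%:C)%C <= ((n + n)%:R * (e / (n.+1 + n.+1)%:R) * enorm (w - z))%:C%C.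
  apply: (le_trans (enorm_le_normr D)).
  rewrite !creal_M -mulrA (_ : ((n + n)%:R%:C)%C = (n + n)%:R); last exact: (rmorph_nat (real_complex R)).
  apply: ler_wpM2l => //; apply: (le_trans HD).
  rewrite -creal_M; apply: ler_wpM2l; last exact: normr_le_enorm.
  exact: ltW.
move: H3; rewrite lecR => /le_trans; apply; apply: ler_wpM2r; first exact: enorm_ge0.
rewrite mulrCA ler_piMr ?(ltW e0) // ler_pdivrMr // mul1r ler_nat.
by rewrite addSn addnS ltnW // ltnW.
Qed.

Lemma C1_curve_enorm (gamma : R -> Cn R n) (t e : R) : C1_curve gamma -> 0 < e ->
  exists2 h : R, 0 < h & forall s, `|s - t| < h ->
    enorm (gamma s - gamma t - (s - t)%:C%C *: velocity gamma t) <= e * `|s - t|.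
Proof.
move=> C1 e0.
pose e' := e / (n.+1 + n.+1)%:R.
have e'0 : 0 < e' by rewrite divr_gt0 // ltr0n.
have D1 (x : R -> R) : derivable x t 1 -> \forall s \near t, `|x s - x t - (s - t) * derive1 x t| <= e' * `|s - t|.
  move=> dx; have : derivable x t 1 := dx.
  rewrite /derivable => /cvg_ex[l xl].
  have -> : derive1 x t = l by rewrite derive1E; exact: (cvg_lim _ xl).
  move/cvgrPdist_lt: xl => /(_ e' e'0) [d /= d0 dP].
  apply/nbhs_ballP; exists d => // s; rewrite -ball_normE /= => sd.
  have [->|st] := eqVneq s t; first by rewrite !subrr mul0r subr0 normr0 mulr0.
  have st0 : s - t != 0 by rewrite subr_eq0.
  have sd' : `|s - t| < d by rewrite distrC.
  have := dP (s - t); rewrite /= sub0r normrN => /(_ sd' st0).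
  rewrite [(_ - _)%:A]mulr1 subrK => H.
  have -> : x s - x t - (s - t) * l = - ((s - t) * (l - (s - t)^-1 *: (x s - x t))).
    by rewrite mulrBr /GRing.scale /= mulVKf //; ring.
  rewrite normrN normrM [leLHS]mulrC; apply: ler_wpM2r => //; exact: ltW.
have : \forall s \near t, forall j,
   `|complex.Re (gamma s ord0 j) - complex.Re (gamma t ord0 j) - (s - t) * complex.Re (velocity gamma t ord0 j)| +
   `|complex.Im (gamma s ord0 j) - complex.Im (gamma t ord0 j) - (s - t) * complex.Im (velocity gamma t ord0 j)|
    <= 2 * (e' * `|s - t|).
  apply: (filter_forall (nbhs_filter t)) => j; have [dx dy _ _] := C1 j.
  apply: filterS2 (D1 _ (dx t)) (D1 _ (dy t)) => s h1 h2.
  by rewrite !mxE /= mulr_natl mulr2n; exact: lerD.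
move=> /nbhs_ballP[h /= h0 hP]; exists h => // s st.
have ts : `|t - s| < h by rewrite distrC.
apply: le_trans (enorm_le_sum _) _.
apply: (@le_trans _ _ (\sum_(j < n) (2 * (e' * `|s - t|)))).
  apply: ler_sum => j _; rewrite !mxE !cReD !cImD !cReN !cImN cReM cImM /=.
  have := hP s; rewrite -ball_normE /= => /(_ ts j).
  by rewrite !mxE /= !mul0r subr0 addr0.
rewrite sumr_const card_ord -[leLHS]mulr_natl /e'.
have -> : n%:R * (2 * (e / (n.+1 + n.+1)%:R * `|s - t|)) = e * `|s - t| * ((2 * n)%:R / (n.+1 + n.+1)%:R).
  by rewrite natrM; ring.
rewrite ler_piMr ?mulr_ge0 ?(ltW e0) // ler_pdivrMr ?ltr0n // mul1r ler_nat mul2n -addnn.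
by rewrite addSn addnS ltnW // ltnW.
Qed.

End Norms.

(** * Chart distance and geodesic distance *)

Lemma ler_dist_minr (R : realDomainType) (a b r : R) : `|Num.min a r - Num.min b r| <= `|a - b|.
Proof.
have H (x y : R) : x <= y -> `|Num.min x r - Num.min y r| <= `|x - y|.
  move=> xy; rewrite ![`|_ - _|]ler0_norm ?subr_le0 //; last by rewrite le_min !ge_min xy lexx orbT.
  rewrite !opprB; have [h1|h1] := leP x r; have [h2|h2] := leP y r; lra.
have [ab|ba] := leP a b; first exact: H.
by rewrite distrC [leRHS]distrC; apply: H; exact: ltW.
Qed.

Lemma ler_dist_enorm (R : realType) n (z w : Cn R n) : `|enorm z - enorm w| <= enorm (z - w).
Proof.
rewrite ler_norml; apply/andP; split.
  rewrite lerNl opprB lerBlDl -[leLHS](_ : enorm (z + (w - z)) = _); last by rewrite addrC subrK.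
  by rewrite enormB (le_trans (ler_enormD _ _)).
by rewrite lerBlDl -{1}(subrK w z) addrC ler_enormD.
Qed.

Section Curves.
Context (R : realType) (n : nat) (X : topologicalType) (Sx : complex_structure R n X).
Context (g : hermitian_metric Sx) (X_hausdorff : hausdorff_space X).
Local Notation mu := (@lebesgue_measure R).

Lemma curve_continuous (gamma : R -> Cn R n) t e : C1_curve gamma -> 0 < e ->
  exists2 h : R, 0 < h & forall s, `|s - t| < h -> enorm (gamma s - gamma t) < e.
Proof.
move=> C1 e0; have [h h0 H] := C1_curve_enorm t C1 ltr01.
have V0 : 0 < enorm (velocity gamma t) + 1 by rewrite ltr_wpDl ?enorm_ge0.
exists (Num.min h (e / (enorm (velocity gamma t) + 1))); first by rewrite lt_min h0 divr_gt0.
move=> s; rewrite lt_min => /andP[/H sh]; rewrite ltr_pdivlMr // => se.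
rewrite -(subrK ((s - t)%:C%C *: velocity gamma t) (gamma s - gamma t)).
apply: le_lt_trans (ler_enormD _ _) _; rewrite enormZr.
by apply: le_lt_trans se; rewrite mulrDr mulr1 addrC lerD2l (le_trans sh) ?mul1r.
Qed.

Lemma curve_cvg (gamma : R -> Cn R n) t : C1_curve gamma -> gamma s @[s --> t] --> gamma t.
Proof.
move=> C1 A /nbhs_enormP[e e0 eA].
have [h h0 H] := curve_continuous t C1 e0.
apply/nbhs_ballP; exists h => // s; rewrite -ball_normE /= distrC => sh.
by apply: eA; exact: H.
Qed.

Lemma near_curve (c : chart R n X) (gamma : R -> Cn R n) t (A : set X) : atlas Sx c ->
  C1_curve gamma -> cod c (gamma t) -> nbhs (bwd c (gamma t)) A ->
  exists2 h : R, 0 < h & forall s, `|s - t| < h -> A (bwd c (gamma s)).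
Proof.
move=> Sc C1 ct nA; have [_ _ _ _ cb] := atlas_chart Sc.
have := @curve_cvg gamma t C1 _ (cb _ ct A nA).
move=> /nbhs_ballP[h /= h0 H]; exists h => // s st; apply: H.
by rewrite -ball_normE /= distrC.
Qed.

Definition speed (c : chart R n X) (gamma : R -> Cn R n) (t : R) : R :=
  hnorm (metric g c (gamma t)) (velocity gamma t).

Lemma speed_continuous (c : chart R n X) (gamma : R -> Cn R n) t : atlas Sx c ->
  C1_curve gamma -> cod c (gamma t) -> {for t, continuous (speed c gamma)}.
Proof.
move=> Sc C1 ct.
have cv j : {for t, continuous (fun s => complex.Re (velocity gamma s ord0 j) : R)} /\
   {for t, continuous (fun s => complex.Im (velocity gamma s ord0 j) : R)}.
  have [_ _ cx cy] := C1 j.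
  split.
    rewrite (_ : (fun s => _) = derive1 (fun s => complex.Re (gamma s ord0 j))); first exact: cx.
    by apply/funext => s; rewrite mxE.
  rewrite (_ : (fun s => _) = derive1 (fun s => complex.Im (gamma s ord0 j))); first exact: cy.
  by apply/funext => s; rewrite mxE.
have cm j k : {for t, continuous (fun s => complex.Re (metric g c (gamma s) j k) : R)} /\
   {for t, continuous (fun s => complex.Im (metric g c (gamma s) j k) : R)}.
  have [/(_ 0%N)[H1 _] /(_ 0%N)[H2 _]] := metric_smooth g Sc j k.
  split; [exact: (cvg_comp _ _ (curve_cvg C1) (H1 _ ct))|exact: (cvg_comp _ _ (curve_cvg C1) (H2 _ ct))].
rewrite /speed /hnorm; apply: (@continuous_comp _ _ _ (fun s => complex.Re (hform (metric g c (gamma s)) (velocity gamma s)) : R) (@Num.sqrt R)); last exact: sqrt_continuous.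
rewrite (_ : (fun s => _) = fun s => \sum_j \sum_k (complex.Re (metric g c (gamma s) j k) * hpr (velocity gamma s) j k - complex.Im (metric g c (gamma s) j k) * hpi (velocity gamma s) j k)); last first.
  by apply/funext => s; rewrite hformE.
apply: (@cvg_sumr R _ (nbhs t) (nbhs_filter t)) => j; apply: (@cvg_sumr R _ (nbhs t) (nbhs_filter t)) => k.
have [r1 i1] := cv j; have [r2 i2] := cv k; have [rm im] := cm j k.
exact: (cvgB (cvgM rm (cvgD (cvgM r1 r2) (cvgM i1 i2))) (cvgM im (cvgB (cvgM i1 r2) (cvgM r1 i2)))).
Qed.

Lemma speed_ge0 c gamma t : 0 <= speed c gamma t.
Proof. exact: sqrtr_ge0. Qed.

Section TruncatedDistance.
Context (c0 : chart R n X) (r k : R) (x : X).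
Context (Sc0 : atlas Sx c0) (r0 : 0 < r) (k0 : 0 < k).
Context (ball_cod : forall z, enorm z < 3 * r -> cod c0 z).
Context (lower : forall z v, enorm z < 3 * r -> enorm v <= k * hnorm (metric g c0 z) v).
Context (xr : enorm (fwd c0 x) < r).

(** The chart distance to x, cut off at r and extended by the constant r, so that it is
    defined, and locally Lipschitz, on the whole of X: a curve may leave the domain of the
    chart. *)
Definition trunc_dist (p : X) : R :=
  if pselect (dom c0 p) then Num.min (enorm (fwd c0 p - fwd c0 x)) r else r.

Let K := bwd c0 @` [set w | enorm (w - fwd c0 x) <= r].

(** The image of a compact ball. It is closed because X is Hausdorff, and this is what
    prevents the truncated distance from jumping where a curve leaves the chart. *)
Lemma K_closed : closed K.
Proof.
apply: compact_closed => //; apply: continuous_compact; last exact: compact_enorm_ball.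
apply: continuous_in_subspaceT => w; rewrite inE /= => wr.
have [_ _ _ _ cb] := atlas_chart Sc0; apply: cb; apply: ball_cod.
rewrite -(subrK (fwd c0 x) w); apply: le_lt_trans (ler_enormD _ _) _.
have rr : r + r < 3 * r.
  by rewrite (_ : 3 * r = r + r + r) ?ltrDl //; ring.
exact: lt_trans (ler_ltD wr xr) rr.
Qed.

Lemma trunc_dist_far p : ~ K p -> trunc_dist p = r.
Proof.
move=> nK; rewrite /trunc_dist; case: pselect => // dp.
have [_ H _ _ _] := atlas_chart Sc0; have [cp bp] := H p dp.
apply/min_idPr; rewrite leNgt; apply/negP => /ltW pr.
by apply: nK; exists (fwd c0 p).
Qed.

(** Away from K the function is constant. Over K, the first order expansion of the
    transition map sends a small step of the curve to a step of the chart c0 whose length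
    the metric controls, and the transition law of the metric identifies the two speeds. *)
Lemma trunc_dist_local (c : chart R n X) (gamma : R -> Cn R n) t e : atlas Sx c ->
  C1_curve gamma -> cod c (gamma t) -> 0 < e ->
  exists2 h : R, 0 < h & forall s, `|s - t| < h ->
    `|trunc_dist (bwd c (gamma s)) - trunc_dist (bwd c (gamma t))| <= (k * speed c gamma t + e) * `|s - t|.
Proof.
move=> Sc C1 ct e0; set p := bwd c (gamma t).
have [Kp|nKp] := pselect (K p); last first.
  have [|h h0 H] := @near_curve c gamma t (~` K) Sc C1 ct.
    by apply: open_nbhs_nbhs; split => //; apply: closed_openC; exact: K_closed.
  exists h => // s /H nKs; rewrite !trunc_dist_far // subrr normr0.
  by rewrite mulr_ge0 // addr_ge0 ?(ltW e0) // mulr_ge0 ?speed_ge0 // ltW.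
have [[od0 oc0] H1 H2 cf0 cb0] := atlas_chart Sc0.
have [w wr wp] := Kp; rewrite /= in wr.
have w2 : enorm w < 3 * r.
  rewrite -(subrK (fwd c0 x) w); apply: le_lt_trans (ler_enormD _ _) _.
  have rr : r + r < 3 * r.
    by rewrite (_ : 3 * r = r + r + r) ?ltrDl //; ring.
  exact: lt_trans (ler_ltD wr xr) rr.
have [dw fw] := H2 w (ball_cod w2).
have dp : dom c0 p by rewrite -wp.
have fp : fwd c0 p = w by rewrite -wp.
have ov : chart_overlap c c0 (gamma t) by split.
have [hol _] := atlas_compatible Sc Sc0.
have df := hol _ ov.
set T := transition c c0 in df *.
have Tt : T (gamma t) = w by rewrite /T /transition /=.
pose V := velocity gamma t; pose J := jacobian T (gamma t).
have VJ : enorm (V *m J) <= k * speed c gamma t.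
  rewrite /speed /hnorm (metric_transition g Sc Sc0 ov) -/T -/J hform_mul.
  by apply: lower; rewrite Tt.
have [CJ CJ0 HJ] := enorm_mulmx_le J.
have V1 : 0 < enorm V + 1 by rewrite ltr_wpDl ?enorm_ge0.
have CJ1 : 0 < CJ + 1 by rewrite ltr_wpDl.
pose e1 := e / (2 * (enorm V + 1)).
have e10 : 0 < e1 by rewrite divr_gt0 // mulr_gt0.
pose e2 := Num.min 1 (e / (2 * (CJ + 1))).
have e20 : 0 < e2 by rewrite lt_min ltr01 divr_gt0 // mulr_gt0.
have [h1 h10 D1] := differentiable_enorm df e10.
have [h2 h20 D2] := curve_continuous t C1 h10.
have [h3 h30 D3] := C1_curve_enorm t C1 e20.
have [h4 h40 D4] := @near_curve c gamma t (dom c0) Sc C1 ct (open_nbhs_nbhs (conj od0 dp)).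
exists (Num.min (Num.min h2 h3) h4); first by rewrite !lt_min h20 h30.
move=> s; rewrite !lt_min => /andP[/andP[s2 s3] s4].
have ds := D4 s s4.
rewrite /trunc_dist; case: pselect => // ?; case: pselect => // ?.
apply: le_trans (ler_dist_minr _ _ _) _; apply: le_trans (ler_dist_enorm _ _) _.
rewrite opprB addrA subrK.
have -> : fwd c0 (bwd c (gamma s)) - fwd c0 p = (T (gamma s) - T (gamma t) - (gamma s - gamma t) *m J) + (gamma s - gamma t) *m J.
  by rewrite subrK.
apply: le_trans (ler_enormD _ _) _.
set dg := gamma s - gamma t.
have A1 := D1 _ (D2 s s2); rewrite -/dg -/J in A1 *.
have A3 := D3 s s3; rewrite -/dg -/V in A3.
set dt := `|s - t| in A3 *.
have dt0 : 0 <= dt by exact: normr_ge0.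
have B1 : enorm dg <= (enorm V + 1) * dt.
  rewrite -(subrK ((s - t)%:C%C *: V) dg); apply: le_trans (ler_enormD _ _) _.
  rewrite enormZr -/dt.
  have : e2 * dt <= 1 * dt by rewrite ler_wpM2r // ge_min lexx.
  by lra.
have B2 : enorm (dg *m J) <= dt * enorm (V *m J) + CJ * e2 * dt.
  rewrite -{1}(subrK ((s - t)%:C%C *: V) dg) mulmxDl.
  apply: le_trans (ler_enormD _ _) _.
  rewrite -scalemxAl enormZr -/dt addrC lerD2l.
  apply: (le_trans (HJ _)); rewrite -mulrA; exact: ler_wpM2l.
have B3 : CJ * e2 <= e / 2.
  apply: (@le_trans _ _ (CJ * (e / (2 * (CJ + 1))))).
    by rewrite ler_wpM2l // ge_min lexx orbT.
  rewrite mulrCA ler_pM2l // ler_pdivrMr ?mulr_gt0 //; lra.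
have B4 : e1 * enorm dg <= e / 2 * dt.
  apply: (@le_trans _ _ (e1 * ((enorm V + 1) * dt))); first by rewrite ler_wpM2l // ltW.
  rewrite /e1 le_eqVlt; apply/orP; left; apply/eqP; field.
  by rewrite gt_eqF.
have B5 : CJ * e2 * dt <= e / 2 * dt by rewrite ler_wpM2r.
have B6 : dt * enorm (V *m J) <= dt * (k * speed c gamma t) by rewrite ler_wpM2l.
rewrite mulrDl [k * _ * _]mulrC.
by have := lerD A1 B2; lra.
Qed.

Lemma trunc_dist_piece (c : chart R n X) (gamma : R -> Cn R n) : atlas Sx c -> C1_curve gamma ->
  (forall t, 0 <= t <= 1 -> cod c (gamma t)) ->
  trunc_dist (bwd c (gamma 1)) - trunc_dist (bwd c (gamma 0)) <= k * \int[mu]_(t in `[0%R, 1%R]) speed c gamma t.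
Proof.
move=> Sc C1 ct.
have cs t : 0 <= t <= 1 -> {for t, continuous (speed c gamma)}.
  by move=> /ct; exact: speed_continuous.
rewrite -RintegralZl //; last by apply: integrable_itv => t; exact: cs.
apply: (@growth_le_integral R (fun t => trunc_dist (bwd c (gamma t))) (fun t => k * speed c gamma t)).
  by move=> t /cs H; apply: cvgM => //; exact: cvg_cst.
move=> t t01 e e0; have [h h0 H] := trunc_dist_local Sc C1 (ct t t01) e0.
by exists h => // s _; exact: H.
Qed.

Lemma trunc_dist_curve_length y z L : curve_length g y z L -> trunc_dist z - trunc_dist y <= k * L.
Proof.
elim=> [p|c gamma z' L' Sc C1 ct _ IH]; first by rewrite subrr mulr0.
rewrite mulrDr; have := trunc_dist_piece Sc C1 ct; rewrite /speed; lra.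
Qed.

End TruncatedDistance.

Lemma curve_length_ge0 y z L : curve_length g y z L -> 0 <= L.
Proof.
elim=> [p|c gamma z' L' Sc C1 ct _ IH] //.
by rewrite addr_ge0 //; apply: Rintegral_ge0 => t _; exact: sqrtr_ge0.
Qed.

End Curves.

(** * Smooth functions are locally Lipschitz *)

Lemma mvt_bound (R : realType) (h dh : R -> R) (C a : R) :
  (forall t, `|t| <= `|a| -> is_derive t (1 : R) h (dh t)) ->
  (forall t, `|t| <= `|a| -> `|dh t| <= C) -> `|h a - h 0| <= C * `|a|.
Proof.
have main (b c : R) : b <= c -> (forall t, t \in `[b, c] -> is_derive t (1 : R) h (dh t)) ->
    (forall t, t \in `[b, c] -> `|dh t| <= C) -> `|h c - h b| <= C * `|c - b|.
  move=> bc H1 H2.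
  have D1 t : t \in `]b, c[ -> is_derive t (1 : R) h (dh t).
    by rewrite in_itv /= => /andP[/ltW t1 /ltW t2]; apply: H1; rewrite in_itv /= t1.
  have D2 : {within `[b, c], continuous h}.
    by apply: derivable_within_continuous => t tbc; have [] := H1 t tbc.
  have [t tbc E] := MVT_segment bc D1 D2.
  rewrite E normrM; apply: ler_wpM2r => //; exact: H2.
move=> H1 H2; have [a0|a0] := leP 0 a.
  have S t : t \in `[0, a] -> `|t| <= `|a|.
    by rewrite in_itv /= => /andP[t0 ta]; rewrite !ger0_norm.
  have := main 0 a a0 (fun t st => H1 t (S t st)) (fun t st => H2 t (S t st)).
  by rewrite subr0.
have S t : t \in `[a, 0] -> `|t| <= `|a|.
  by rewrite in_itv /= => /andP[ta t0]; rewrite ler0_norm // ltr0_norm // lerN2.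
have := main a 0 (ltW a0) (fun t st => H1 t (S t st)) (fun t st => H2 t (S t st)).
by rewrite sub0r normrN distrC.
Qed.

Section SmoothLip.
Context (R : realType) (n : nat).
Local Notation ofr := (@of_real_coords R n).

Lemma enorm_ofr (t : (n + n).-tuple R) : enorm (ofr t) ^+ 2 = \sum_i tnth t i ^+ 2.
Proof.
rewrite enorm_sqr /edot big_split_ord /= -big_split /=.
by apply: eq_bigr => j _; rewrite !mxE /= !expr2.
Qed.

Lemma sub_ofr (t : (n + n).-tuple R) (p : Cn R n) :
  ofr t - p = ofr [tuple tnth t i - tnth (to_real p) i | i < n + n].
Proof.
rewrite -{1}(to_realK p); move: (to_real p) => {}p; apply/rowP => j; rewrite !mxE !tnth_mktuple.
by apply/eqP; rewrite eq_complex /= !eqxx.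
Qed.

Lemma ler_tnth_enorm (w z : Cn R n) i : `|tnth (to_real w) i - tnth (to_real z) i| <= enorm (w - z).
Proof.
rewrite -(@ler_pXn2r _ 2) ?nnegrE ?enorm_ge0 // real_normK ?num_real //.
rewrite -{2}(to_realK w) sub_ofr enorm_ofr (bigD1 i) //=.
rewrite [tnth (mktuple _) i]tnth_mktuple lerDl.
by apply: sumr_ge0 => k _; rewrite sqr_ge0.
Qed.

Definition rbasis (i : 'I_(n + n)) : Cn R n := ofr [tuple (j == i)%:R | j < n + n].

Lemma enorm_rbasis i : enorm (rbasis i) = 1.
Proof.
apply/eqP; rewrite -(@eqrXn2 _ 2) ?enorm_ge0 // enorm_ofr (bigD1 i) //= big1.
  by rewrite tnth_mktuple eqxx addr0.
by move=> j ji; rewrite tnth_mktuple (negbTE ji) expr0n.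
Qed.

(** Going from z to w along these points changes one real coordinate at a time. *)
Definition hybrid (z w : Cn R n) (k : nat) : Cn R n :=
  ofr [tuple if (i < k)%N then tnth (to_real w) i else tnth (to_real z) i | i < n + n].

Lemma hybrid0 z w : hybrid z w 0 = z.
Proof.
rewrite -[RHS]to_realK; congr of_real_coords.
by apply: eq_from_tnth => i; rewrite tnth_mktuple.
Qed.

Lemma hybridN z w : hybrid z w (n + n) = w.
Proof.
rewrite -[RHS]to_realK; congr of_real_coords.
by apply: eq_from_tnth => i; rewrite tnth_mktuple ltn_ord.
Qed.

Lemma hybridS z w (i : 'I_(n + n)) : hybrid z w i.+1 = hybrid z w i +
  (tnth (to_real w) i - tnth (to_real z) i)%:C%C *: rbasis i.
Proof.
rewrite /hybrid; move: (to_real w) (to_real z) => {}w {}z.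
have H (a : 'I_(n + n)) : (if (a < i.+1)%N then tnth w a else tnth z a) =
  (if (a < i)%N then tnth w a else tnth z a) +
  (tnth w i - tnth z i) * (a == i)%:R.
  rewrite ltnS leq_eqVlt -val_eqE /=; case: (ltngtP a i) => //= [_|_|/val_inj ->].
  - by rewrite mulr0 addr0.
  - by rewrite mulr0 addr0.
  - by rewrite mulr1 addrC subrK.
apply/rowP => j; rewrite !mxE !tnth_mktuple !H.
by apply/eqP; rewrite eq_complex; apply/andP; split => /=; rewrite !mul0r ?subr0 ?addr0.
Qed.

Lemma hybrid_near z w k : enorm (hybrid z w k - z) <= enorm (w - z).
Proof.
rewrite -(@ler_pXn2r _ 2) ?nnegrE ?enorm_ge0 //.
rewrite -{2}(to_realK w) /hybrid !sub_ofr !enorm_ofr; apply: ler_sum => i _.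
rewrite !tnth_map !tnth_ord_tuple; case: ifP => // _.
by rewrite subrr expr0n sqr_ge0.
Qed.

Lemma rderive_line (f : Cn R n -> R) (v p : Cn R n) (V : set (Cn R n)) (t : R) :
  (forall z, V z -> rderivable f v z) -> V (p + t%:C%C *: v) ->
  is_derive t 1 (fun s : R => f (p + s%:C%C *: v)) (rderive f v (p + t%:C%C *: v)).
Proof.
move=> df Vt.
have dt := df _ Vt.
have E : (fun s : R => f (p + s%:C%C *: v)) = (fun s : R => f (p + t%:C%C *: v + s%:C%C *: v)) \o (fun s => s - t).
  apply/funext => s /=; rewrite -addrA -scalerDl; congr (f (_ + _ *: _)).
  by apply/eqP; rewrite eq_complex /= addr0 addrC subrK !eqxx.
have H0 : is_derive (t - t) (1 : R) (fun s : R => f (p + t%:C%C *: v + s%:C%C *: v)) (rderive f v (p + t%:C%C *: v)).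
  by rewrite subrr; exact: DeriveDef.
rewrite E -[rderive _ _ _]mulr1.
have H1 : is_derive t (1 : R) (fun s : R => s - t) 1.
  by apply: is_derive_eq; rewrite subr0.
exact: (@is_derive1_comp R _ (fun s : R => s - t) t _ _ H0 H1).
Qed.

(** The mean value theorem on each coordinate segment of a path from z to w; continuity of
    the first derivatives bounds them near 0. *)
Lemma smooth_lipschitz (f : Cn R n -> R) (W : set (Cn R n)) : smooth_on W f -> nbhs (0 : Cn R n) W ->
  exists2 rho : R, 0 < rho & exists2 L : R, 0 <= L & forall z w, enorm z < rho -> enorm w < rho ->
    `|f z - f w| <= L * enorm (w - z).
Proof.
move=> /(_ 1%N)[_ sf] W0.
have near1 i : \forall z \near (0 : Cn R n), `|rderive f (rbasis i) z - rderive f (rbasis i) 0| < 1.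
  have [_ [cf _]] := sf (rbasis i).
  have := cf 0 (nbhs_singleton W0).
  by move=> /cvgrPdist_lt/(_ 1 ltr01); apply: filterS => z; rewrite distrC.
have : nbhs (0 : Cn R n) (W `&` [set z | forall i, `|rderive f (rbasis i) z - rderive f (rbasis i) 0| < 1]).
  apply: filterI => //; exact: (@filter_forall _ _ _ (nbhs (0 : Cn R n)) (nbhs_filter _) near1).
move=> /nbhs_enormP[r r0 rW].
pose L := \sum_i (`|rderive f (rbasis i) 0| + 1).
(* On a segment between hybrid points, the norm is at most 2 |w - z| + |z|, and |w - z| <=
   |z| + |w|. *)
exists (r / 5); first by rewrite divr_gt0.
exists L; first by apply: sumr_ge0 => i _; rewrite addr_ge0.
move=> z w zr wr.
have -> : `|f z - f w| = `|\sum_(k < n + n) (f (hybrid z w k.+1) - f (hybrid z w k))|.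
  rewrite -(big_mkord xpredT (fun k => f (hybrid z w k.+1) - f (hybrid z w k))).
  by rewrite telescope_sumr // hybrid0 hybridN distrC.
rewrite mulr_suml; apply: le_trans (ler_norm_sum _ _ _) _; apply: ler_sum => i _.
set a := tnth (to_real w) i - tnth (to_real z) i.
have aw : `|a| <= enorm (w - z) by exact: ler_tnth_enorm.
have inB t : `|t| <= `|a| -> enorm (hybrid z w i + t%:C%C *: rbasis i) < r.
  move=> ta; apply: le_lt_trans (ler_enormD _ _) _.
  rewrite enormZr enorm_rbasis mulr1 -(subrK z (hybrid z w i)).
  have h1 := ler_enormD (hybrid z w i - z) z; have h2 := hybrid_near z w i.
  have h3 := ler_enormD w (- z); rewrite enormN in h3.
  have h4 := le_trans ta aw; clear -h1 h2 h3 h4 zr wr; lra.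
have D t : `|t| <= `|a| -> is_derive t (1 : R) (fun s : R => f (hybrid z w i + s%:C%C *: rbasis i)) (rderive f (rbasis i) (hybrid z w i + t%:C%C *: rbasis i)).
  move=> ta; have [df _] := sf (rbasis i); apply: (rderive_line df).
  by have [] := rW _ (eq_ind_r (fun u => enorm u < r) (inB t ta) (subr0 _)).
have := @mvt_bound R (fun s : R => f (hybrid z w i + s%:C%C *: rbasis i)) _ (`|rderive f (rbasis i) 0| + 1) a D.
rewrite hybridS -/a scale0r addr0 => H; apply: le_trans (H _) _; last first.
  by apply: ler_wpM2l => //; rewrite addr_ge0.
move=> t ta; have [_ /(_ i) /ltW B] := rW _ (eq_ind_r (fun u => enorm u < r) (inB t ta) (subr0 _)).
rewrite -lerBlDl; apply: le_trans B.
exact: lerB_dist.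
Qed.

End SmoothLip.

(** * The metric dominates the Euclidean norm in charts *)

(** Positive definiteness at z0 with a constant m, kept with m / 2 nearby because the
    entries of the metric are continuous. *)
Lemma metric_lower (R : realType) n (X : topologicalType) (Sx : complex_structure R n X)
    (g : hermitian_metric Sx) (c : chart R n X) (z0 : Cn R n) : atlas Sx c -> cod c z0 ->
  exists2 r : R, 0 < r & exists2 k : R, 0 < k &
    forall z v, enorm (z - z0) < r -> enorm v <= k * hnorm (metric g c z) v.
Proof.
move=> Sc cz0.
have [m m0 low] := hform_lower (@metric_posdef _ _ _ _ g c z0 Sc cz0).
(* Then n^2 * 4 e <= m / 2, the loss allowed in [hform_perturb]. *)
pose e : R := m / (8 * (n * n).+1%:R).
have e0 : 0 < e by rewrite divr_gt0 // mulr_gt0 // ltr0n.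
have near2 j k : \forall z \near z0,
   `|complex.Re (metric g c z j k) - complex.Re (metric g c z0 j k)| < e /\
   `|complex.Im (metric g c z j k) - complex.Im (metric g c z0 j k)| < e.
  have [/(_ 0%N)[H1 _] /(_ 0%N)[H2 _]] := metric_smooth g Sc j k.
  have := H1 _ cz0 => /cvgrPdist_lt/(_ e e0) N1.
  have := H2 _ cz0 => /cvgrPdist_lt/(_ e e0) N2.
  by apply: (@filterS2 _ (nbhs z0) (nbhs_filter z0) _ _ _ _ N1 N2) => z h1 h2; split; rewrite distrC.
have : \forall z \near z0, forall jk : 'I_n * 'I_n,
   `|complex.Re (metric g c z jk.1 jk.2) - complex.Re (metric g c z0 jk.1 jk.2)| < e /\
   `|complex.Im (metric g c z jk.1 jk.2) - complex.Im (metric g c z0 jk.1 jk.2)| < e.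
  exact: (@filter_forall _ _ _ (nbhs z0) (nbhs_filter _) (fun jk => near2 jk.1 jk.2)).
move=> /nbhs_enormP[r r0 rP]; exists r => //.
exists (Num.sqrt (2 / m)); first by rewrite sqrtr_gt0 divr_gt0.
move=> z v zr; rewrite /hnorm -sqrtrM ?divr_ge0 ?(ltW m0) //.
have P1 j k : `|complex.Re (metric g c z0 j k) - complex.Re (metric g c z j k)| <= e.
  by rewrite distrC; have [/ltW] := rP z zr (j, k).
have P2 j k : `|complex.Im (metric g c z0 j k) - complex.Im (metric g c z j k)| <= e.
  by rewrite distrC; have [_ /ltW] := rP z zr (j, k).
have P := hform_perturb v P1 P2; have l0 := low v.
have e4 : (n * n)%:R * (4 * e) <= m / 2.
  rewrite /e (_ : _ * (4 * _) = ((n * n)%:R / (n * n).+1%:R) * (m / 2)).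
    apply: ler_piMl; first by rewrite divr_ge0 // ltW.
    by rewrite ler_pdivrMr ?ltr0n // mul1r ler_nat.
  have : (n * n).+1%:R != 0 :> R by rewrite pnatr_eq0.
  by move: (_.+1%:R) => N N0; field.
have e5 : (n * n)%:R * (4 * e) * enorm v ^+ 2 <= m / 2 * enorm v ^+ 2.
  by apply: ler_wpM2r => //; rewrite sqr_ge0.
have fin : enorm v ^+ 2 <= 2 / m * complex.Re (hform (metric g c z) v).
  rewrite -(invf_div m 2) ler_pdivlMl ?divr_gt0 //.
  have -> : m / 2 * enorm v ^+ 2 = m * enorm v ^+ 2 - m / 2 * enorm v ^+ 2 by field.
  by clear -l0 P e5; lra.
by rewrite -[enorm v]ger0_norm ?enorm_ge0 // -sqrtr_sqr ler_sqrt // (le_trans _ fin) // sqr_ge0.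
Qed.

(** * Circle means of a sum of a smooth and a plurisubharmonic function *)

Section Submean.
Context (R : realType) (n : nat).
Local Notation mu := (@lebesgue_measure R).
Local Notation I2 := (`[0%R, (2 * pi)%R]%classic : set R).
Implicit Types (g h : Cn R n -> R) (x z : Cn R n).

Lemma mu_I2_fin : (mu I2 < +oo)%E.
Proof. by rewrite mu_I2 ltry. Qed.

Lemma circle_in x z (u : R[i]) (r : R) : `|u| <= 1 -> enorm x + enorm z < r -> enorm (x + u *: z) < r.
Proof.
move=> u1; apply: le_lt_trans; apply: le_trans (ler_enormD _ _) _; rewrite lerD2l enormZ.
by rewrite ler_piMl ?enorm_ge0 //; move: u1; rewrite normc_def lecE /= => /andP[_].
Qed.

Lemma norm_expi (t : R) : `|expi t| <= 1.
Proof. by rewrite normc_def /= cos2Dsin2 sqrtr1. Qed.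

Lemma circle_integrable r M h x z : (forall w, `|h w| <= M) -> usc_on r h ->
  enorm x + enorm z < r ->
  mu.-integrable I2 (fun t => (h (x + expi t *: z))%:E).
Proof.
move=> hM uh xz; apply: (@measurable_bounded_integrable _ _ _ mu (fun t => h (x + expi t *: z))).
- exact: measurable_itv.
- exact: mu_I2_fin.
- have H : measurable_fun I2 (fun t : measurableTypeR R => ball_cut r M h (x + expi t *: z) - M).
    apply: measurable_funTS; apply: measurable_funB; last exact: measurable_cst.
    apply/measurable_EFinP; apply: (cmeas_comp (measurable_cut hM uh)).
    apply: measurable_coordsD; first exact: measurable_coords_cst.
    by apply: measurable_coordsZ; [exact: measurable_expi_Re|exact: measurable_expi_Im|exact: measurable_coords_cst].
  apply: (eq_measurable_fun _ _ H) => t _.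
  by rewrite /ball_cut (circle_in (norm_expi t) xz) addrK.
- exists M; split; first exact: num_real.
  by move=> b Mb t _; exact: le_trans (hM _) (ltW Mb).
Qed.

(** The circle integral of h may be shifted by the constant c because h, being bounded and
    upper semicontinuous, is integrable on circles; comparison with g is then pointwise. *)
Lemma circle_submean r M M' g h x z (c d : R) : (forall w, `|h w| <= M) -> usc_on r h ->
  (forall w, `|g w| <= M') -> usc_on r g -> enorm x + enorm z < r ->
  ((2 * pi * h x)%:E <= \int[mu]_(t in I2) (h (x + expi t *: z))%:E)%E ->
  (forall t, h (x + expi t *: z) + c <= g (x + expi t *: z) + d) ->
  ((2 * pi * (h x + c))%:E <= \int[mu]_(t in I2) (g (x + expi t *: z) + d)%:E)%E.
Proof.
move=> hM uh gM ug xz sub le.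
have ih := circle_integrable hM uh xz; have ig := circle_integrable gM ug xz.
have mI : measurable I2 by exact: measurable_itv.
have icst (a : R) : mu.-integrable I2 (fun=> a%:E).
  apply: (@measurable_bounded_integrable _ _ _ mu (fun=> a)) => //; first exact: mu_I2_fin.
  by exists `|a|; split; [exact: num_real|move=> b /ltW ab t _].
apply: (@le_trans _ _ (\int[mu]_(t in I2) ((h (x + expi t *: z))%:E + c%:E))%E).
  rewrite integralD //= integral_cst //= mu_I2 mulrDr EFinD.
  by rewrite [(2 * pi * c)%R]mulrC [in leLHS]EFinM leeD2r.
apply: le_integral.
- exact: mI.
- exact: integrableD.
- by rewrite (_ : (fun t => _) = fun t => ((g (x + expi t *: z))%:E + d%:E)%E) //; exact: integrableD.
- by move=> t _; rewrite -EFinD lee_fin.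
Qed.

End Submean.

Section Local.
Context (R : realType) (n : nat).
Local Notation mu := (@lebesgue_measure R).
Local Notation I2 := (`[0%R, (2 * pi)%R]%classic : set R).

(** With g = s + u: the submean inequality for u loses at most the oscillation of s on the
    circle, which the Lipschitz constant bounds, and upper semicontinuity passes from u to g
    because s is continuous. *)
Lemma quasi_psh_local (W : set (Cn R n)) (g s : Cn R n -> R) (u : Cn R n -> \bar R) (M : R) :
  nbhs (0 : Cn R n) W -> smooth_on W s -> psh_on W u ->
  (forall z, W z -> (g z)%:E = ((s z)%:E + u z)%E) -> (forall z, `|g z| <= M) ->
  exists2 r0 : R, 0 < r0 & exists2 L : R, 0 <= L & forall r : R, r <= r0 ->
    usc_on r g /\ forall x z d, enorm x + enorm z < r -> enorm z <= d ->
      ((2 * pi * (g x + M))%:E <=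
        \int[mu]_(t in I2) (g (x + expi t *: z)%R + M + L * d)%:E)%E.
Proof.
move=> nW ss [_ usc_u sub_u] gE gM.
have [rho rho0 [L L0 lip]] := smooth_lipschitz ss nW.
have [r2 r20 r2W] := (nbhs_enormP _ _).1 nW.
have uE z : W z -> u z = (g z - s z)%:E.
  move=> Wz; have := gE z Wz; case: (u z) => [y| |] //= [->].
  by rewrite addrAC subrr add0r.
have inW z r : r <= Num.min rho r2 -> enorm z < r -> W z /\ enorm z < rho.
  rewrite le_min => /andP[h1 h2] zr; split; last exact: lt_le_trans zr h1.
  by apply: r2W; rewrite subr0 (lt_le_trans zr).
exists (Num.min rho r2); first by rewrite lt_min rho0.
exists L => // r rr0.
have usc_gen z a : enorm z < r -> g z - s z < a -> exists2 e, 0 < e &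
    forall w, enorm (w - z) < e -> enorm w < r /\ g w - s w < a.
  move=> zr za; have [Wz _] := inW z r rr0 zr.
  have := usc_u z Wz a; rewrite uE // lte_fin => /(_ za) /nbhs_enormP[e e0 eP].
  exists (Num.min e (r - enorm z)); first by rewrite lt_min e0 subr_gt0.
  move=> w; rewrite lt_min => /andP[we wr].
  have wr' : enorm w < r.
    by rewrite -(subrK z w) (le_lt_trans (ler_enormD _ _)) // -ltrBrDr.
  by split=> //; have := eP w we; rewrite uE ?lte_fin //; have [] := inW w r rr0 wr'.
have uscg : usc_on r g.
  move=> z a zr za; have [Wz _] := inW z r rr0 zr.
  have e0 : 0 < (a - g z) / 2 by rewrite divr_gt0 // subr_gt0.
  have [e1 e10 P1] := usc_gen z (g z - s z + (a - g z) / 2) zr (ltr_pwDr e0 (lexx _)).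
  have [cs _] := ss 0%N.
  have := cs _ Wz => /cvgrPdist_lt/(_ _ e0)/nbhs_enormP[e2 e20 P2].
  exists (Num.min e1 e2); first by rewrite lt_min e10.
  move=> w; rewrite lt_min => /andP[/P1[_ w1] /P2 w2].
  by move: w2; rewrite ltr_norml => /andP[w2 _]; clear -w1 w2; lra.
split=> // x z d xz zd.
have xr : enorm x < r by apply: le_lt_trans xz; rewrite lerDl enorm_ge0.
pose h (w : Cn R n) := if enorm w < r then g w - s w else 0.
have hM w : `|h w| <= M + (`|s 0| + L * rho).
  have M0 : 0 <= M := le_trans (normr_ge0 _) (gM 0).
  rewrite /h; case: ifP => [wr|_]; last first.
    by rewrite normr0 !addr_ge0 // mulr_ge0 // ltW.
  have [_ wrho] := inW w r rr0 wr.
  have h0 : enorm (0 : Cn R n) < rho by rewrite enorm0.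
  have := lip w 0 wrho h0; rewrite sub0r enormN => lw.
  rewrite (le_trans (ler_normB _ _)) // lerD //.
  rewrite -(subrK (s 0) (s w)) (le_trans (ler_normD _ _)) // addrC lerD2l.
  by rewrite (le_trans lw) // ler_wpM2l // ltW.
have usch : usc_on r h.
  move=> w a wr; rewrite {1}/h wr => wa; have [e e0 eP] := usc_gen w a wr wa.
  by exists e => // v /eP[vr va]; rewrite /h vr.
have C t : enorm (x + expi t *: z) < r := circle_in (norm_expi t) xz.
have [_ xrho] := inW x r rr0 xr.
under eq_integral do rewrite -addrA.
have -> : g x + M = h x + (s x + M) by rewrite /h xr addrA subrK.
apply: (circle_submean hM usch gM uscg xz).
  have Cz (v : R[i]) : `|v| <= 1 -> W (x + v *: z).
    by move=> v1; have [] := inW (x + v *: z) r rr0 (circle_in v1 xz).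
  have := sub_u x z Cz.
  have [Wx _] := inW x r rr0 xr.
  rewrite uE // -EFinM /h xr => /le_trans; apply.
  rewrite le_eqVlt; apply/orP; left; apply/eqP; apply: eq_integral => t _.
  by rewrite C uE //; have [] := inW _ r rr0 (C t).
move=> t; rewrite /h C.
suff : `|s x - s (x + expi t *: z)| <= L * d.
  by rewrite ler_norml => /andP[_ lipd]; clear -lipd; lra.
have [_ ctrho] := inW _ r rr0 (C t).
have := lip x _ xrho ctrho; rewrite [_ - x]addrC addKr enormZ_expi => /le_trans; apply.
exact: ler_wpM2l.
Qed.

End Local.

(** * Local and global estimates on the manifold *)

Section Distance.
Context (R : realType) (n : nat) (X : topologicalType) (S : complex_structure R n X).
Context (omega : hermitian_metric S) (X_hausdorff : hausdorff_space X).

Lemma geodesic_dist_ge0 x y : (0 <= geodesic_dist omega x y)%E.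
Proof. by apply: le_ereal_inf_tmp => _ [L /curve_length_ge0 L0 <-]; rewrite lee_fin. Qed.

Lemma geodesic_dist_fine x y (a : R) : (geodesic_dist omega x y <= a%:E)%E ->
  geodesic_dist omega x y = (fine (geodesic_dist omega x y))%:E /\ 0 <= fine (geodesic_dist omega x y).
Proof.
move=> da; have d0 := geodesic_dist_ge0 x y; split; last exact: fine_ge0.
by rewrite fineK // ge0_fin_numE // (le_lt_trans da) // ltry.
Qed.

(** The truncated distance vanishes at x and grows along a curve by at most k times its
    length; a geodesic distance below r / k therefore forces y into the part of the chart
    where the truncation is not active. *)
Lemma chart_dist_le (c : chart R n X) x0 R1 : atlas S c -> dom c x0 -> fwd c x0 = 0 -> 0 < R1 ->
  exists r k : R, [/\ 0 < r <= R1, 0 < k &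
    forall x y, dom c x -> enorm (fwd c x) < r -> (geodesic_dist omega x y < (r / k)%:E)%E ->
      dom c y /\ enorm (fwd c y - fwd c x) <= k * fine (geodesic_dist omega x y)].
Proof.
move=> Sc dx0 f0 R10.
have [[od oc] H1 _ _ _] := atlas_chart Sc.
have c0 : cod c 0 by rewrite -f0; have [] := H1 _ dx0.
have [rm rm0 [k k0 low]] := metric_lower omega Sc c0.
have /nbhs_enormP[rc rc0 rcP] : nbhs (0 : Cn R n) (cod c) by exact: open_nbhs_nbhs.
pose r := Num.min R1 (Num.min rm rc / 3).
have r0 : 0 < r by rewrite lt_min R10 divr_gt0 // lt_min rm0.
have r3 : 3 * r <= Num.min rm rc.
  by rewrite mulrC -ler_pdivlMr // ge_min lexx orbT.
exists r, k; split=> //; first by rewrite r0 ge_min lexx.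
have [r3m r3c] : 3 * r <= rm /\ 3 * r <= rc by move: r3; rewrite le_min => /andP[].
move=> x y dx xr dr.
have [dE dge0] := geodesic_dist_fine (ltW dr).
have ball_cod z : enorm z < 3 * r -> cod c z.
  by move=> zr; apply: rcP; rewrite subr0 (lt_le_trans zr).
have lower z v : enorm z < 3 * r -> enorm v <= k * hnorm (metric omega c z) v.
  by move=> zr; apply: low; rewrite subr0 (lt_le_trans zr).
have psix : trunc_dist c r x x = 0.
  by rewrite /trunc_dist; case: pselect => [? /=|//]; rewrite subrr enorm0; apply/min_idPl; exact: ltW.
have psiy : trunc_dist c r x y <= k * fine (geodesic_dist omega x y).
  rewrite -ler_pdivrMl // -lee_fin -dE mulrC; apply: le_ereal_inf_tmp => _ [L Lxy <-].
  rewrite lee_fin ler_pdivrMr // mulrC.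
  by have := trunc_dist_curve_length X_hausdorff Sc r0 k0 ball_cod lower xr Lxy; rewrite psix subr0.
have kd : k * fine (geodesic_dist omega x y) < r.
  by rewrite mulrC -ltr_pdivlMr // -lte_fin -dE.
have := le_lt_trans psiy kd; move: psiy; rewrite /trunc_dist.
case: pselect => [dy /=|?]; last by rewrite /= ltxx.
by rewrite minEle; case: ifP => _; rewrite ?ltxx.
Qed.

End Distance.

Section Holder.
Context (R : realType) (n : nat) (X : topologicalType) (S : complex_structure R n X).
Context (omega : hermitian_metric S) (X_hausdorff : hausdorff_space X).
Context (rho : Cn R n -> R) (rho_kernel : regularizing_kernel rho).
Context (l : R) (l_gt0 : 0 < l) (kappa : R -> R) (km : modulus_of_continuity l kappa).
Context (kappa_limsup : exists2 A : R, 0 < A &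
       (limf_esup (fun t : R =>
          ((4 * n%:R * kappa (A * t)) / (A * kappa t))%:E) 0^'+ < 1)%E).
Context (phi : X -> R) (M : R) (phiM : forall x, `|phi x| <= M).
Context (phi_psh : omega_psh omega phi).

(** A boundary point of the codomain is outside the ball of radius r0, hence at distance at
    least r0 / 2 from z. *)
Lemma ball_chart_shrink (c : chart R n X) (r0 d : R) z : is_chart c ->
  (forall w, enorm w < r0 -> cod c w) -> enorm z < r0 / 2 -> 0 < d < r0 / 2 ->
  chart_shrink c d (bwd c z).
Proof.
move=> [[_ oc] _ H2 _ _] Bc zr /andP[d0 dr].
have r0E : r0 / 2 + r0 / 2 = r0 by rewrite -splitr.
have cz : cod c z by apply: Bc; rewrite (lt_trans zr) // -[ltRHS]r0E ltrDl (lt_trans d0).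
have [dz fz] := H2 z cz.
split=> //; rewrite fz; split=> //.
apply: (@lt_le_trans _ _ (r0 / 2)%:E); first by rewrite lte_fin.
apply: le_ereal_inf_tmp => _ [w [_ nw] <-]; rewrite lee_fin leNgt; apply/negP => zw.
apply: nw; apply: open_nbhs_nbhs; split=> //; apply: Bc.
rewrite -(subrK z w) (le_lt_trans (ler_enormD _ _)) // -r0E ltrD //.
by rewrite enormB.
Qed.

(** [local_modulus] gives a one-sided estimate; it is symmetric in the two points. *)
Lemma chart_modulus (c : chart R n X) (C1 d1 : R) x0 : (0 < n)%N ->
  centered_chart S x0 c -> 0 < C1 -> 0 < d1 ->
  (forall d, 0 < d < d1 -> forall x, chart_shrink c d x ->
     local_regularization rho c d phi x - phi x <= C1 * kappa d) ->
  exists a Q t0 : R, [/\ 0 < a, 0 <= Q, 0 < t0 <= l & forall x y, dom c x -> dom c y ->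
    enorm (fwd c x) < a -> enorm (fwd c y) < a -> enorm (fwd c y - fwd c x) <= t0 ->
    `|phi x - phi y| <= Q * kappa (enorm (fwd c y - fwd c x))].
Proof.
move=> n0 [Sc dx0 f0 _ _] C10 d10 reg.
have ch := atlas_chart Sc; have [[od oc] H1 H2 _ cb] := ch.
have [c0 b0] := H1 _ dx0; rewrite f0 in c0 b0.
have [V [s [u [[oV Vx0] /(_ c Sc) ss /(_ c Sc) pu phiE]]]] := phi_psh.1 x0.
set W := [set z | cod c z /\ V (bwd c z)] in ss pu.
have nc : nbhs (0 : Cn R n) (cod c) by exact: open_nbhs_nbhs.
have nW : nbhs (0 : Cn R n) W.
  apply: filterI => //; apply: (cb _ c0); rewrite b0.
  exact: open_nbhs_nbhs.
have gE z : W z -> ((phi \o bwd c) z)%:E = ((s \o bwd c) z)%:E + (u \o bwd c) z.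
  by move=> [_]; exact: phiE.
have [r1 r10 [L L0 P]] := quasi_psh_local nW ss pu gE (fun z => phiM (bwd c z)).
have /nbhs_enormP[rc rc0 rcP] := nc.
pose r0 := Num.min r1 rc.
have r00 : 0 < r0 by rewrite lt_min r10.
have [|usc sub] := P r0; first by rewrite ge_min lexx.
have Bc w : enorm w < r0 -> cod c w.
  by rewrite lt_min => /andP[_ wr]; apply: rcP; rewrite subr0.
have d20 : 0 < Num.min d1 (r0 / 2) by rewrite lt_min d10 divr_gt0.
have regB x d : enorm x < r0 / 2 -> 0 < d < Num.min d1 (r0 / 2) ->
    regularization rho d (phi \o bwd c) x - (phi \o bwd c) x <= C1 * kappa d.
  rewrite lt_min => xr /and3P[dd0 dd1 dr].
  have cx : chart_shrink c d (bwd c x).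
    by apply: (ball_chart_shrink ch Bc xr); rewrite dd0.
  have := reg d _ (bwd c x) cx; rewrite dd0 dd1 => /(_ isT).
  have cx' : cod c x.
    by apply: Bc; rewrite (lt_trans xr) // ltr_pdivrMr // ltr_pMr // ltr1n.
  by rewrite /local_regularization; have [_ ->] := H2 x cx'.
have [Q [t0 [Q0 t00 H]]] := local_modulus rho_kernel l_gt0 km n0 kappa_limsup
  (fun z => phiM (bwd c z)) r00 L0 (ltW C10) d20 usc sub regB.
exists (r0 / 4), Q, t0; split=> //; first by rewrite divr_gt0.
move=> x y dx dy xr yr xy.
have [_ bx] := H1 x dx; have [_ by'] := H1 y dy.
have := H _ _ xr yr xy; have := H _ _ yr xr; rewrite enormB => /(_ xy).
rewrite /= bx by' => h1 h2.
by rewrite ler_norml h1 andbT lerNl opprB.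
Qed.

(** The case n = 0 needs no analysis, since then a chart is a single point. Otherwise kappa
    (k t) <= N kappa t for an integer N >= k trades the chart distance for the geodesic
    distance. *)
Lemma local_holder (c : chart R n X) (C1 d1 : R) x0 :
  centered_chart S x0 c -> 0 < C1 -> 0 < d1 ->
  (forall d, 0 < d < d1 -> forall x, chart_shrink c d x ->
     local_regularization rho c d phi x - phi x <= C1 * kappa d) ->
  exists2 U : set X, nbhs x0 U & exists e Q : R, [/\ 0 < e, e <= l, 0 <= Q &
    forall x y, U x -> (geodesic_dist omega x y <= e%:E)%E ->
      `|phi x - phi y| <= Q * kappa (fine (geodesic_dist omega x y))].
Proof.
move=> cc C10 d10 reg; have [Sc dx0 f0 _ _] := cc.
have ch := atlas_chart Sc; have [[od oc] H1 H2 cf _] := ch.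
have [a [Q [t0 [a0 Q0 t00 mod]]]] : exists a Q t0 : R, [/\ 0 < a, 0 <= Q, 0 < t0 <= l &
  forall x y, dom c x -> dom c y ->
    enorm (fwd c x) < a -> enorm (fwd c y) < a -> enorm (fwd c y - fwd c x) <= t0 ->
    `|phi x - phi y| <= Q * kappa (enorm (fwd c y - fwd c x))].
  have [n0|n0] := posnP n; last exact: (chart_modulus n0 cc C10 d10 reg).
  exists 1, 0, l; split=> //; first by rewrite l_gt0 lexx.
  move=> x y dx dy _ _ _; rewrite mul0r.
  have [_ <-] := H1 x dx; have [_ <-] := H1 y dy.
  have -> : fwd c x = fwd c y 
    by apply/rowP => j; have := leq_trans (ltn_ord j) (eq_leq n0); rewrite ltn0.
  by rewrite subrr normr0.
have [r [k [/andP[r0 ra] k0 near]]] := chart_dist_le omega X_hausdorff Sc dx0 f0 (divr_gt0 a0 (ltr0n R 2)).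
pose N := (Num.bound k).+1.
have kN : k <= N%:R by rewrite /N -natr1 ler_wpDr // ltW // archi_boundP // ltW.
have N0 : 0 < N%:R :> R by rewrite ltr0n.
have N1 : 1 <= N%:R :> R by rewrite ler1n.
clearbody N; move/andP: t00 => [t00 t0l].
pose e := Num.min (r / (2 * k)) (t0 / N%:R).
have e0 : 0 < e by rewrite lt_min !divr_gt0 // mulr_gt0.
have eN : N%:R * e <= t0 by rewrite mulrC -ler_pdivlMr // ge_min lexx orbT.
have ek : k * e <= r / 2.
  by rewrite mulrC -ler_pdivlMr // -mulrA -invfM ge_min lexx.
have el : e <= l.
  by apply: le_trans t0l; apply: le_trans eN; rewrite ler_peMl // ltW.
exists [set x | dom c x /\ enorm (fwd c x) < r].
  apply: filterI; first exact: open_nbhs_nbhs.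
  have nr : nbhs (fwd c x0) [set w | enorm w < r].
    by apply/nbhs_enormP; exists r => // w; rewrite f0 subr0.
  exact: (cf _ dx0 _ nr).
exists e, (Q * N%:R); split=> //; first by rewrite mulr_ge0 // ltW.
move=> x y [dx xr] xy.
have [dE] := geodesic_dist_fine xy; have := near x y dx xr.
rewrite dE !lte_fin /=; move: xy; rewrite dE lee_fin /=.
set t := fine _ => te nr tge0.
have kt : k * t <= r / 2 by apply: le_trans ek; rewrite ler_pM2l.
have [|dy E] := nr.
  rewrite ltr_pdivlMr // mulrC (le_lt_trans kt) // ltr_pdivrMr // ltr_pMr // ltr1n.
  by [].
have Nt : N%:R * t <= t0 by apply: le_trans eN; rewrite ler_pM2l.
have ktN : k * t <= N%:R * t by exact: ler_wpM2r.
have aE : a / 2 + a / 2 = a by rewrite -splitr.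
have Er : enorm (fwd c y - fwd c x) <= a / 2.
  by rewrite (le_trans E) // (le_trans kt) // (le_trans _ ra) // ler_pdivrMr // ler_pMr // ler1n.
apply: (le_trans (mod x y dx dy _ _ _)).
- by rewrite (lt_le_trans xr) // (le_trans ra) // ler_pdivrMr // ler_pMr // ler1n.
- rewrite -(subrK (fwd c x) (fwd c y)) (le_lt_trans (ler_enormD _ _)) // -aE ler_ltD //.
  exact: lt_le_trans xr ra.
- by rewrite (le_trans E) // (le_trans ktN).
rewrite -mulrA; apply: ler_wpM2l => //.
apply: le_trans (kappa_natM km tge0 (le_trans Nt t0l)).
apply: (modulus_le km); first exact: enorm_ge0.
  exact: le_trans E ktN.
exact: le_trans Nt t0l.
Qed.

End Holder.

Theorem theorem3p4 (R : realType) (n : nat) (X : topologicalType)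
    (S : complex_structure R n X) (omega : hermitian_metric S)
    (X_hausdorff : hausdorff_space X) (X_compact : compact [set: X])
    (rho : Cn R n -> R) (rho_kernel : regularizing_kernel rho)
    (l : R) (l_gt0 : 0 < l) (kappa : R -> R)
    (kappa_modulus : modulus_of_continuity l kappa)
    (kappa_limsup : exists2 A : R, 0 < A &
       (limf_esup (fun t : R =>
          ((4 * n%:R * kappa (A * t)) / (A * kappa t))%:E) 0^'+ < 1)%E)
    (phi : X -> R) (phi_bounded : exists M : R, forall x, `|phi x| <= M)
    (phi_psh : omega_psh omega phi)
    (phi_regularization : forall x0 : X,
       exists (c : chart R n X) (C1 delta1 : R),
         [/\ centered_chart S x0 c, 0 < C1, 0 < delta1 < 1, delta1 <= l &
             forall delta : R, 0 < delta < delta1 ->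
             forall x : X, chart_shrink c delta x ->
               local_regularization rho c delta phi x - phi x
                 <= C1 * kappa delta]) :
  exists2 C2 : R, 0 < C2 &
    forall x y : X, (geodesic_dist omega x y <= l%:E)%E ->
      `|phi x - phi y| <= C2 * kappa (fine (geodesic_dist omega x y)).

Proof.
have [M phiM] := phi_bounded.
pose d x y := fine (geodesic_dist omega x y).
(* One integer serves as the constant and as the inverse of the admissible distance, so that
   P is a property along a filter, and the uniformity over X is an instance of near-covering
   compactness. *)
pose P (N : nat) (x : X) := forall y, (geodesic_dist omega x y <= (N.+1%:R^-1)%:E)%E ->
  `|phi x - phi y| <= N%:R * kappa (d x y).
have cover : \forall N \near \oo, [set: X] `<=` P N.
  apply: (compact_near_coveringP [set: X]).1 => // x0 _.
  have [c [C1 [d1 [cc C10 /andP[d10 _] _ reg]]]] := phi_regularization x0.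
  have [U nU [e [Q [e0 el Q0 H]]]] := local_holder X_hausdorff rho_kernel l_gt0 kappa_modulus
    kappa_limsup phiM phi_psh cc C10 d10 reg.
  have nI : \forall N \near \oo, (N.+1%:R^-1 < e) && (Q <= N%:R).
    near=> N; apply/andP; split.
      near: N; exact: near_infty_natSinv_lt (PosNum e0).
    near: N; exact: nbhs_infty_ger.
  exists (U, [set N : nat | (N.+1%:R^-1 < e) && (Q <= N%:R)]) => //.
  move=> [x N] /= [Ux /andP[Ne QN]] y xy.
  have xye : (geodesic_dist omega x y <= e%:E)%E by rewrite (le_trans xy) // lee_fin ltW.
  have [dE dge0] := geodesic_dist_fine xy.
  apply: (le_trans (H x y Ux xye)); apply: ler_wpM2r => //.
  apply: (kappa_ge0 kappa_modulus); rewrite dge0 (le_trans _ el) //.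
  by rewrite -lee_fin -dE.
have [N0 _ N0P] := cover.
have [N1 _ N1P] := near_infty_natSinv_lt (PosNum l_gt0).
pose N := maxn N0 N1.
have PN x : P N x by apply: N0P => //=; rewrite leq_maxl.
pose e : R := N.+1%:R^-1.
have e0 : 0 < e by rewrite invr_gt0.
have el : e <= l by apply: ltW; apply: N1P; rewrite /= leq_maxr.
have ke0 : 0 < kappa e by exact: (modulus_gt0 kappa_modulus).
exists (N%:R + 2 * `|M| / kappa e + 1).
  by rewrite ltr_wpDl // addr_ge0 // divr_ge0 // ?mulr_ge0 // ltW.
move=> x y xy; have [dE dge0] := geodesic_dist_fine xy.
have dl : fine (geodesic_dist omega x y) <= l by rewrite -lee_fin -dE.
have k0 : 0 <= kappa (d x y) by apply: (kappa_ge0 kappa_modulus); rewrite dge0.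
have A0 : 0 <= 2 * `|M| / kappa e by rewrite divr_ge0 ?mulr_ge0 // ltW.
(* For distances above e, the oscillation 2 M of phi is at most (2 M / kappa e) kappa (d x
   y). *)
have [de|de] := leP (d x y) e.
  have := PN x y; rewrite dE lee_fin => /(_ de)/le_trans; apply.
  by apply: ler_wpM2r => //; rewrite -addrA lerDl addr_ge0.
apply: (@le_trans _ _ (2 * `|M| / kappa e * kappa (d x y))); last first.
  by apply: ler_wpM2r => //; rewrite [N%:R + _]addrC -addrA lerDl addr_ge0.
apply: (@le_trans _ _ (2 * `|M|)).
  rewrite (le_trans (ler_normB _ _)) // mulr_natl mulr2n lerD //.
    by rewrite (le_trans (phiM x)) // ler_norm.
  by rewrite (le_trans (phiM y)) // ler_norm.
rewrite -mulrA ler_peMr ?mulr_ge0 // mulrC ler_pdivlMr // mul1r.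
by apply: (modulus_le kappa_modulus); [exact: ltW|exact: ltW|exact: dl].
Unshelve. all: by end_near.
Qed.
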